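(* Let $m\ge 1$. Then: (1) $\mathrm{GL}_\infty(\mathbb S_m)=U(K)\ltimes E_\infty(\mathbb S_m)$, and $E_\infty(\mathbb S_m)=\ker(\overline{\det})$. More precisely, $\overline{\det}:\mathrm{GL}_\infty(\mathbb S_m)\to K^*$ is a surjective group homomorphism, and every $a\in \mathrm{GL}_\infty(\mathbb S_m)$ is the unique product $a=\mu(\lambda)\,e$ with $\lambda=\overline{\det}(a)\in K^*$ and $e=\mu(\overline{\det}(a))^{-1}a\in E_\infty(\mathbb S_m)$. (2) $\mathrm{K}_1(\mathbb S_m)\simeq K^*$.
   Context: $K$ is a field with unit group $K^*$. For $m\ge1$, $\mathbb S_m$ is the $K$-algebra generated by $x_1,\dots,x_m,y_1,\dots,y_m$ subject to the defining relations $y_ix_i=1$ for all $i$, and $[x_i,y_j]=[x_i,x_j]=[y_i,y_j]=0$ for all $i\neq j$ (where $[a,b]=ab-ba$). For $1\le i\le m$ let $E_{00}(i):=1-x_iy_i$; let $\mathfrak a_m$ be the ideal of $\mathbb S_m$ generated by $E_{00}(1),\dots,E_{00}(m)$. Then $\mathbb S_m/\mathfrak a_m\simeq L_m:=K[x_1^{\pm1},\dots,x_m^{\pm1}]$ (Laurent polynomial algebra, $x_i\mapsto x_i$, $y_i\mapsto x_i^{-1}$). For a ring $A$, $\mathrm{GL}_\infty(A)=\bigcup_d \mathrm{GL}_d(A)$ is the group of invertible $\mathbb N\times\mathbb N$ matrices over $A$ differing from the identity in finitely many entries, and $E_\infty(A)$ is its subgroup generated by the elementary matrices $1+aE_{ij}$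 ($a\in A$, $i\ne j$); $\mathrm{K}_1(A)=\mathrm{GL}_\infty(A)/E_\infty(A)$. $\overline{\det}:\mathrm{GL}_\infty(\mathbb S_m)\to L_m^*$ is the composition of the map $\mathrm{GL}_\infty(\mathbb S_m)\to \mathrm{GL}_\infty(L_m)$ induced by $\mathbb S_m\to\mathbb S_m/\mathfrak a_m=L_m$ with the determinant $\mathrm{GL}_\infty(L_m)\to L_m^*$. For $\lambda\in K^*$, $\mu(\lambda):=\mathrm{diag}(\lambda,1,1,\dots)$ and $U(K):=\{\mu(\lambda):\lambda\in K^*\}\simeq K^*$. *)

(* Defs.v *)
From HB Require Import structures.
From mathcomp Require Import all_boot all_order all_algebra.
Set Implicit Arguments. Unset Strict Implicit. Unset Printing Implicit Defensive.
Import Order.TTheory GRing.Theory.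
Local Open Scope ring_scope.

Definition Sm_relations (R : pzRingType) (m : nat) (x y : 'I_m -> R) : Prop :=
  (forall i, y i * x i = 1) /\
  (forall i j, i != j ->
     [/\ x i * y j = y j * x i, x i * x j = x j * x i & y i * y j = y j * y i]).

(* S together with x, y : 'I_m -> S is (a model of) the K-algebra S_m,
   i.e. it is the K-algebra presented by the generators x_i, y_i and the
   relations above: the relations hold, and for every K-algebra R with a
   family satisfying the relations there is a unique K-algebra morphism
   S -> R sending x_i, y_i to that family. *)
Definition is_Sm (K : fieldType) (m : nat) (S : algType K)
    (x y : 'I_m -> S) : Prop :=
  Sm_relations x y /\
  forall (R : algType K) (a b : 'I_m -> R), Sm_relations a b ->
    exists f : {lrmorphism S -> R},
      (forall i, f (x i) = a i /\ f (y i) = b i) /\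
      (forall g : {lrmorphism S -> R},
         (forall i, g (x i) = a i /\ g (y i) = b i) -> forall s, g s = f s).

(* L with X : 'I_m -> L is (a model of) L_m = K[X_1^{+-1},...,X_m^{+-1}],
   i.e. the commutative K-algebra freely generated by the units X_i. *)
Definition is_Laurent (K : fieldType) (m : nat) (L : comUnitAlgType K)
    (X : 'I_m -> L) : Prop :=
  (forall i, X i \is a GRing.unit) /\
  forall (R : comUnitAlgType K) (u : 'I_m -> R),
    (forall i, u i \is a GRing.unit) ->
    exists f : {lrmorphism L -> R},
      (forall i, f (X i) = u i) /\
      (forall g : {lrmorphism L -> R},
         (forall i, g (X i) = u i) -> forall l, g l = f l).

(* Elements of GL_infinity(A) are represented by invertible n x n matrices
   (GL_n(A) embedded in GL_infinity(A) via a |-> diag(a, 1, 1, ...)). *)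
Definition invertible_mx (A : pzRingType) (n : nat) (a : 'M[A]_n) : Prop :=
  exists b : 'M[A]_n, a *m b = 1%:M /\ b *m a = 1%:M.

Definition elementary_mx (A : pzRingType) (n : nat) (e : 'M[A]_n) : Prop :=
  exists (i j : 'I_n) (c : A), i != j /\ e = 1%:M + c *: delta_mx i j.

Inductive Eprod (A : pzRingType) (n : nat) : 'M[A]_n -> Prop :=
  | Eprod1 : Eprod (1%:M : 'M[A]_n)
  | EprodM (e a : 'M[A]_n) : elementary_mx e -> Eprod a -> Eprod (e *m a).

Definition in_Einf (A : pzRingType) (n : nat) (a : 'M[A]_n) : Prop :=
  exists k : nat, Eprod (block_mx a 0 0 1%:M : 'M[A]_(n + k)).

Definition mu (K : fieldType) (S : algType K) (n : nat) (l : K) : 'M[S]_n.+1 :=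
  \matrix_(i, j) (if i == j then (if i == ord0 then l%:A else 1) else 0).

Definition detbar (K : fieldType) (S : algType K) (L : comUnitAlgType K)
    (pi : S -> L) (n : nat) (a : 'M[S]_n) : L :=
  \det (map_mx pi a).

(* Main.v *)
Require Import Defs.
From HB Require Import structures.
From mathcomp Require Import all_boot all_order all_algebra.
From mathcomp Require Import boolp generic_quotient finmap zify.
From mathcomp.multinomials Require Import monalg.
Set Implicit Arguments. Unset Strict Implicit. Unset Printing Implicit Defensive.
Import GRing.Theory.
Local Open Scope ring_scope.
Local Open Scope quotient_scope.

(* Write T(A) for the Toeplitz ring A<x, y | y x = 1>, with x and y commuting with A.
   Then S_m is T applied m times to K; it is realised as the monoid ring over K of the
   m-th power of the bicyclic monoid.  By induction on m, for all fields at once, every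
   class of K_1(S_m) comes from K^*; the determinant over L_m then detects that scalar.

   For the induction step let A be the monoid ring over K, R = A[t, 1/t] the quotient of
   T(A) by the ideal of e = 1 - x y, and A_F the monoid ring over F = K(t).

   - K_1(R) -> K_1(A_F) is injective.  Let a in GL(R) be a product of elementary matrices
     over A_F.  Let R act on M = R[s, 1/s] through t -> s, where M is a free right
     R-module through t.  Division with remainder by polynomials f(s) lifts each
     elementary factor to an operator on M, and the product theta of the lifts is
     a w with w a finite rank perturbation of 1.  Let X = s - t, Y the division by X and
     E = 1 - X Y the evaluation s -> t.  Then theta -> X theta Y + E is multiplicative,
     and theta^-1 (X theta Y + E) is a finite rank perturbation of 1, whose class in
     K_1(R) is 0 for lifts of elementary matrices and for w, but -[a] for a.  So [a] = 0.

   - K_1(T(A)) -> K_1(R) is injective.  By [1 + u v] = [1 + v u] a class in the kernel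
     moves into the corner e T(A) e = e A, where it is the class of some 1 + e (D - 1);
     and this is trivial, by conjugating diag(D^-1, 1) with [[x, e], [0, y]].

   - So g in GL(T(A)) has in K_1(R) the class of some l t^k.  If k > 0 (otherwise replace g
     by its inverse), map A to K: up to elementary matrices y^k g is 1 + C with C over the
     ideal of e, and it has a right inverse.  Such an inverse is two-sided since K is stably
     finite, which would give x^k y^k = 1.  Hence k = 0. *)

(** * Matrices and products of elementary matrices *)

Reserved Notation "a <+> b" (at level 51, left associativity).
Notation "a <+> b" := (block_mx a 0 0 b) : ring_scope.

Lemma scalar_mx_comm (A : pzRingType) n p (x : A) (a : 'M_(n, p)) :
  (forall i j, GRing.comm x (a i j)) -> x%:M *m a = a *m x%:M.
Proof.
move=> xa; rewrite mul_scalar_mx; apply/matrixP=> i j; rewrite !mxE (bigD1 j) //=.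
rewrite big1 => [|k /negbTE kj]; first by rewrite mxE eqxx mulr1n addr0 xa.
by rewrite mxE kj mulr0n mulr0.
Qed.

Section MutuallyInverse.
Variable A : pzRingType.

Definition inverse_mx n (a b : 'M[A]_n) : Prop := a *m b = 1%:M /\ b *m a = 1%:M.

Lemma inverse_mx_sym n (a b : 'M[A]_n) : inverse_mx a b -> inverse_mx b a.
Proof. by case=> ab ba; split. Qed.

Lemma inverse_mx1 n : inverse_mx (1%:M : 'M[A]_n) 1%:M.
Proof. by split; rewrite mulmx1. Qed.

Lemma mulmxK_inverse m n p (a : 'M[A]_(m, n)) (b : 'M[A]_(n, m)) (c : 'M[A]_(p, m)) :
  a *m b = 1%:M -> c *m a *m b = c.
Proof. by move=> ab; rewrite -mulmxA ab mulmx1. Qed.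

Lemma mulKmx_inverse m n p (a : 'M[A]_(m, n)) (b : 'M[A]_(n, m)) (c : 'M[A]_(m, p)) :
  a *m b = 1%:M -> a *m (b *m c) = c.
Proof. by move=> ab; rewrite mulmxA ab mul1mx. Qed.

Lemma mulmx_sub1 n (a b : 'M[A]_n) :
  a *m b - 1%:M = (b - 1%:M) + ((a - 1%:M) + (a - 1%:M) *m (b - 1%:M)).
Proof.
rewrite mulmxBr mulmx1 mulmxBl mul1mx [X in _ = _ + X]addrC subrK [RHS]addrC.
by rewrite addrA subrK.
Qed.

Lemma inverse_mxM n (a a' b b' : 'M[A]_n) :
  inverse_mx a a' -> inverse_mx b b' -> inverse_mx (a *m b) (b' *m a').
Proof.
move=> [aa' a'a] [bb' b'b].
by split; rewrite mulmxA ?(mulmxK_inverse _ bb') ?(mulmxK_inverse _ a'a).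
Qed.

Lemma inverse_mx_scalar n (a b : A) : a * b = 1 -> b * a = 1 ->
  inverse_mx (a%:M : 'M_n) b%:M.
Proof. by move=> ab ba; split; rewrite -scalar_mxM ?ab ?ba. Qed.

Lemma mulmx_dsum m n (a c : 'M[A]_m) (b d : 'M[A]_n) :
  (a <+> b) *m (c <+> d) = (a *m c) <+> (b *m d).
Proof. by rewrite mulmx_block !mul0mx !mulmx0 !addr0 !add0r. Qed.

Lemma dsum1 m n : 1%:M <+> 1%:M = 1%:M :> 'M[A]_(m + n).
Proof. by rewrite -scalar_mx_block. Qed.

Lemma inverse_mx_dsum m n (a a' : 'M[A]_m) (b b' : 'M[A]_n) :
  inverse_mx a a' -> inverse_mx b b' -> inverse_mx (a <+> b) (a' <+> b').
Proof.
by move=> [aa' a'a] [bb' b'b]; split; rewrite mulmx_dsum ?aa' ?bb' ?a'a ?b'b dsum1.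
Qed.

Lemma invertible_mx1 n : invertible_mx (1%:M : 'M[A]_n).
Proof. by exists 1%:M; apply: inverse_mx1. Qed.

Lemma invertible_mxM n (a b : 'M[A]_n) :
  invertible_mx a -> invertible_mx b -> invertible_mx (a *m b).
Proof. by move=> [a' aa'] [b' bb']; exists (b' *m a'); apply: inverse_mxM. Qed.

Lemma invertible_mx_scalar n (a b : A) : a * b = 1 -> b * a = 1 ->
  invertible_mx (a%:M : 'M_n).
Proof. by move=> ab ba; exists b%:M; apply: inverse_mx_scalar. Qed.

Lemma invertible_mx_dsum m n (a : 'M[A]_m) (b : 'M[A]_n) :
  invertible_mx a -> invertible_mx b -> invertible_mx (a <+> b).
Proof. by move=> [a' aa'] [b' bb']; exists (a' <+> b'); apply: inverse_mx_dsum. Qed.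

Lemma invertible_mx_dsumr m n (a : 'M[A]_m) (b : 'M[A]_n) :
  invertible_mx (a <+> b) -> invertible_mx b.
Proof.
case=> c [abc cab]; exists (drsubmx c); split.
  have := congr1 drsubmx abc; rewrite -{1}[c]submxK mulmx_block -dsum1 !block_mxKdr.
  by rewrite mul0mx add0r.
have := congr1 drsubmx cab; rewrite -{1}[c]submxK mulmx_block -dsum1 !block_mxKdr.
by rewrite mulmx0 add0r.
Qed.

Section AddOneSwap.
Variables (m n : nat) (u : 'M[A]_(m, n)) (v : 'M[A]_(n, m)) (c : 'M[A]_m).

Lemma add1mulmx_rinv_swap : (1%:M + u *m v) *m c = 1%:M ->
  (1%:M + v *m u) *m (1%:M - v *m c *m u) = 1%:M.
Proof.
move=> ac; have uvc : u *m v *m c = 1%:M - c by rewrite -ac mulmxDl mul1mx addrAC subrr add0r.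
have vuvcu : v *m u *m (v *m c *m u) = v *m (u *m v *m c) *m u by rewrite !mulmxA.
rewrite mulmxBr mulmx1 mulmxDl mul1mx vuvcu uvc mulmxBr mulmx1 mulmxBl [X in _ - X]addrC.
by rewrite subrK addrK.
Qed.

Lemma add1mulmx_linv_swap : c *m (1%:M + u *m v) = 1%:M ->
  (1%:M - v *m c *m u) *m (1%:M + v *m u) = 1%:M.
Proof.
move=> ca; have cuv : c *m (u *m v) = 1%:M - c by rewrite -ca mulmxDr mulmx1 addrAC subrr add0r.
have vcuvu : v *m c *m u *m (v *m u) = v *m (c *m (u *m v)) *m u by rewrite !mulmxA.
rewrite mulmxBl mul1mx mulmxDr mulmx1 vcuvu cuv mulmxBr mulmx1 mulmxBl [X in _ - X]addrC.
by rewrite subrK addrK.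
Qed.

End AddOneSwap.

Lemma invertible_add1mulmx_swap m n (u : 'M[A]_(m, n)) (v : 'M[A]_(n, m)) :
  invertible_mx (1%:M + u *m v) -> invertible_mx (1%:M + v *m u).
Proof.
case=> c [ac ca]; exists (1%:M - v *m c *m u).
by split; [apply: add1mulmx_rinv_swap|apply: add1mulmx_linv_swap].
Qed.

End MutuallyInverse.

Lemma inverse_mx_map (A B : pzRingType) (f : {rmorphism A -> B}) n (a b : 'M[A]_n) :
  inverse_mx a b -> inverse_mx (map_mx f a) (map_mx f b).
Proof. by move=> [ab ba]; split; rewrite -map_mxM ?ab ?ba map_mx1. Qed.

Lemma invertible_mx_map (A B : pzRingType) (f : {rmorphism A -> B}) n (a : 'M[A]_n) :
  invertible_mx a -> invertible_mx (map_mx f a).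
Proof. by move=> [b ab]; exists (map_mx f b); apply: inverse_mx_map. Qed.

Section ElementaryProducts.
Variable A : pzRingType.

Lemma Eprod_elementary n (e : 'M[A]_n) : elementary_mx e -> Eprod e.
Proof. by move=> elem_e; rewrite -[e]mulmx1; apply: EprodM => //; apply: Eprod1. Qed.

Lemma Eprod_mulmx n (a b : 'M[A]_n) : Eprod a -> Eprod b -> Eprod (a *m b).
Proof.
move=> Ea Eb; elim: Ea => [|e c elem_e _ IHc]; first by rewrite mul1mx.
by rewrite -mulmxA; apply: EprodM.
Qed.

Section OffDiagonal.
Variables (n : nat) (P : pred 'I_n).

Definition offdiag (u : 'M[A]_n) : Prop := forall i j, ~~ (P i && ~~ P j) -> u i j = 0.

Lemma offdiag_mulmx (u v : 'M[A]_n) : offdiag u -> offdiag v -> u *m v = 0.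
Proof.
move=> Pu Pv; apply/matrixP=> i j; rewrite !mxE big1 // => k _.
have [Pk|nPk] := boolP (P k); first by rewrite Pu ?mul0r // Pk andbF.
by rewrite Pv ?mulr0 // (negbTE nPk).
Qed.

Lemma inverse_mx_offdiag (u : 'M[A]_n) : offdiag u -> inverse_mx (1%:M + u) (1%:M - u).
Proof.
move=> Pu; have uu := offdiag_mulmx Pu Pu.
by split; rewrite !(mulmxDl, mulmxDr, mulmxN, mulNmx, mul1mx, mulmx1) uu oppr0 addr0
                  ?addrK ?subrK.
Qed.

Lemma Eprod_offdiag (u : 'M[A]_n) : offdiag u -> Eprod (1%:M + u).
Proof.
move=> Pu; pose E v := offdiag v /\ Eprod (1%:M + v).
suff [] : E u by [].
have E0 : E 0 by split=> [i j _|]; rewrite ?mxE // addr0; apply: Eprod1.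
have ED v w : E v -> E w -> E (v + w).
  move=> [Pv Ev] [Pw Ew]; split=> [i j Pij|]; first by rewrite mxE Pv // Pw // addr0.
  have -> : 1%:M + (v + w) = (1%:M + v) *m (1%:M + w).
    by rewrite mulmxDl mul1mx mulmxDr mulmx1 offdiag_mulmx // addr0 -addrA [v + w]addrC.
  exact: Eprod_mulmx.
rewrite [u]matrix_sum_delta; apply: (big_ind E) => // i _; apply: (big_ind E) => // j _.
have [/andP[Pi nPj]|/Pu->] := boolP (P i && ~~ P j); last by rewrite scale0r.
split=> [k l nPkl|].
  rewrite !mxE; case: eqP nPkl => [->|_ _] /=; last by rewrite mulr0.
  by case: eqP => [->|_ _]; rewrite ?Pi ?nPj ?mulr0.
by apply: Eprod_elementary; exists i, j, (u i j); split=> //; apply: contraNneq nPj => <-.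
Qed.

End OffDiagonal.

Lemma elementary_inverse n (i j : 'I_n) (c : A) : i != j ->
  inverse_mx (1%:M + c *: delta_mx i j) (1%:M - c *: delta_mx i j).
Proof.
move=> ij; apply: (inverse_mx_offdiag (P := pred1 i)) => k l.
rewrite !mxE /= negb_and negbK; case: (eqVneq k i) => [_ /eqP->|]; rewrite ?mulr0 //.
by rewrite (negbTE ij) mulr0.
Qed.

Lemma Eprod_inverse n (a : 'M[A]_n) : Eprod a -> exists2 b, Eprod b & inverse_mx a b.
Proof.
elim=> [|_ c [i [j [t [ij ->]]]] _ [b Eb cb]].
  by exists 1%:M; [apply: Eprod1|apply: inverse_mx1].
exists (b *m (1%:M - t *: delta_mx i j)); last exact: inverse_mxM (elementary_inverse t ij) cb.
by apply: Eprod_mulmx => //; apply: Eprod_elementary; exists i, j, (- t); rewrite scaleNr.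
Qed.

Lemma invertible_Eprod n (e : 'M[A]_n) : Eprod e -> invertible_mx e.
Proof. by case/Eprod_inverse=> b _ eb; exists b. Qed.

Lemma offdiag_upper m n (u : 'M[A]_(m, n)) :
  offdiag (fun i : 'I_(m + n) => i < m)%N (block_mx 0 u 0 0).
Proof.
move=> i j; case: (split_ordP i) => i' ->; case: (split_ordP j) => j' ->;
  by rewrite ?block_mxEul ?block_mxEur ?block_mxEdl ?block_mxEdr ?mxE //= ltn_ord ltnNge leq_addr.
Qed.

Lemma offdiag_lower m n (u : 'M[A]_(n, m)) :
  offdiag (fun i : 'I_(m + n) => m <= i)%N (block_mx 0 0 u 0).
Proof.
move=> i j; case: (split_ordP i) => i' ->; case: (split_ordP j) => j' ->;
  by rewrite ?block_mxEul ?block_mxEur ?block_mxEdl ?block_mxEdr ?mxE //= leq_addr leqNgt ltn_ord.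
Qed.

Lemma Eprod_upper m n (u : 'M[A]_(m, n)) : Eprod (block_mx 1%:M u 0 1%:M).
Proof.
have -> : block_mx 1%:M u 0 1%:M = 1%:M + block_mx 0 u 0 0.
  by rewrite -dsum1 add_block_mx !addr0 add0r.
exact/Eprod_offdiag/offdiag_upper.
Qed.

Lemma Eprod_lower m n (u : 'M[A]_(n, m)) : Eprod (block_mx 1%:M 0 u 1%:M).
Proof.
have -> : block_mx 1%:M 0 u 1%:M = 1%:M + block_mx 0 0 u 0.
  by rewrite -dsum1 add_block_mx !addr0 add0r.
exact/Eprod_offdiag/offdiag_lower.
Qed.

Lemma Eprod_dsum1 n k (a : 'M[A]_n) : Eprod a -> Eprod (a <+> 1%:M : 'M[A]_(n + k)).
Proof.
elim=> [|_ b [i [j [c [ij ->]]]] _ IH]; first by rewrite dsum1; apply: Eprod1.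
rewrite -[X in _ <+> X]mulmx1 -mulmx_dsum; apply: EprodM => //.
exists (lshift k i), (lshift k j), c; split; first by rewrite (inj_eq (@lshift_inj _ _)).
have -> : delta_mx (lshift k i) (lshift k j) = delta_mx i j <+> 0 :> 'M[A]_(n + k).
  apply/matrixP=> p q; case: (split_ordP p) => p' ->; case: (split_ordP q) => q' ->;
  by rewrite ?block_mxEul ?block_mxEur ?block_mxEdl ?block_mxEdr !mxE
             ?(inj_eq (@lshift_inj _ _)) ?eq_rlshift ?andbF.
by rewrite scale_block_mx !scaler0 -dsum1 add_block_mx !addr0.
Qed.

Lemma Eprod_dsum_inverse n (a b : 'M[A]_n) : inverse_mx a b -> Eprod (a <+> b).
Proof.
case=> ab ba.
have -> : a <+> b = block_mx 1%:M a 0 1%:M *m block_mx 1%:M 0 (- b) 1%:M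
    *m block_mx 1%:M a 0 1%:M
    *m (block_mx 1%:M (- 1%:M) 0 1%:M *m block_mx 1%:M 0 1%:M 1%:M
        *m block_mx 1%:M (- 1%:M) 0 1%:M).
  rewrite !mulmx_block !(mul1mx, mulmx1, mul0mx, mulmx0, addr0, add0r, mulmxN, mulNmx).
  rewrite ab ba !(subrr, addNr, addr0, add0r, mul0mx, mulmx0, mul1mx, mulmx1, oppr0, opprK).
  by rewrite mulmxN mulmx1 opprK.
by do !apply: Eprod_mulmx; first [apply: Eprod_upper|apply: Eprod_lower].
Qed.

Lemma Eprod_conj n (a b e : 'M[A]_n) : inverse_mx a b -> Eprod e ->
  Eprod ((a *m e *m b) <+> 1%:M : 'M[A]_(n + n)).
Proof.
move=> ab Ee.
have -> : (a *m e *m b) <+> 1%:M = (a <+> b) *m (e <+> 1%:M) *m (b <+> a).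
  by rewrite !mulmx_dsum mulmx1 ab.2.
apply: Eprod_mulmx; last exact: Eprod_dsum_inverse (inverse_mx_sym ab).
by apply: Eprod_mulmx; [apply: Eprod_dsum_inverse|apply: Eprod_dsum1].
Qed.

End ElementaryProducts.

Lemma Eprod_map (A B : pzRingType) (f : {rmorphism A -> B}) n (e : 'M[A]_n) :
  Eprod e -> Eprod (map_mx f e).
Proof.
elim=> [|_ a [i [j [t [ij ->]]]] _ IH]; first by rewrite map_mx1; apply: Eprod1.
rewrite map_mxM; apply: EprodM => //; exists i, j, (f t); split=> //.
by rewrite map_mxD map_mx1 map_mxZ map_delta_mx.
Qed.

Lemma Eprod_map_surj (A B : pzRingType) (f : {rmorphism A -> B}) n (h : 'M[B]_n) :
  (forall b, exists a, f a = b) -> Eprod h -> exists2 e, Eprod e & map_mx f e = h.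
Proof.
move=> f_surj; elim=> [|_ a [i [j [c [ij ->]]]] _ [e Ee eh]].
  by exists 1%:M; [apply: Eprod1|rewrite map_mx1].
have [c' fc'] := f_surj c; exists ((1%:M + c' *: delta_mx i j) *m e).
  by apply: EprodM => //; exists i, j, c'.
by rewrite map_mxM eh map_mxD map_mx1 map_mxZ map_delta_mx fc'.
Qed.

Section Padding.
Variable A : pzRingType.

(* For [n <= N] this is [diag (a, 1, .., 1)]. *)
Definition pad N n (a : 'M[A]_n) : 'M[A]_N :=
  1%:M + pid_mx n *m (a - 1%:M) *m pid_mx n.

Lemma pid_mx_section N n : (n <= N)%N ->
  (pid_mx n : 'M[A]_(n, N)) *m (pid_mx n : 'M_(N, n)) = 1%:M.
Proof. by move=> nN; rewrite pid_mx_id // pid_mx_1. Qed.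

Lemma pad_id n (a : 'M[A]_n) : pad n a = a.
Proof. by rewrite /pad pid_mx_1 mul1mx mulmx1 addrC subrK. Qed.

Lemma pad1 N n : pad N (1%:M : 'M[A]_n) = 1%:M.
Proof. by rewrite /pad subrr mulmx0 mul0mx addr0. Qed.

Lemma padM N n (a b : 'M[A]_n) : (n <= N)%N -> pad N (a *m b) = pad N a *m pad N b.
Proof.
move=> nN; rewrite /pad mulmx_sub1; move: (a - _) (b - _) => x y.
rewrite [RHS]mulmxDl mul1mx mulmxDr mulmx1 !mulmxA (mulmxK_inverse _ (pid_mx_section nN)).
by rewrite !mulmxDr !mulmxDl !mulmxA addrA.
Qed.

Lemma padK N N' n (a : 'M[A]_n) : (n <= N)%N -> pad N' (pad N a) = pad N' a.
Proof.
move=> nN; rewrite {1 2}/pad [1%:M + _ - _]addrC addKr !mulmxA mul_pid_mx.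
by rewrite -[X in _ + X]mulmxA mul_pid_mx (minn_idPl nN) !(minn_idPr nN).
Qed.

Lemma pad_inj N n : (n <= N)%N -> injective (@pad N n).
Proof.
move=> nN a b /addrI/(congr1 (fun c => (pid_mx n : 'M_(n, N)) *m c *m (pid_mx n : 'M_(N, n)))).
rewrite /= !mulmxA pid_mx_section // !mul1mx !(mulmxK_inverse _ (pid_mx_section nN)).
exact: addIr.
Qed.

Lemma pad_dsum n k (a : 'M[A]_n) : pad (n + k) a = a <+> 1%:M.
Proof.
rewrite /pad pid_mx_row pid_mx_col mul_col_mx mul1mx mul0mx mul_mx_row mulmx1 mulmx0.
rewrite -[X in row_mx _ X]col_mx0 -block_mxEh -dsum1 add_block_mx !addr0.
by rewrite addrC subrK.
Qed.

Lemma Eprod_pad N n (a : 'M[A]_n) : (n <= N)%N -> Eprod a -> Eprod (pad N a).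
Proof. by move=> nN Ea; rewrite -(subnKC nN) pad_dsum; apply: Eprod_dsum1. Qed.

Lemma inverse_mx_pad N n (a b : 'M[A]_n) : (n <= N)%N ->
  inverse_mx a b -> inverse_mx (pad N a) (pad N b).
Proof. by move=> nN [ab ba]; split; rewrite -padM // ?ab ?ba pad1. Qed.

Lemma invertible_mx_pad N n (a : 'M[A]_n) : (n <= N)%N ->
  invertible_mx a -> invertible_mx (pad N a).
Proof. by move=> nN [b ab]; exists (pad N b); apply: inverse_mx_pad. Qed.

End Padding.

Lemma map_pad (A B : pzRingType) (f : {rmorphism A -> B}) N n (a : 'M[A]_n) :
  map_mx f (pad N a) = pad N (map_mx f a).
Proof. by rewrite map_mxD map_mx1 !map_mxM map_mxB map_mx1 !map_pid_mx. Qed.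

(** * The group K_1 *)

Section StableEquivalence.
Variable A : pzRingType.

Definition K1_equiv n m (a : 'M[A]_n) (b : 'M[A]_m) : Prop :=
  exists N0, forall N, (N0 <= N)%N -> exists2 e : 'M[A]_N, Eprod e & pad N a = e *m pad N b.

Lemma K1_equiv_witness N n m (e : 'M[A]_N) (a : 'M[A]_n) (b : 'M[A]_m) :
  (n <= N)%N -> (m <= N)%N -> Eprod e -> pad N a = e *m pad N b -> K1_equiv a b.
Proof.
move=> nN mN Ee ab; exists N => N' NN'; exists (pad N' e); first exact: Eprod_pad.
by rewrite -(padK _ a nN) ab padM // padK.
Qed.

Lemma K1_equiv_refl n (a : 'M[A]_n) : K1_equiv a a.
Proof. by exists 0 => N _; exists 1%:M; [apply: Eprod1|rewrite mul1mx]. Qed.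

Lemma K1_equiv_sym n m (a : 'M[A]_n) (b : 'M[A]_m) : K1_equiv a b -> K1_equiv b a.
Proof.
case=> N0 ab; exists N0 => N /ab[e /Eprod_inverse[f Ef [_ fe]] ->].
by exists f; rewrite // mulKmx_inverse.
Qed.

Lemma K1_equiv_trans n m p (b : 'M[A]_m) (a : 'M[A]_n) (c : 'M[A]_p) :
  K1_equiv a b -> K1_equiv b c -> K1_equiv a c.
Proof.
case=> N0 ab [N1 bc]; exists (maxn N0 N1) => N; rewrite geq_max => /andP[/ab[e Ee ->]].
by case/bc=> f Ef ->; exists (e *m f); rewrite ?mulmxA //; apply: Eprod_mulmx.
Qed.

Lemma K1_equiv_pad N n (a : 'M[A]_n) : (n <= N)%N -> K1_equiv (pad N a) a.
Proof. by move=> nN; exists 0 => N' _; exists 1%:M; [apply: Eprod1|rewrite mul1mx padK]. Qed.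

(* [a *m b = e *m a' *m f *m b'], and moving [f] past [a'] conjugates it by [a']. *)
Lemma K1_equiv_mulmx n (a a' b b' : 'M[A]_n) : invertible_mx a' ->
  K1_equiv a a' -> K1_equiv b b' -> K1_equiv (a *m b) (a' *m b').
Proof.
move=> [c a'c] [N1 aa'] [N2 bb']; pose N := (n + N1 + N2)%N.
have nN : (n <= N)%N by rewrite /N -addnA leq_addr.
have [|e Ee eqa] := aa' N; first by rewrite /N addnAC leq_addl.
have [|f Ef eqb] := bb' N; first exact: leq_addl.
have NN := leq_addr N N; have nNN := leq_trans nN NN.
have conj := Eprod_conj (inverse_mx_pad nN a'c) Ef.
apply: (K1_equiv_witness nNN nNN (Eprod_mulmx (Eprod_pad NN Ee) conj)).
rewrite -pad_dsum -(padK _ (a *m b) nN) -(padK _ (a' *m b') nN) -!padM //; congr (pad _ _).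
rewrite !padM // eqa eqb !mulmxA; congr (_ *m _).
by rewrite (mulmxK_inverse _ (inverse_mx_pad nN a'c).2).
Qed.

Lemma K1_equiv_padM N N' n m n' m' (a : 'M[A]_n) (b : 'M[A]_m) (a' : 'M[A]_n') (b' : 'M[A]_m') :
  (n <= N)%N -> (m <= N)%N -> (n' <= N')%N -> (m' <= N')%N ->
  invertible_mx a' -> K1_equiv a a' -> K1_equiv b b' ->
  K1_equiv (pad N a *m pad N b) (pad N' a' *m pad N' b').
Proof.
move=> nN mN nN' mN' inva' aa' bb'; pose P := (N + N')%N.
have NP : (N <= P)%N by apply: leq_addr.
have N'P : (N' <= P)%N by apply: leq_addl.
apply: K1_equiv_trans (K1_equiv_sym (K1_equiv_pad _ NP)) _.
apply: K1_equiv_trans _ (K1_equiv_pad _ N'P); rewrite !padM // !padK //.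
have pad_equiv k l (c : 'M[A]_k) (d : 'M[A]_l) : (k <= P)%N -> (l <= P)%N ->
    K1_equiv c d -> K1_equiv (pad P c) (pad P d).
  move=> kP lP cd; apply: K1_equiv_trans (K1_equiv_pad _ kP) (K1_equiv_trans cd _).
  exact: K1_equiv_sym (K1_equiv_pad _ lP).
apply: K1_equiv_mulmx; first by apply: invertible_mx_pad => //; apply: leq_trans N'P.
  by apply: pad_equiv => //; [apply: leq_trans NP|apply: leq_trans N'P].
by apply: pad_equiv => //; [apply: leq_trans NP|apply: leq_trans N'P].
Qed.

Lemma K1_equiv_mulmxC n (a b : 'M[A]_n) : invertible_mx a -> invertible_mx b ->
  K1_equiv (a *m b) (b *m a).
Proof.
move=> [a' aa'] [b' bb']; have nn := leq_addr n n.
have Ecomm : Eprod ((a <+> a') *m (b <+> b') *m ((a' *m b') <+> (b *m a))).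
  do !apply: Eprod_mulmx; apply: Eprod_dsum_inverse => //.
  exact: inverse_mx_sym (inverse_mxM bb' aa').
apply: (K1_equiv_witness nn nn Ecomm); rewrite !pad_dsum !mulmx_dsum mulmx1.
rewrite !mulmxA (mulmxK_inverse _ bb'.2) (mulmxK_inverse _ bb'.2) aa'.2.
by rewrite (mulmxK_inverse _ aa'.2).
Qed.

Lemma in_Einf_K1_equiv n (a : 'M[A]_n) : in_Einf a <-> K1_equiv a (1%:M : 'M[A]_n).
Proof.
split=> [[k Ek]|[N0 /(_ (n + N0)%N (leq_addl _ _))[e Ee]]].
  apply: (K1_equiv_witness (leq_addr k n) (leq_addr k n) Ek).
  by rewrite pad1 mulmx1 pad_dsum.
by rewrite pad1 mulmx1 pad_dsum => ae; exists N0; rewrite ae.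
Qed.

End StableEquivalence.

Section K1Group.
Variable A : pzRingType.

Definition mutually_inverse (x : {n : nat & ('M[A]_n * 'M[A]_n)%type}) : bool :=
  ((tagged x).1 *m (tagged x).2 == 1%:M) && ((tagged x).2 *m (tagged x).1 == 1%:M).

Definition GLinf := {x : {n : nat & ('M[A]_n * 'M[A]_n)%type} | mutually_inverse x}.
HB.instance Definition _ := Choice.on GLinf.

Definition GLsize (x : GLinf) : nat := tag (val x).
Definition GLmx (x : GLinf) : 'M[A]_(GLsize x) := (tagged (val x)).1.
Definition GLinv (x : GLinf) : 'M[A]_(GLsize x) := (tagged (val x)).2.

Lemma GLmxP (x : GLinf) : inverse_mx (GLmx x) (GLinv x).
Proof. by case/andP: (valP x) => /eqP ? /eqP ?. Qed.

Lemma invertible_GLmx (x : GLinf) : invertible_mx (GLmx x).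
Proof. by exists (GLinv x); apply: GLmxP. Qed.

Fact mutually_inverseP n (a b : 'M[A]_n) : inverse_mx a b ->
  mutually_inverse (Tagged (fun n => ('M[A]_n * 'M[A]_n)%type) (a, b)).
Proof. by case; rewrite /mutually_inverse /= => -> ->; rewrite !eqxx. Qed.

Definition mkGL n (a b : 'M[A]_n) (ab : inverse_mx a b) : GLinf :=
  Sub (Tagged _ (a, b)) (mutually_inverseP ab).

Definition GLequiv (x y : GLinf) : bool := `[< K1_equiv (GLmx x) (GLmx y) >].

Fact GLequiv_refl : reflexive GLequiv.
Proof. by move=> x; apply/asboolP; apply: K1_equiv_refl. Qed.
Fact GLequiv_sym : symmetric GLequiv.
Proof. by move=> x y; apply/asboolP/asboolP; apply: K1_equiv_sym. Qed.
Fact GLequiv_trans : transitive GLequiv.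
Proof. by move=> y x z /asboolP xy /asboolP yz; apply/asboolP; apply: K1_equiv_trans yz. Qed.

Canonical GLequiv_rel := EquivRel GLequiv GLequiv_refl GLequiv_sym GLequiv_trans.

Definition K1 := {eq_quot GLequiv_rel}.
HB.instance Definition _ := Choice.on K1.
HB.instance Definition _ := EqQuotient.on K1.

Lemma pi_K1P (x y : GLinf) : \pi_K1 x = \pi_K1 y <-> K1_equiv (GLmx x) (GLmx y).
Proof.
split=> [/eqP|xy]; first by rewrite eqmodE => /asboolP.
by apply/eqP; rewrite eqmodE; apply/asboolP.
Qed.

Definition GLone : GLinf := mkGL (inverse_mx1 A 0).
Definition GLinverse (x : GLinf) : GLinf := mkGL (inverse_mx_sym (GLmxP x)).
Definition GLmul (x y : GLinf) : GLinf :=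
  mkGL (inverse_mxM (inverse_mx_pad (leq_maxl (GLsize x) (GLsize y)) (GLmxP x))
                    (inverse_mx_pad (leq_maxr (GLsize x) (GLsize y)) (GLmxP y))).

Lemma K1_equiv_GLmul N x y : (GLsize x <= N)%N -> (GLsize y <= N)%N ->
  K1_equiv (GLmx (GLmul x y)) (pad N (GLmx x) *m pad N (GLmx y)).
Proof.
move=> xN yN; apply: K1_equiv_padM; rewrite ?leq_maxl ?leq_maxr //;
  by [apply: invertible_GLmx|apply: K1_equiv_refl].
Qed.

Definition K1add (u v : K1) : K1 := \pi_K1 (GLmul (repr u) (repr v)).
Definition K1opp (u : K1) : K1 := \pi_K1 (GLinverse (repr u)).

Lemma pi_GLmul x y : \pi_K1 (GLmul x y) = K1add (\pi_K1 x) (\pi_K1 y).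
Proof.
apply/pi_K1P; apply: K1_equiv_padM; rewrite ?leq_maxl ?leq_maxr //;
  by [apply: invertible_GLmx|apply/pi_K1P; rewrite reprK].
Qed.

Fact K1addC : commutative K1add.
Proof.
elim/quotW=> x; elim/quotW=> y; rewrite -!pi_GLmul; apply/pi_K1P.
have xN := leq_addr (GLsize y) (GLsize x); have yN := leq_addl (GLsize x) (GLsize y).
apply: K1_equiv_trans (K1_equiv_GLmul xN yN) _.
apply: K1_equiv_trans (K1_equiv_sym (K1_equiv_GLmul yN xN)).
by apply: K1_equiv_mulmxC; apply: invertible_mx_pad => //; apply: invertible_GLmx.
Qed.

Fact K1addA : associative K1add.
Proof.
elim/quotW=> x; elim/quotW=> y; elim/quotW=> z.
rewrite -(pi_GLmul y z) -(pi_GLmul x y) -(pi_GLmul x) -(pi_GLmul _ z); apply/pi_K1P.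
pose N := (GLsize x + GLsize y + GLsize z)%N.
have xN : (GLsize x <= N)%N by rewrite /N -addnA leq_addr.
have yN : (GLsize y <= N)%N by rewrite /N addnAC leq_addl.
have zN : (GLsize z <= N)%N by apply: leq_addl.
have yzN : (GLsize (GLmul y z) <= N)%N by rewrite geq_max yN.
have xyN : (GLsize (GLmul x y) <= N)%N by rewrite geq_max xN.
apply: K1_equiv_trans (K1_equiv_GLmul xN yzN) _.
apply: K1_equiv_trans (K1_equiv_sym (K1_equiv_GLmul xyN zN)).
rewrite /= !padM ?geq_max ?xN ?yN ?zN // !padK ?leq_maxl ?leq_maxr // mulmxA.
exact: K1_equiv_refl.
Qed.

Fact K1add0 : left_id (\pi_K1 GLone) K1add.
Proof.
elim/quotW=> x; rewrite -pi_GLmul; apply/pi_K1P.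
apply: K1_equiv_trans (@K1_equiv_GLmul _ GLone x (leq0n _) (leqnn _)) _.
by rewrite pad1 mul1mx pad_id; apply: K1_equiv_refl.
Qed.

Fact K1addN : left_inverse (\pi_K1 GLone) K1opp K1add.
Proof.
move=> u; rewrite -[X in K1add _ X]reprK -pi_GLmul; apply/pi_K1P.
apply: K1_equiv_trans (@K1_equiv_GLmul _ (GLinverse _) (repr u) (leqnn _) (leqnn _)) _.
rewrite !pad_id; have -> := (GLmxP (repr u)).2.
rewrite -(pad1 A (GLsize (repr u)) 0); exact: K1_equiv_pad.
Qed.

HB.instance Definition _ := GRing.isZmodule.Build K1 K1addA K1addC K1add0 K1addN.

(* Junk value [0] on matrices that are not invertible. *)
Definition K1class n (a : 'M[A]_n) : K1 :=
  if pselect (invertible_mx a) is left inva then \pi_K1 (mkGL (projT2 (cid inva))) else 0.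

Lemma K1class_repr n (a : 'M[A]_n) : invertible_mx a ->
  exists2 x : GLinf, K1class a = \pi_K1 x & K1_equiv (GLmx x) a.
Proof.
rewrite /K1class; case: pselect => // inva _; eexists; first reflexivity.
exact: K1_equiv_refl.
Qed.

Lemma K1class_noninvertible n (a : 'M[A]_n) : ~ invertible_mx a -> K1class a = 0.
Proof. by rewrite /K1class; case: pselect. Qed.

Lemma K1class_eqP n m (a : 'M[A]_n) (b : 'M[A]_m) : invertible_mx a -> invertible_mx b ->
  K1class a = K1class b <-> K1_equiv a b.
Proof.
move=> /K1class_repr[x -> xa] /K1class_repr[y -> yb]; rewrite pi_K1P.
split=> ab; first exact: K1_equiv_trans (K1_equiv_sym xa) (K1_equiv_trans ab yb).
exact: K1_equiv_trans xa (K1_equiv_trans ab (K1_equiv_sym yb)).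
Qed.

Lemma K1classM n (a b : 'M[A]_n) : invertible_mx a -> invertible_mx b ->
  K1class (a *m b) = K1class a + K1class b.
Proof.
move=> inva invb; have [z -> zab] := K1class_repr (invertible_mxM inva invb).
have [x -> xa] := K1class_repr inva; have [y -> yb] := K1class_repr invb.
rewrite -[RHS]/(K1add _ _) -pi_GLmul; apply/pi_K1P.
apply: K1_equiv_trans zab _; rewrite -[a]pad_id -[b]pad_id.
apply: K1_equiv_padM; rewrite ?leq_maxl ?leq_maxr //; first exact: invertible_GLmx.
  exact: K1_equiv_sym.
exact: K1_equiv_sym.
Qed.

Lemma K1class1 n : K1class (1%:M : 'M[A]_n) = 0.
Proof.
have inv1 := invertible_mx1 A n; apply: (addrI (K1class (1%:M : 'M[A]_n))).
by rewrite -K1classM // mulmx1 addr0.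
Qed.

Lemma K1class_eq0 n (a : 'M[A]_n) : invertible_mx a -> K1class a = 0 <-> in_Einf a.
Proof.
move=> inva; rewrite -(K1class1 n) in_Einf_K1_equiv.
by apply: K1class_eqP => //; apply: invertible_mx1.
Qed.

Lemma K1class_Eprod n (e : 'M[A]_n) : Eprod e -> K1class e = 0.
Proof.
move=> Ee; apply/K1class_eq0; first exact: invertible_Eprod.
by exists 0; apply: Eprod_dsum1.
Qed.

Lemma K1class_EprodMl n (e a : 'M[A]_n) : Eprod e -> invertible_mx a ->
  K1class (e *m a) = K1class a.
Proof.
by move=> Ee inva; rewrite K1classM ?(K1class_Eprod Ee) ?add0r //; apply: invertible_Eprod.
Qed.

Lemma K1class_EprodMr n (e a : 'M[A]_n) : Eprod e -> invertible_mx a ->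
  K1class (a *m e) = K1class a.
Proof.
by move=> Ee inva; rewrite K1classM ?(K1class_Eprod Ee) ?addr0 //; apply: invertible_Eprod.
Qed.

Lemma K1class_inverse n (a b : 'M[A]_n) : inverse_mx a b -> K1class b = - K1class a.
Proof.
move=> ab; have [_ ba] := ab; apply/eqP; rewrite -addr_eq0 -K1classM ?ba ?K1class1 //.
  by exists a; apply: inverse_mx_sym.
by exists b.
Qed.

Lemma K1class_conj n (w w' a : 'M[A]_n) : inverse_mx w w' -> invertible_mx a ->
  K1class (w *m a *m w') = K1class a.
Proof.
move=> ww' inva; have invw : invertible_mx w by exists w'.
have invw' : invertible_mx w' by exists w; apply: inverse_mx_sym.
rewrite K1classM ?K1classM //; last exact: invertible_mxM.
by rewrite (K1class_inverse ww') addrAC subrr add0r.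
Qed.

Lemma K1class_pad N n (a : 'M[A]_n) : (n <= N)%N -> invertible_mx a ->
  K1class (pad N a) = K1class a.
Proof.
move=> nN inva; apply/K1class_eqP => //; first exact: invertible_mx_pad.
exact: K1_equiv_pad.
Qed.

Lemma K1class_dsum1 n k (a : 'M[A]_n) : invertible_mx a ->
  K1class (a <+> 1%:M : 'M[A]_(n + k)) = K1class a.
Proof. by move=> inva; rewrite -pad_dsum K1class_pad ?leq_addr. Qed.

Lemma K1class_1dsum_square n (a : 'M[A]_n) : invertible_mx a ->
  K1class (1%:M <+> a : 'M[A]_(n + n)) = K1class a.
Proof.
case=> b ab; have inva : invertible_mx a by exists b.
have <- : (b <+> a) *m (a <+> 1%:M) = 1%:M <+> a by rewrite mulmx_dsum ab.2 mulmx1.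
rewrite K1class_EprodMl ?K1class_dsum1 //; first exact: Eprod_dsum_inverse (inverse_mx_sym ab).
exact: invertible_mx_dsum (invertible_mx1 A n).
Qed.

Lemma K1class_add1mulmx_square n (u v : 'M[A]_n) : invertible_mx (1%:M + u *m v) ->
  K1class (1%:M + u *m v) = K1class (1%:M + v *m u).
Proof.
move=> inva; have invb := invertible_add1mulmx_swap inva.
have swap : block_mx 1%:M u 0 1%:M *m ((1%:M + u *m v <+> 1%:M) *m block_mx 1%:M 0 (- v) 1%:M)
    = block_mx 1%:M 0 (- v) 1%:M *m ((1%:M <+> 1%:M + v *m u) *m block_mx 1%:M u 0 1%:M).
  rewrite !mulmx_block !(mul1mx, mulmx1, mul0mx, mulmx0, addr0, add0r, mulmxN, mulNmx).
  by rewrite addrK addrCA addNr addr0.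
have Eu := Eprod_upper u; have Ev := Eprod_lower (- v).
have invua := invertible_mx_dsum inva (invertible_mx1 A n).
have invub := invertible_mx_dsum (invertible_mx1 A n) invb.
rewrite -(K1class_dsum1 n inva) -(K1class_EprodMr Ev invua).
rewrite -(K1class_EprodMl Eu (invertible_mxM invua (invertible_Eprod Ev))) swap.
by rewrite K1class_EprodMl ?K1class_EprodMr ?K1class_1dsum_square //;
  apply: invertible_mxM => //; apply: invertible_Eprod.
Qed.

Theorem K1class_add1mulmxC m n (u : 'M[A]_(m, n)) (v : 'M[A]_(n, m)) :
  K1class (1%:M + u *m v) = K1class (1%:M + v *m u).
Proof.
have [inva|ninva] := pselect (invertible_mx (1%:M + u *m v)); last first.
  by rewrite !K1class_noninvertible // => /invertible_add1mulmx_swap.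
have [mN nN] := (leq_addr n m, leq_addl m n); pose N := (m + n)%N.
pose u' : 'M[A]_N := pid_mx m *m u *m pid_mx n; pose v' : 'M[A]_N := pid_mx n *m v *m pid_mx m.
have uv : 1%:M + u' *m v' = pad N (1%:M + u *m v).
  by rewrite /pad [_ + u *m v - _]addrC addKr !mulmxA (mulmxK_inverse _ (pid_mx_section A nN)).
have vu : 1%:M + v' *m u' = pad N (1%:M + v *m u).
  by rewrite /pad [_ + v *m u - _]addrC addKr !mulmxA (mulmxK_inverse _ (pid_mx_section A mN)).
rewrite -(K1class_pad mN inva) -uv K1class_add1mulmx_square; last first.
  by rewrite uv; apply: invertible_mx_pad.
by rewrite vu K1class_pad //; apply: invertible_add1mulmx_swap.
Qed.

Lemma K1class_1dsum k n (a : 'M[A]_n) : K1class (1%:M <+> a : 'M[A]_(k + n)) = K1class a.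
Proof.
pose u : 'M[A]_(k + n, n) := col_mx 0 1%:M; pose v : 'M[A]_(n, k + n) := row_mx 0 (a - 1%:M).
have -> : 1%:M <+> a = 1%:M + u *m v.
  rewrite mul_col_row !mul0mx mulmx0 mul1mx -dsum1 add_block_mx !addr0.
  by rewrite addrC subrK.
by rewrite K1class_add1mulmxC mul_row_col mul0mx mulmx1 add0r addrC subrK.
Qed.

Lemma K1class_dsum m n (a : 'M[A]_m) (b : 'M[A]_n) :
  invertible_mx a -> invertible_mx b -> K1class (a <+> b) = K1class a + K1class b.
Proof.
move=> inva invb; have -> : a <+> b = (a <+> 1%:M) *m (1%:M <+> b).
  by rewrite mulmx_dsum mulmx1 mul1mx.
rewrite K1classM ?K1class_dsum1 ?K1class_1dsum //; apply: invertible_mx_dsum => //;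
  exact: invertible_mx1.
Qed.

Section BlockMatrix.
Variables (m n : nat) (a a' : 'M[A]_m) (b : 'M[A]_(m, n)) (c : 'M[A]_(n, m)) (d : 'M[A]_n).
Hypothesis aa' : inverse_mx a a'.

Lemma block_mx_schur : block_mx a b c d =
  block_mx 1%:M 0 (c *m a') 1%:M *m (a <+> d - c *m a' *m b)
    *m block_mx 1%:M (a' *m b) 0 1%:M.
Proof.
rewrite !mulmx_block !(mul1mx, mulmx1, mul0mx, mulmx0, addr0, add0r).
by rewrite !mulmxA aa'.1 mul1mx -(mulmxA c) aa'.2 mulmx1 addrC subrK.
Qed.

Lemma invertible_schur : invertible_mx (block_mx a b c d) <-> invertible_mx (d - c *m a' *m b).
Proof.
have inva : invertible_mx a by exists a'.
have [/Eprod_inverse[l El ll'] /Eprod_inverse[u Eu uu']] :=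
  (Eprod_lower (c *m a'), Eprod_upper (a' *m b)).
split=> [inv|invs]; last first.
  rewrite block_mx_schur; apply: invertible_mxM; last by exists u.
  by apply: invertible_mxM; [exists l|apply: invertible_mx_dsum].
apply: (@invertible_mx_dsumr _ _ _ a).
have <- : l *m block_mx a b c d *m u = a <+> d - c *m a' *m b.
  by rewrite block_mx_schur !mulmxA ll'.2 mul1mx (mulmxK_inverse _ uu'.1).
by do !apply: invertible_mxM => //; apply: invertible_Eprod.
Qed.

Lemma K1class_schur : invertible_mx (block_mx a b c d) ->
  K1class (block_mx a b c d) = K1class a + K1class (d - c *m a' *m b).
Proof.
move=> /invertible_schur invs; have inva : invertible_mx a by exists a'.
have invad := invertible_mx_dsum inva invs.
rewrite block_mx_schur K1class_EprodMr; last 2 first.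
- exact: Eprod_upper.
- by apply: invertible_mxM => //; apply: invertible_Eprod; apply: Eprod_lower.
by rewrite K1class_EprodMl ?K1class_dsum //; apply: Eprod_lower.
Qed.

End BlockMatrix.

Section LowerTriangular.
Variables (m n : nat) (a : 'M[A]_m) (c : 'M[A]_(n, m)) (d : 'M[A]_n).
Hypotheses (inva : invertible_mx a) (invd : invertible_mx d).

Lemma invertible_lower : invertible_mx (block_mx a 0 c d).
Proof. by have [a' aa'] := inva; apply/(invertible_schur _ _ _ aa'); rewrite mulmx0 subr0. Qed.

Lemma K1class_lower : K1class (block_mx a 0 c d) = K1class a + K1class d.
Proof.
have [a' aa'] := inva; rewrite (K1class_schur aa'); last exact: invertible_lower.
by rewrite mulmx0 subr0.
Qed.

End LowerTriangular.

End K1Group.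

Section K1Functoriality.
Variables (A B : pzRingType) (f : {rmorphism A -> B}).

Lemma K1_equiv_map n m (a : 'M[A]_n) (b : 'M[A]_m) :
  K1_equiv a b -> K1_equiv (map_mx f a) (map_mx f b).
Proof.
case=> N0 ab; exists N0 => N /ab[e Ee eab]; exists (map_mx f e); first exact: Eprod_map.
by rewrite -!map_pad eab map_mxM.
Qed.

Lemma K1class_map_eq n m (a : 'M[A]_n) (b : 'M[A]_m) : invertible_mx a -> invertible_mx b ->
  K1class a = K1class b -> K1class (map_mx f a) = K1class (map_mx f b).
Proof.
move=> inva invb /(K1class_eqP inva invb) ab.
by apply/K1class_eqP; [apply: invertible_mx_map..|apply: K1_equiv_map].
Qed.

Lemma K1class_map_inj :
  (forall n (a : 'M[A]_n), invertible_mx a -> Eprod (map_mx f a) -> K1class a = 0) ->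
  forall n m (a : 'M[A]_n) (b : 'M[A]_m), invertible_mx a -> invertible_mx b ->
  K1class (map_mx f a) = K1class (map_mx f b) -> K1class a = K1class b.
Proof.
move=> Eprod_ker n m a b inva [b' bb'] fab; have invb : invertible_mx b by exists b'.
have invb' : invertible_mx b' by exists b; apply: inverse_mx_sym.
have invab' := invertible_mx_dsum inva invb'.
have : K1class (map_mx f (a <+> b')) = 0.
  rewrite map_block_mx !map_mx0 K1class_dsum; try exact: invertible_mx_map.
  by rewrite fab (K1class_inverse (inverse_mx_map f bb')) subrr.
case/(K1class_eq0 (invertible_mx_map f invab')) => k.
rewrite -pad_dsum -map_pad => /Eprod_ker; rewrite K1class_pad ?leq_addr //.
rewrite K1class_dsum // (K1class_inverse bb') => ab'.
by apply/eqP; rewrite -subr_eq0 ab' //; apply: invertible_mx_pad; rewrite ?leq_addr.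
Qed.

End K1Functoriality.

Lemma K1class_retract (A B : pzRingType) (f : {rmorphism A -> B}) (g : {rmorphism B -> A}) n m
    (a : 'M[A]_n) (b : 'M[B]_m) : cancel f g -> invertible_mx a -> invertible_mx b ->
  K1class (map_mx f a) = K1class b -> K1class a = K1class (map_mx g b).
Proof.
move=> fK inva invb /(K1class_map_eq g (invertible_mx_map f inva) invb) <-.
by congr K1class; apply/matrixP=> i j; rewrite !mxE fK.
Qed.

(** * Determinants and fields *)

Section Determinant.
Variable A : comPzRingType.

Lemma det_elementary n (e : 'M[A]_n) : elementary_mx e -> \det e = 1.
Proof.
case=> i [j [c [ij ->]]].
have trig (k l : 'I_n) : (l < k)%N -> \det (1%:M + c *: delta_mx k l : 'M[A]_n) = 1.
  move=> lk; rewrite det_trig; first by rewrite big1 // => p _; rewrite !mxE eqxx;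
    case: eqP => [->|_]; rewrite /= ?mulr0 ?addr0 // -val_eqE gtn_eqF ?mulr0 ?addr0.
  apply/is_trig_mxP=> p q pq; rewrite !mxE -val_eqE ltn_eqF // add0r.
  by case: andP => [[/eqP pk /eqP ql]|_]; rewrite ?mulr0 //; move: pq; rewrite pk ql ltnNge ltnW.
case: (ltngtP i j) => [lt_ij|/trig//|/val_inj/eqP]; last by rewrite (negbTE ij).
by rewrite -det_tr linearD linearZ /= trmx_delta trmx1 trig.
Qed.

Lemma det_Eprod n (e : 'M[A]_n) : Eprod e -> \det e = 1.
Proof.
by elim=> [|a b /det_elementary ea _ IH]; rewrite ?det1 // det_mulmx ea IH mulr1.
Qed.

Lemma det_dsum1 n k (a : 'M[A]_n) : \det (a <+> 1%:M : 'M[A]_(n + k)) = \det a.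
Proof. by rewrite det_ublock det1 mulr1. Qed.

Lemma K1class_det n m (a : 'M[A]_n) (b : 'M[A]_m) : invertible_mx a -> invertible_mx b ->
  K1class a = K1class b -> \det a = \det b.
Proof.
move=> inva invb /(K1class_eqP inva invb)[N0 ab].
have [|e /det_Eprod e1] := ab (n + m + N0)%N; first exact: leq_addl.
have det_pad k (c : 'M[A]_k) : (k <= n + m + N0)%N -> \det (pad (n + m + N0) c) = \det c.
  by move=> kN; rewrite -(subnKC kN) pad_dsum det_dsum1.
move/(congr1 determinant); rewrite det_mulmx e1 mul1r !det_pad //.
  by rewrite addnAC leq_addl.
by rewrite -addnA leq_addr.
Qed.

End Determinant.

Lemma invertible_mx_scalar_map (K : fieldType) (A : pzRingType) (f : {rmorphism K -> A}) n u :
  u != 0 -> invertible_mx ((f u)%:M : 'M_n).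
Proof.
move=> u0; apply: (@invertible_mx_scalar _ _ _ (f u^-1));
  by rewrite -rmorphM ?divff ?mulVf ?rmorph1.
Qed.

Lemma Eprod_pivot (K : fieldType) n (a : 'M[K]_n.+1) : invertible_mx a ->
  exists2 e, Eprod e & (e *m a) 0 0 != 0.
Proof.
case=> b [_ ba]; have [a00|a00] := eqVneq (a 0 0) 0; last first.
  by exists 1%:M; [apply: Eprod1|rewrite mul1mx].
have [i ai] : exists i, a i 0 != 0.
  apply/existsP; apply: contraPT (oner_neq0 K) => /existsPn a0.
  move/matrixP/(_ 0 0): ba; rewrite !mxE eqxx big1 => [->|k _]; first by rewrite eqxx.
  by have /negPn/eqP-> := a0 k; rewrite mulr0.
have i0 : 0 != i by apply: contraNneq ai => <-; rewrite a00.
exists (1%:M + 1 *: delta_mx 0 i); first by apply: Eprod_elementary; exists 0, i, 1.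
rewrite scale1r mulmxDl mul1mx mxE a00 add0r mxE (bigD1 i) //= big1 => [|k /negbTE ki].
  by rewrite mxE !eqxx mul1r addr0.
by rewrite mxE ki andbF mul0r.
Qed.

Theorem K1class_field (K : fieldType) n (a : 'M[K]_n) : invertible_mx a ->
  exists2 u : K, u != 0 & K1class a = K1class (u%:M : 'M_1).
Proof.
elim: n a => [|n IH] a inva.
  exists 1; rewrite ?oner_neq0 // (_ : a = 1%:M) ?K1class1 //.
  by rewrite [a]flatmx0 [RHS]flatmx0.
have [e Ee pn0] := Eprod_pivot inva; rewrite -(K1class_EprodMl Ee inva).
have : invertible_mx (e *m a) by apply: invertible_mxM => //; apply: invertible_Eprod.
move: (e *m a : 'M_(1 + n)) pn0 => {Ee e inva}a; set p := a 0 0 => pn0.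
have pE : ulsubmx a = p%:M.
  by apply/matrixP=> i j; rewrite !mxE !ord1 eqxx mulr1n; congr (a _ _); apply: val_inj.
have pp' : inverse_mx (p%:M : 'M_1) p^-1%:M by apply: inverse_mx_scalar; rewrite ?divff ?mulVf.
rewrite -[a]submxK pE => inva; have [u un0 eu] := IH _ ((invertible_schur _ _ _ pp').1 inva).
have uu' : inverse_mx (u%:M : 'M_1) u^-1%:M by apply: inverse_mx_scalar; rewrite ?divff ?mulVf.
exists (p * u); first by rewrite mulf_neq0.
by rewrite (K1class_schur pp' inva) eu scalar_mxM K1classM //; [exists p^-1%:M|exists u^-1%:M].
Qed.

(** * Operators over a ring and Fredholm classes *)

Section Operators.
Variables (R M B : pzRingType) (it : {rmorphism R -> M}) (jt : {rmorphism R -> B}).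

(* [M] is a right [R]-module through [it], and [B] through [jt]. *)
Record rlinear := RLinear {
  rlinear_fun :> M -> B;
  rlinear_additive : zmod_morphism rlinear_fun;
  rlinearM : forall m r, rlinear_fun (m * it r) = rlinear_fun m * jt r }.
HB.instance Definition _ (H : rlinear) :=
  GRing.isZmodMorphism.Build M B (rlinear_fun H) (rlinear_additive H).

(* A right [R]-linear map [M^n -> B^p], acting on all columns of a matrix at once. *)
Record mxop n p := MxOp {
  mxop_fun :> forall D, 'M[M]_(n, D) -> 'M[B]_(p, D);
  mxop_additive : forall D, zmod_morphism (@mxop_fun D);
  mxopM : forall D D' (u : 'M[M]_(n, D)) (w : 'M[R]_(D, D')),
    mxop_fun (u *m map_mx it w) = mxop_fun u *m map_mx jt w }.
HB.instance Definition _ n p (f : mxop n p) D :=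
  GRing.isZmodMorphism.Build 'M[M]_(n, D) 'M[B]_(p, D) (@mxop_fun n p f D) (@mxop_additive n p f D).

Definition rlinear_rmorphism (h : {rmorphism M -> B}) (h_it : forall r, h (it r) = jt r) : rlinear.
Proof. by exists h => [m m'|m r]; rewrite ?rmorphB ?rmorphM ?h_it. Defined.

Definition mxop0 n p : mxop n p.
Proof. by exists (fun D v => 0) => [D u v|D D' u w]; rewrite ?subrr ?mul0mx. Defined.

Definition mxop_add n p (f g : mxop n p) : mxop n p.
Proof.
exists (fun D v => f D v + g D v) => [D u v|D D' u w]; last by rewrite !mxopM mulmxDl.
by rewrite !raddfB opprD addrACA.
Defined.

Definition mxop_map n (H : rlinear) : mxop n n.
Proof.
exists (fun D v => map_mx H v) => [D u v|D D' u w]; first exact: map_mxB.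
apply/matrixP=> i j; rewrite !mxE raddf_sum; apply: eq_bigr => k _.
by rewrite !mxE -rlinearM.
Defined.

Lemma mxop_row n p D D' (f : mxop n p) (u : 'M[M]_(n, D)) (v : 'M[M]_(n, D')) :
  f _ (row_mx u v) = row_mx (f _ u) (f _ v).
Proof.
have ul := mxopM f (row_mx u v) (col_mx 1%:M 0); have ur := mxopM f (row_mx u v) (col_mx 0 1%:M).
rewrite -[LHS]hsubmxK -[LHS]mulmx1 (@scalar_mx_block _ D D') block_mxEh mul_mx_row hsubmxK.
move: ul ur; rewrite !map_col_mx !map_mx1 !map_mx0 !mul_row_col.
by rewrite !mulmx1 !mulmx0 addr0 add0r => -> ->.
Qed.

End Operators.

Section Composition.
Variables (R M B C : pzRingType).
Variables (it : {rmorphism R -> M}) (jt : {rmorphism R -> B}) (kt : {rmorphism R -> C}).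

Definition rlinear_comp (G : rlinear jt kt) (H : rlinear it jt) : rlinear it kt.
Proof. by exists (G \o H) => [m m'|m r]; rewrite /= ?raddfB ?rlinearM. Defined.

Definition mxop_comp n p q (f : mxop jt kt p q) (g : mxop it jt n p) : mxop it kt n q.
Proof. by exists (fun D v => f D (g D v)) => [D u v|D D' u w]; rewrite ?raddfB ?mxopM. Defined.

End Composition.

Section LeftMultiplication.
Variables (R M : pzRingType) (it : {rmorphism R -> M}).

Definition rlinear_mull (c : M) : rlinear it it.
Proof. by exists (fun m => c * m) => [m m'|m r]; rewrite ?mulrBr ?mulrA. Defined.

Definition mxop_mull n p (a : 'M[M]_(p, n)) : mxop it it n p.
Proof. by exists (fun D v => a *m v) => [D u v|D D' u w]; rewrite ?mulmxBr ?mulmxA. Defined.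

Definition mxop_id n : mxop it it n n.
Proof. by exists (fun D v => v). Defined.

End LeftMultiplication.

Section ColumnOperator.
Variables (R M B : pzRingType) (it : {rmorphism R -> M}) (jt : {rmorphism R -> B}).
Variables (n p q : nat) (f : mxop it jt n p) (g : mxop it jt n q).

Definition mxop_col : mxop it jt n (p + q) :=
  mxop_add (mxop_comp (mxop_mull jt (col_mx 1%:M 0)) f)
           (mxop_comp (mxop_mull jt (col_mx 0 1%:M)) g).

Lemma mxop_colE D v : mxop_col D v = col_mx (f D v) (g D v).
Proof. by rewrite /= !mul_col_mx !mul1mx !mul0mx add_col_mx addr0 add0r. Qed.

End ColumnOperator.

Section FiniteRank.
Variables (R M : pzRingType) (it : {rmorphism R -> M}).
Local Notation "W ^it" := (map_mx it W) (at level 2, format "W ^it").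
Local Notation functional := (rlinear it (idfun : {rmorphism R -> R})).
Local Notation functionals := (mxop it (idfun : {rmorphism R -> R})).
Local Notation op := (mxop it it).

Definition finite_rank n p (C : forall D, 'M[M]_(n, D) -> 'M[M]_(p, D)) : Prop :=
  exists N (U : 'M[M]_(p, N)) (V : functionals n N), forall D v, C D v = U *m (V D v)^it.

Lemma finite_rank_ext n p (C C' : forall D, 'M[M]_(n, D) -> 'M[M]_(p, D)) :
  (forall D v, C D v = C' D v) -> finite_rank C -> finite_rank C'.
Proof. by move=> CC' [N [U [V CE]]]; exists N, U, V => D v; rewrite -CC'. Qed.

Lemma finite_rank0 n p : finite_rank (fun D (v : 'M_(n, D)) => 0 : 'M_(p, D)).
Proof. by exists 0, 0, (mxop0 it _ n 0) => D v; rewrite mul0mx. Qed.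

Lemma finite_rankD n p C C' : @finite_rank n p C -> @finite_rank n p C' ->
  finite_rank (fun D v => C D v + C' D v).
Proof.
move=> [N [U [V CE]]] [N' [U' [V' C'E]]].
exists (N + N')%N, (row_mx U U'), (mxop_col V V') => D v.
by rewrite mxop_colE map_col_mx mul_row_col CE C'E.
Qed.

Lemma finite_rank_sum n p I (r : seq I) (C : I -> forall D, 'M_(n, D) -> 'M_(p, D)) :
  (forall i, finite_rank (C i)) -> finite_rank (fun D v => \sum_(i <- r) C i D v).
Proof.
move=> Cfin; elim: r => [|i r IH].
  by apply: finite_rank_ext (finite_rank0 n p) => D v; rewrite big_nil.
by apply: finite_rank_ext (finite_rankD (Cfin i) IH) => D v; rewrite big_cons.
Qed.

Lemma finite_rank_compl n p q (f : op p q) C : @finite_rank n p C ->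
  finite_rank (fun D v => f D (C D v)).
Proof. by move=> [N [U [V CE]]]; exists N, (f N U), V => D v; rewrite CE mxopM. Qed.

Lemma finite_rank_compr n p q (f : op n p) C : @finite_rank p q C ->
  finite_rank (fun D v => C D (f D v)).
Proof. by move=> [N [U [V CE]]]; exists N, U, (mxop_comp V f) => D v; rewrite CE. Qed.

Definition scalar_finite_rank (B : M -> M) : Prop :=
  forall n, finite_rank (fun D (v : 'M_(n, D)) => map_mx B v).

Lemma scalar_finite_rank_ext B B' : B =1 B' -> scalar_finite_rank B -> scalar_finite_rank B'.
Proof.
move=> BB' Bfin n; apply: finite_rank_ext (Bfin n) => D v.
by apply/matrixP=> i j; rewrite !mxE BB'.
Qed.

Lemma scalar_finite_rankD B B' : scalar_finite_rank B -> scalar_finite_rank B' ->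
  scalar_finite_rank (fun m => B m + B' m).
Proof.
move=> Bfin B'fin n; apply: finite_rank_ext (finite_rankD (Bfin n) (B'fin n)) => D v.
by apply/matrixP=> i j; rewrite !mxE.
Qed.

Lemma scalar_finite_rank_compl (H : rlinear it it) B : scalar_finite_rank B ->
  scalar_finite_rank (H \o B).
Proof.
move=> Bfin n; apply: finite_rank_ext (finite_rank_compl (mxop_map n H) (Bfin n)) => D v.
by rewrite /= map_mx_comp.
Qed.

Lemma scalar_finite_rank_compr (H : rlinear it it) B : scalar_finite_rank B ->
  scalar_finite_rank (B \o H).
Proof.
move=> Bfin n; apply: finite_rank_ext (finite_rank_compr (mxop_map n H) (Bfin n)) => D v.
by rewrite /= map_mx_comp.
Qed.

Lemma scalar_finite_rank_sum I (r : seq I) (b : I -> M) (c : I -> functional) :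
  scalar_finite_rank (fun m => \sum_(i <- r) b i * it (c i m)).
Proof.
move=> n; have rank1 i : finite_rank (fun D (v : 'M_(n, D)) => (b i)%:M *m (map_mx (c i) v)^it).
  by exists n, (b i)%:M, (mxop_map n (c i)).
apply: finite_rank_ext (finite_rank_sum r rank1) => D v; apply/matrixP=> k l.
by rewrite summxE !mxE; apply: eq_bigr => i _; rewrite mul_scalar_mx !mxE.
Qed.

Lemma scalar_finite_rank1 b (c : functional) : scalar_finite_rank (fun m => b * it (c m)).
Proof.
apply: scalar_finite_rank_ext (scalar_finite_rank_sum [:: tt] (fun=> b) (fun=> c)) => m.
by rewrite big_seq1.
Qed.

End FiniteRank.

Section FredholmDeterminant.
Variables (R M : pzRingType) (it : {rmorphism R -> M}).
Local Notation "W ^it" := (map_mx it W) (at level 2, format "W ^it").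
Local Notation functionals := (mxop it (idfun : {rmorphism R -> R})).
Local Notation op := (mxop it it).

Lemma functionalsM n p (V : functionals n p) D D' (u : 'M_(n, D)) (w : 'M_(D, D')) :
  V _ (u *m w^it) = V _ u *m w.
Proof. by rewrite mxopM map_mx_id. Qed.

Definition inverse_op n (f g : op n n) : Prop :=
  (forall D v, f D (g D v) = v) /\ (forall D v, g D (f D v) = v).

Lemma inverse_op_sym n (f g : op n n) : inverse_op f g -> inverse_op g f.
Proof. by case=> fg gf; split. Qed.

Lemma inverse_op_comp n (f f' g g' : op n n) : inverse_op f f' -> inverse_op g g' ->
  inverse_op (mxop_comp f g) (mxop_comp g' f').
Proof. by move=> [ff' f'f] [gg' g'g]; split=> D v /=; rewrite ?gg' ?g'g ?f'f ?ff'. Qed.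

Lemma inverse_op_mull n (a a' : 'M[M]_n) : inverse_mx a a' ->
  inverse_op (mxop_mull it a) (mxop_mull it a').
Proof. by move=> [aa' a'a]; split=> D v /=; rewrite mulKmx_inverse. Qed.

(* As for Fredholm determinants, the class in K_1 of a finite rank perturbation
   [1 + U V] of the identity is that of the finite matrix [1 + V U]. *)
Definition fredholm_det n (w : op n n) (c : K1 R) : Prop :=
  exists N (U : 'M[M]_(n, N)) (V : functionals n N),
  [/\ forall D v, w D v = v + U *m (V D v)^it, invertible_mx (1%:M + V N U)
    & K1class (1%:M + V N U) = c].

Lemma fredholm_det_id n : fredholm_det (mxop_id it n) 0.
Proof.
exists 0, 0, (mxop0 it _ n 0).
by split=> [D v||]; rewrite ?mul0mx /= addr0 ?K1class1 //; apply: invertible_mx1.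
Qed.

Lemma fredholm_det_ext n (w w' : op n n) c : (forall D v, w D v = w' D v) ->
  fredholm_det w c -> fredholm_det w' c.
Proof. by move=> ww' [N [U [V [wE inv cE]]]]; exists N, U, V; split=> // D v; rewrite -ww'. Qed.

Lemma fredholm_det_exists n (w w' : op n n) : finite_rank it (fun D v => w D v - v) ->
  inverse_op w w' -> exists c, fredholm_det w c.
Proof.
move=> [N [U [V wE]]] [ww' w'w]; exists (K1class (1%:M + V N U)), N, U, V.
have {}wE D v : w D v = v + U *m (V D v)^it by rewrite -wE addrC subrK.
split=> //; exists (1%:M - V N (w' N U)).
have linv : V N (w' N U) + V N (w' N U) *m V N U = V N U.
  by rewrite -{4}(w'w _ U) wE !raddfD /= mxopM functionalsM.
have rinv : V N (w' N U) + V N U *m V N (w' N U) = V N U.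
  by rewrite -{4}(ww' _ U) wE raddfD /= functionalsM.
split; first by rewrite mulmxBr mulmx1 mulmxDl mul1mx rinv addrK.
by rewrite mulmxBl mul1mx mulmxDr mulmx1 linv addrK.
Qed.

Lemma fredholm_det_conj n (g g' w : op n n) c : inverse_op g g' -> fredholm_det w c ->
  fredholm_det (mxop_comp g (mxop_comp w g')) c.
Proof.
move=> [gg' g'g] [N [U [V [wE inv cE]]]]; exists N, (g N U), (mxop_comp V g').
by rewrite /= g'g; split=> // D v; rewrite wE raddfD /= gg' mxopM.
Qed.

Lemma fredholm_det_comp n (w w' : op n n) c c' : fredholm_det w c -> fredholm_det w' c' ->
  fredholm_det (mxop_comp w w') (c + c').
Proof.
move=> [N [U [V [wE inv <-]]]] [N' [U' [V' [w'E inv' <-]]]].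
pose V2 := mxop_col (mxop_comp V w') V'; pose U2 := row_mx U U'.
have factor : 1%:M + V2 _ U2 =
    block_mx 1%:M (V _ U') 0 1%:M *m block_mx (1%:M + V _ U) 0 (V' _ U) (1%:M + V' _ U').
  rewrite mulmx_block !(mul1mx, mul0mx, add0r) /U2 mxop_row !mxop_colE /= !w'E.
  rewrite -block_mxEh -dsum1 add_block_mx !add0r !raddfD /= !functionalsM addrA.
  by rewrite mulmx1.
have inv_lower := invertible_lower (V' _ U) inv inv'.
exists (N + N')%N, U2, V2; rewrite factor; split.
- move=> D v; rewrite mxop_colE map_col_mx mul_row_col /= wE {1}w'E.
  by rewrite addrA addrAC.
- by apply: invertible_mxM => //; apply: invertible_Eprod; apply: Eprod_upper.
- by rewrite K1class_EprodMl ?K1class_lower //; apply: Eprod_upper.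
Qed.

Lemma fredholm_det_inverse n (w w' : op n n) c : (forall D v, w D (w' D v) = v) ->
  fredholm_det w c -> fredholm_det w' (- c).
Proof.
move=> ww' [N [U [V [wE [G G_inv] <-]]]]; have [VUG GVU] := G_inv.
have w'E D v : w' D v = v + (- U *m G^it) *m (V D v)^it.
  have -> : V D v = (1%:M + V N U) *m V D (w' D v).
    by rewrite -{1}(ww' _ v) wE raddfD /= functionalsM mulmxDl mul1mx.
  rewrite -{2}(ww' _ v) wE -mulmxA -map_mxM mulKmx_inverse // mulNmx.
  by rewrite addrK.
have GE : 1%:M + V N (- U *m G^it) = G.
  by rewrite functionalsM raddfN mulNmx -VUG mulmxDl mul1mx addrK.
exists N, (- U *m G^it), V; rewrite GE; split=> //.
  by exists (1%:M + V N U); apply: inverse_mx_sym.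
exact: K1class_inverse.
Qed.

Section Uniqueness.
Hypothesis dual_basis :
  forall s : seq M, exists2 B, scalar_finite_rank it B & forall m, m \in s -> B m = m.

Lemma finite_rank_retract n k (U : 'M[M]_(n, k)) :
  exists N (b : 'M[M]_(n, N)) (c : functionals n N), U = b *m (c k U)^it.
Proof.
have [B /(_ n)[N [b [c BE]]] Bid] := dual_basis [seq U p.1 p.2 | p : 'I_n * 'I_k].
exists N, b, c; rewrite -BE; apply/matrixP=> i j; rewrite mxE Bid //.
exact: (image_f (fun p : 'I_n * 'I_k => U p.1 p.2) (x := (i, j))).
Qed.

Lemma fredholm_det_unique n (w : op n n) c c' :
  fredholm_det w c -> fredholm_det w c' -> c = c'.
Proof.
move=> [N [U [V [wE _ <-]]]] [N' [U' [V' [wE' _ <-]]]].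
have UV D v : U *m (V D v)^it = U' *m (V' D v)^it by apply: (addrI v); rewrite -wE -wE'.
have [k [b [d]]] := finite_rank_retract (row_mx U U').
rewrite mxop_row map_row_mx mul_mx_row => /eq_row_mx[bU bU'].
rewrite {1}bU functionalsM K1class_add1mulmxC {1}bU' functionalsM [RHS]K1class_add1mulmxC.
by rewrite -!functionalsM UV.
Qed.

End Uniqueness.
End FredholmDeterminant.

(** * Injectivity of K_1 under localization *)

Lemma map_mx_mul_delta (M : pzRingType) (H : {additive M -> M}) n p D (i : 'I_p) (j : 'I_n)
  (v : 'M_(n, D)) : map_mx H (delta_mx i j *m v) = delta_mx i j *m map_mx H v.
Proof.
apply/matrixP=> k l; rewrite !mxE raddf_sum; apply: eq_bigr => q _; rewrite !mxE.
by case: andP => _; rewrite ?mul1r ?mul0r ?raddf0.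
Qed.

Lemma mul_delta_scalar_mx (M : pzRingType) m n (i : 'I_m) (j : 'I_n) (b : M) :
  delta_mx i j *m b%:M = b *: delta_mx i j.
Proof.
apply/matrixP=> k l; rewrite !mxE (bigD1 j) //= big1 => [|q /negbTE qj]; last first.
  by rewrite mxE qj andbF mul0r.
rewrite !mxE eqxx andbT addr0 [j == l]eq_sym.
by case: (k == i); case: (l == j); rewrite ?mul1r ?mul0r ?mulr1 ?mulr0 ?mulr0n.
Qed.

Section EvaluationDefect.
Variables (R M : pzRingType) (it sg : {rmorphism R -> M}) (ev : {rmorphism M -> R}).
Variables (x : M) (y : rlinear it it).
Local Notation "W ^it" := (map_mx it W) (at level 2, format "W ^it").
Local Notation "W ^sg" := (map_mx sg W) (at level 2, format "W ^sg").
Local Notation functional := (rlinear it (idfun : {rmorphism R -> R})).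
Local Notation op := (mxop it it).

(* In the application [M = R[s, 1/s]] with [R = A[t, 1/t]], [it] is the inclusion of
   the constants, [sg] and [ev] are the substitutions [t -> s] and [s -> t], [x = s - t],
   and [y] is the division by [x]. *)
Hypotheses (ev_it : cancel it ev) (ev_sg : cancel sg ev).
Hypotheses (x_central : forall m, GRing.comm x m) (ev_x : ev x = 0).
Hypotheses (yx : forall m, y (x * m) = m) (xy : forall m, x * y m = m - it (ev m)).
Hypothesis dual_basis :
  forall s : seq M, exists2 B, scalar_finite_rank it B & forall m, m \in s -> B m = m.

Definition ev_functional : functional := rlinear_rmorphism (jt := idfun) ev_it.
Definition it_rlinear : rlinear idfun it := rlinear_rmorphism (it := idfun) (h := it) (frefl it).
Definition ev_op n : op n n := mxop_map n (rlinear_comp it_rlinear ev_functional).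

Lemma ev_opE n D (v : 'M_(n, D)) : ev_op n D v = (map_mx ev v)^it.
Proof. by rewrite /= map_mx_comp. Qed.

Definition quasi_conj n (theta : op n n) : op n n :=
  mxop_add (mxop_comp (mxop_mull it x%:M) (mxop_comp theta (mxop_map n y))) (ev_op n).

Lemma quasi_conjE n (theta : op n n) D v :
  quasi_conj theta D v = x%:M *m theta D (map_mx y v) + ev_op n D v.
Proof. by []. Qed.

Lemma y_it r : y (it r) = 0.
Proof. by rewrite -[LHS]yx xy ev_it subrr raddf0. Qed.

Lemma mull_x_map_y n D (v : 'M_(n, D)) : x%:M *m map_mx y v = v - ev_op n D v.
Proof. by rewrite mul_scalar_mx; apply/matrixP=> i j; rewrite !mxE xy. Qed.

Lemma map_y_mull_x n D (v : 'M_(n, D)) : map_mx y (x%:M *m v) = v.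
Proof. by rewrite mul_scalar_mx; apply/matrixP=> i j; rewrite !mxE yx. Qed.

Lemma map_y_quasi_conj n (theta : op n n) D v :
  map_mx y (quasi_conj theta D v) = theta D (map_mx y v).
Proof.
rewrite quasi_conjE map_mxD map_y_mull_x ev_opE -[RHS]addr0; congr (_ + _).
by apply/matrixP=> i j; rewrite !mxE; apply: y_it.
Qed.

Lemma ev_quasi_conj n (theta : op n n) D v : ev_op n D (quasi_conj theta D v) = ev_op n D v.
Proof.
rewrite quasi_conjE mul_scalar_mx !ev_opE; congr (_^it); apply/matrixP=> i j.
by rewrite !mxE rmorphD rmorphM ev_x mul0r add0r ev_it.
Qed.

Lemma quasi_conj_comp n (theta theta' : op n n) D v :
  quasi_conj (mxop_comp theta theta') D v = quasi_conj theta D (quasi_conj theta' D v).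
Proof. by rewrite [RHS]quasi_conjE map_y_quasi_conj ev_quasi_conj. Qed.

Definition defect n (theta : op n n) (c : K1 R) : Prop :=
  exists2 w : op n n, fredholm_det w c & forall D v, quasi_conj theta D v = theta D (w D v).

Lemma defect_ext n (theta theta' : op n n) c : (forall D v, theta D v = theta' D v) ->
  defect theta c -> defect theta' c.
Proof.
move=> eq_theta [w wc wE]; exists w => // D v.
by rewrite -eq_theta -wE !quasi_conjE eq_theta.
Qed.

Lemma defect_unique n (theta theta' : op n n) c c' : inverse_op theta theta' ->
  defect theta c -> defect theta c' -> c = c'.
Proof.
move=> [_ theta'K] [w wc wE] [w' w'c' w'E]; apply: (fredholm_det_unique dual_basis wc).
by apply: fredholm_det_ext w'c' => D v; rewrite -[LHS]theta'K -w'E wE theta'K.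
Qed.

Lemma defect_id n : defect (mxop_id it n) 0.
Proof.
exists (mxop_id it n) => [|D v]; first exact: fredholm_det_id.
by rewrite quasi_conjE /= mull_x_map_y subrK.
Qed.

Lemma defect_comp n (theta1 theta2 theta2' : op n n) c1 c2 : inverse_op theta2 theta2' ->
  defect theta1 c1 -> defect theta2 c2 -> defect (mxop_comp theta1 theta2) (c1 + c2).
Proof.
move=> inv2 [w1 w1c w1E] [w2 w2c w2E].
exists (mxop_comp (mxop_comp theta2' (mxop_comp w1 theta2)) w2) => [|D v].
  by apply: fredholm_det_comp w2c; apply: fredholm_det_conj => //; apply: inverse_op_sym.
by rewrite quasi_conj_comp w2E w1E /= inv2.1.
Qed.

Lemma defect_fredholm n (theta theta' : op n n) c : inverse_op theta theta' ->
  fredholm_det theta c -> defect theta 0.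
Proof.
move=> [thetaK theta'K] thetac; have thetaVc := fredholm_det_inverse thetaK thetac.
exists (mxop_comp theta' (quasi_conj theta)) => [|D v]; last by rewrite /= thetaK.
rewrite -(addNr c); apply: fredholm_det_comp => //.
have [N [U [V [thetaE inv cE]]]] := thetac.
exists N, (x%:M *m U), (mxop_comp V (mxop_map n y)); split.
- move=> D v; rewrite quasi_conjE thetaE mulmxDr mull_x_map_y mulmxA.
  by rewrite addrAC subrK.
- by rewrite /= map_y_mull_x.
- by rewrite /= map_y_mull_x.
Qed.

Lemma defect_mull n (a a' : 'M[R]_n) : inverse_mx a a' ->
  defect (mxop_mull it a^sg) (K1class a').
Proof.
move=> aa'; have [asK _] := inverse_mx_map sg aa'.
have VU : 1%:M + mxop_map n ev_functional n (a'^sg - 1%:M) = a'.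
  rewrite /= map_mxB map_mx1 addrC subrK; apply/matrixP=> i j; rewrite !mxE.
  exact: ev_sg.
exists (mxop_add (mxop_id it n) (mxop_comp (mxop_mull it (a'^sg - 1%:M)) (ev_op n))).
  exists n, (a'^sg - 1%:M), (mxop_map n ev_functional); rewrite VU; split=> //.
    by move=> D v; rewrite -ev_opE.
  by exists a; apply: inverse_mx_sym.
move=> D v; rewrite quasi_conjE /= mulmxA scalar_mx_comm // -mulmxA mull_x_map_y.
by rewrite [RHS]mulmxDr mulmxBl mul1mx !mulmxBr mulKmx_inverse // addrA addrAC.
Qed.

Section Elementary.
Variables (n : nat) (i j : 'I_n).
Hypothesis ij : i != j.

Definition elementary_op (H : rlinear it it) : op n n :=
  mxop_add (mxop_id it n) (mxop_comp (mxop_mull it (delta_mx i j)) (mxop_map n H)).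

Lemma elementary_op_comp (G H : rlinear it it) D v :
  elementary_op G D (elementary_op H D v) = v + delta_mx i j *m (map_mx H v + map_mx G v).
Proof.
have -> : elementary_op G D (elementary_op H D v) = v + delta_mx i j *m map_mx H v
    + delta_mx i j *m map_mx G (v + delta_mx i j *m map_mx H v) by [].
rewrite map_mxD map_mx_mul_delta mulmxDr mulmxA mul_delta_mx_0 1?eq_sym //.
by rewrite mul0mx addr0 -addrA -mulmxDr.
Qed.

Lemma inverse_elementary_op (H : rlinear it it) :
  inverse_op (elementary_op H) (elementary_op (rlinear_comp (rlinear_mull it (-1)) H)).
Proof.
by split=> D v; rewrite elementary_op_comp -[RHS]addr0 -(mulmx0 _ (delta_mx i j));
  congr (_ + _ *m _); apply/matrixP=> k l; rewrite !mxE /= mulN1r ?subrr ?addNr.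
Qed.

Lemma fredholm_det_elementary (B : M -> M) : scalar_finite_rank it B ->
  exists2 w : op n n, fredholm_det w 0 & forall D v, w D v = v + delta_mx i j *m map_mx B v.
Proof.
move=> /(_ 1)[N [U [V BE]]].
pose Ui := (delta_mx i 0 : 'M_(n, 1)) *m U.
pose Vj := mxop_comp V (mxop_mull it (delta_mx 0 j : 'M_(1, n))).
exists (mxop_add (mxop_id it n)
  (mxop_comp (mxop_mull it Ui) (mxop_comp (mxop_map N it_rlinear) Vj))).
  have VU : Vj _ Ui = 0 by rewrite /= /Ui mulmxA mul_delta_mx_0 1?eq_sym // mul0mx raddf0.
  exists N, Ui, Vj; rewrite VU addr0 K1class1; split=> //; exact: invertible_mx1.
move=> D v /=; congr (_ + _); rewrite -mulmxA -BE -(mul_delta_mx (0 : 'I_1) i j) -mulmxA.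
by rewrite -!rowE map_row.
Qed.

Lemma defect_elementary_op (H : rlinear it it) :
  scalar_finite_rank it (fun m => x * H (y m) - H m) -> defect (elementary_op H) 0.
Proof.
pose B m := x * H (y m) - H m; case/fredholm_det_elementary=> w w0 wE; exists w => // D v.
rewrite wE -[RHS]/(_ + delta_mx i j *m map_mx H _) map_mxD map_mx_mul_delta.
rewrite mulmxDr !mulmxA mul_delta_mx_0 1?eq_sym // mul0mx addr0 -addrA -mulmxDr.
have -> : map_mx B v + map_mx H v = x%:M *m map_mx H (map_mx y v).
  by rewrite mul_scalar_mx; apply/matrixP=> k l; rewrite !mxE subrK.
rewrite mulmxA -scalar_mx_comm // -mulmxA quasi_conjE /= mulmxDr mull_x_map_y.
by rewrite addrAC subrK.
Qed.

End Elementary.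

Variables (Q : pzRingType) (rho : {rmorphism R -> Q}) (den : R -> Prop).
Hypotheses (rho_inj : injective rho) (den1 : den 1).
Hypothesis denM : forall f g, den f -> den g -> den (f * g).
Hypothesis den_central : forall f, den f -> forall m, GRing.comm (sg f) m.
Hypothesis rho_den_central : forall f, den f -> forall h, GRing.comm (rho f) h.
Hypothesis den_frac : forall h, exists f b, den f /\ rho f * h = rho b.
Hypothesis den_div : forall f, den f -> exists2 z : rlinear it it,
  forall m, z (sg f * m) = m & scalar_finite_rank it (fun m => m - sg f * z m).

(* [theta] lifts the matrix [h = b / f] over [Q]: it differs from [b f^-1], with the
   inverse of [f] replaced by a division, by an operator of finite rank. *)
Definition lifts n (theta : op n n) (h : 'M[Q]_n) : Prop :=
  exists f (b : 'M[R]_n), [/\ den f, (rho f)%:M *m h = map_mx rho b &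
    finite_rank it (fun D (v : 'M_(n, D)) => theta D ((sg f)%:M *m v) - b^sg *m v)].

Lemma lifts_id n : lifts (mxop_id it n) 1%:M.
Proof.
exists 1, 1%:M; split=> //; first by rewrite rmorph1 mul1mx map_mx1.
apply: finite_rank_ext (finite_rank0 it n n) => D v.
by rewrite /= rmorph1 map_mx1 subrr.
Qed.

Lemma lifts_comp n (theta theta' : op n n) h h' :
  lifts theta h -> lifts theta' h' -> lifts (mxop_comp theta theta') (h *m h').
Proof.
move=> [f [b [df fh thetab]]] [f' [b' [df' f'h' theta'b']]].
exists (f * f'), (b *m b'); split; first exact: denM.
  rewrite map_mxM -fh -f'h' rmorphM scalar_mxM -!mulmxA; congr (_ *m _).
  by rewrite !mulmxA scalar_mx_comm // => i j; apply: rho_den_central.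
apply: finite_rank_ext (finite_rankD
  (finite_rank_compl theta (finite_rank_compr (mxop_mull it (sg f)%:M) theta'b'))
  (finite_rank_compr (mxop_mull it b'^sg) thetab)) => D v /=.
have f_central (a : 'M_n) : a *m (sg f)%:M = (sg f)%:M *m a.
  by rewrite scalar_mx_comm // => i j; apply: den_central.
rewrite raddfB /= [b'^sg *m (_ *m v)]mulmxA f_central -mulmxA addrA subrK map_mxM rmorphM.
by rewrite scalar_mxM !mulmxA f_central.
Qed.

Lemma lifts_matrix n (theta : op n n) (a : 'M[R]_n) : lifts theta (map_mx rho a) ->
  finite_rank it (fun D (v : 'M_(n, D)) => theta D v - a^sg *m v).
Proof.
move=> [f [b [df fa thetab]]]; have [z zf zfin] := den_div df.
have {fa} fa : f%:M *m a = b.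
  apply/matrixP=> i j; apply: rho_inj; move/matrixP/(_ i j): fa.
  by rewrite !mul_scalar_mx !mxE rmorphM.
pose theta_sub_a := mxop_add theta (mxop_mull it (- a^sg)).
apply: finite_rank_ext (finite_rankD (finite_rank_compr (mxop_map n z) thetab)
  (finite_rank_compl theta_sub_a (zfin n))) => D v /=.
have -> : map_mx (fun m => m - sg f * z m) v = v - (sg f)%:M *m map_mx z v.
  by rewrite mul_scalar_mx; apply/matrixP=> i j; rewrite !mxE.
have -> : b^sg *m map_mx z v = a^sg *m ((sg f)%:M *m map_mx z v).
  by rewrite -fa map_mxM map_scalar_mx scalar_mx_comm ?mulmxA // => i j; apply: den_central.
rewrite raddfB mulmxBr !mulNmx /= opprK [X in _ + X]addrACA [- theta _ _ + _]addrC.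
by rewrite -[_ - theta _ _]opprB addrCA subrr addr0.
Qed.

Lemma division_quasi_central (z : rlinear it it) f : (forall m, z (sg f * m) = m) ->
  scalar_finite_rank it (fun m => m - sg f * z m) -> den f ->
  scalar_finite_rank it (fun m => x * z (y m) - z m).
Proof.
move=> zf zfin df; pose zx := rlinear_comp z (rlinear_mull it (- x)).
have z_ev := scalar_finite_rank1 (- z 1) ev_functional.
apply: scalar_finite_rank_ext (scalar_finite_rankD
  (scalar_finite_rank_compl zx (scalar_finite_rank_compr y zfin)) z_ev) => m /=.
have zm : z m = z (x * y m) + z 1 * it (ev m).
  by rewrite -rlinearM mul1r -raddfD xy subrK.
have zxf : z (x * (sg f * z (y m))) = x * z (y m).
  by rewrite mulrA x_central -mulrA zf.
by rewrite zm opprD addrA mulNr -mulrN opprB mulrBr raddfB /= zxf mulNr.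
Qed.

Lemma elementary_lift n (i j : 'I_n) h : i != j -> exists theta theta' : op n n,
  [/\ inverse_op theta theta', defect theta 0 & lifts theta (1%:M + h *: delta_mx i j)].
Proof.
move=> ij; have [f [b [df fh]]] := den_frac h; have [z zf zfin] := den_div df.
pose H := rlinear_comp (rlinear_mull it (sg b)) z.
exists (elementary_op i j H), (elementary_op i j (rlinear_comp (rlinear_mull it (-1)) H)).
split; first exact: inverse_elementary_op.
  apply: defect_elementary_op => //.
  apply: scalar_finite_rank_ext (scalar_finite_rank_compl (rlinear_mull it (sg b))
    (division_quasi_central zf zfin df)) => m /=.
  by rewrite mulrBr !mulrA x_central.
exists f, (f%:M + b *: delta_mx i j); split=> //.
  rewrite map_mxD map_scalar_mx map_mxZ map_delta_mx -fh mulmxDr mulmx1.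
  by rewrite mul_scalar_mx scalerA.
apply: finite_rank_ext (finite_rank0 it n n) => D v.
have -> : elementary_op i j H D ((sg f)%:M *m v)
    = (sg f)%:M *m v + delta_mx i j *m ((sg b)%:M *m v).
  by congr (_ + _ *m _); rewrite !mul_scalar_mx; apply/matrixP=> k l; rewrite !mxE /= zf.
rewrite map_mxD map_scalar_mx map_mxZ map_delta_mx mulmxDl mulmxA mul_delta_scalar_mx.
by rewrite opprD addrACA !subrr addr0.
Qed.

Lemma Eprod_lift n (h : 'M[Q]_n) : Eprod h -> exists theta theta' : op n n,
  [/\ inverse_op theta theta', defect theta 0 & lifts theta h].
Proof.
elim=> [|_ a [i [j [c [ij ->]]]] _ [theta [theta' [inv def lift]]]].
  by exists (mxop_id it n), (mxop_id it n); split; [split|apply: defect_id|apply: lifts_id].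
have [theta1 [theta1' [inv1 def1 lift1]]] := elementary_lift c ij.
exists (mxop_comp theta1 theta), (mxop_comp theta' theta1'); split.
- exact: inverse_op_comp.
- by rewrite -[X in defect _ X]addr0; apply: defect_comp inv def1 def.
- exact: lifts_comp.
Qed.

(* [theta = a^sg w] with [w] a finite rank perturbation of the identity, so its defect
   is both [0] and [- K1class a]. *)
Theorem K1class_localization n (a : 'M[R]_n) : invertible_mx a ->
  Eprod (map_mx rho a) -> K1class a = 0.
Proof.
case=> a' aa' /Eprod_lift[theta [theta' [inv def0 /lifts_matrix theta_a]]].
have [asK a'sK] := inverse_mx_map sg aa'.
pose w := mxop_comp (mxop_mull it a'^sg) theta.
have inv_w : inverse_op w (mxop_comp theta' (mxop_mull it a^sg)).
  exact: inverse_op_comp (inverse_op_mull it (inverse_mx_sym (inverse_mx_map sg aa'))) inv.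
have wfin : finite_rank it (fun D v => w D v - v).
  apply: finite_rank_ext (finite_rank_compl (mxop_mull it a'^sg) theta_a) => D v /=.
  by rewrite mulmxBr mulKmx_inverse.
have [c wc] := fredholm_det_exists wfin inv_w.
have : defect theta (K1class a' + 0).
  apply: defect_ext (defect_comp inv_w (defect_mull aa') (defect_fredholm inv_w wc)) => D v /=.
  by rewrite mulKmx_inverse.
move/(defect_unique inv def0)/esym; rewrite addr0 (K1class_inverse aa').
by move/eqP; rewrite oppr_eq0 => /eqP.
Qed.

End EvaluationDefect.

(** * Monoid rings *)

(* The ring structure of [{malg R[G]}] requires [g * h = 1 -> g = h = 1], which
   excludes Z and the bicyclic monoid.  The operations are locked because a failing
   conversion test between ring elements would otherwise unfold them down to finite
   maps. *)
Definition mring (R : pzRingType) (G : monoidType) := {malg R[G]}.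
HB.instance Definition _ (R : pzRingType) (G : monoidType) := Choice.on (mring R G).

HB.lock Definition mring_add (R : pzRingType) (G : monoidType) (u v : {malg R[G]}) : mring R G :=
  u + v.
HB.lock Definition mring_opp (R : pzRingType) (G : monoidType) (u : {malg R[G]}) : mring R G :=
  - u.
HB.lock Definition monom (R : pzRingType) (G : monoidType) (g : G) (a : R) : mring R G :=
  << a *g g >>.
HB.lock Definition mcoef (R : pzRingType) (G : monoidType) (g : G) (u : mring R G) : R :=
  (u : {malg R[G]})@_g.

Section MonoidRingZmodule.
Variables (R : pzRingType) (G : monoidType).
Implicit Types (u v w : mring R G) (a b : R) (g h : G).

Fact mring_addA : associative (@mring_add R G).
Proof. by move=> u v w; rewrite !mring_add.unlock addrA. Qed.
Fact mring_addC : commutative (@mring_add R G).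
Proof. by move=> u v; rewrite !mring_add.unlock addrC. Qed.
Fact mring_add0 : left_id (monom 1%g 0) (@mring_add R G).
Proof. by move=> u; rewrite mring_add.unlock monom.unlock monalgU0 add0r. Qed.
Fact mring_addN : left_inverse (monom 1%g 0) (@mring_opp R G) (@mring_add R G).
Proof.
by move=> u; rewrite mring_add.unlock mring_opp.unlock monom.unlock monalgU0 addNr.
Qed.
HB.instance Definition _ :=
  GRing.isZmodule.Build (mring R G) mring_addA mring_addC mring_add0 mring_addN.

Lemma mcoefP u v : (forall g, mcoef g u = mcoef g v) -> u = v.
Proof. by rewrite mcoef.unlock => uv; apply/malgP. Qed.

Lemma mcoef_monom g a h : mcoef h (monom g a) = if g == h then a else 0.
Proof. by rewrite mcoef.unlock monom.unlock mcoeffU; case: eqP. Qed.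

Fact mcoef_is_additive g : zmod_morphism (@mcoef R G g).
Proof.
move=> u v; rewrite -[u - v]/(mring_add u (mring_opp v)) mcoef.unlock mring_add.unlock.
by rewrite mring_opp.unlock mcoeffB.
Qed.
HB.instance Definition _ g :=
  GRing.isZmodMorphism.Build (mring R G) R (mcoef g) (mcoef_is_additive g).

Lemma mcoefD g : {morph @mcoef R G g : u v / u + v}. Proof. exact: raddfD. Qed.

Fact monom_is_additive g : zmod_morphism (@monom R G g).
Proof.
by move=> a b; apply: mcoefP => h; rewrite raddfB /= !mcoef_monom; case: eqP; rewrite ?subrr.
Qed.
HB.instance Definition _ g :=
  GRing.isZmodMorphism.Build R (mring R G) (monom g) (monom_is_additive g).

Lemma mring_ind (P : mring R G -> Prop) :
  (forall u v, P u -> P v -> P (u + v)) -> (forall g a, P (monom g a)) -> forall u, P u.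
Proof.
move=> PD Pmonom u; rewrite [u]monalgE; apply: (big_ind P) => [|v w Pv Pw|g _].
- by have := Pmonom 1%g 0; rewrite monom.unlock monalgU0.
- by have := PD _ _ Pv Pw; rewrite -[_ + _]/(mring_add v w) mring_add.unlock.
- by have := Pmonom g (mcoeff g u); rewrite monom.unlock.
Qed.

Section AdditiveExtension.
Variables (V : zmodType) (f : G -> R -> V).
Hypothesis fD : forall g, {morph f g : a b / a + b}.

Definition mring_sum u : V := \sum_(g <- msupp u) f g (mcoef g u).

Fact f0 g : f g 0 = 0.
Proof. by apply: (addrI (f g 0)); rewrite -fD !addr0. Qed.

Lemma mring_sum_supp u (d : {fset G}) : (msupp u `<=` d)%fset ->
  mring_sum u = \sum_(g <- d) f g (mcoef g u).
Proof.
move=> ud; apply: big_fset_incl => // g _ gu.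
by rewrite mcoef.unlock mcoeff_outdom // f0.
Qed.

Lemma mring_sumD : {morph mring_sum : u v / u + v}.
Proof.
move=> u v; have supp_uv : (msupp ((u + v)%R : mring R G) `<=` msupp u `|` msupp v)%fset.
  by rewrite -[(u + v)%R]/(mring_add u v) mring_add.unlock msuppD_le.
rewrite (mring_sum_supp supp_uv) (mring_sum_supp (fsubsetUl (msupp u) (msupp v))).
rewrite (mring_sum_supp (fsubsetUr (msupp u) (msupp v))) -big_split /=.
by apply: eq_bigr => g _; rewrite raddfD fD.
Qed.

Lemma mring_sum0 : mring_sum 0 = 0.
Proof. by apply: (addrI (mring_sum 0)); rewrite -mring_sumD !addr0. Qed.

Lemma mring_sum_monom g a : mring_sum (monom g a) = f g a.
Proof.
rewrite (@mring_sum_supp _ [fset g]%fset) ?big_seq_fset1 ?mcoef_monom ?eqxx //.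
by rewrite monom.unlock msuppU_le.
Qed.

End AdditiveExtension.
End MonoidRingZmodule.

HB.lock Definition mring_mul (R : pzRingType) (G : monoidType) (u v : mring R G) : mring R G :=
  mring_sum (fun g a => mring_sum (fun h b => monom (g * h)%g (a * b)) v) u.

Section MonoidRing.
Variables (R : pzRingType) (G : monoidType).
Implicit Types (u v w : mring R G) (a b : R) (g h : G).

Let mul_monom_l g a v := mring_sum (fun h b => monom (g * h)%g (a * b)) v.

Fact monom_mulD g a h : {morph (fun b : R => monom (g * h)%g (a * b)) : b b' / b + b'}.
Proof. by move=> b b'; rewrite mulrDr raddfD. Qed.

Fact mul_monom_lD g v : {morph (fun a => mul_monom_l g a v) : a a' / a + a'}.
Proof.
move=> a a'; rewrite /mul_monom_l /mring_sum -big_split.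
by apply: eq_bigr => h _ /=; rewrite mulrDl raddfD.
Qed.

Fact mring_mulDl : left_distributive (@mring_mul R G) +%R.
Proof. by move=> u v w; rewrite mring_mul.unlock (mring_sumD (mul_monom_lD^~ w)). Qed.

Fact mring_mulDr : right_distributive (@mring_mul R G) +%R.
Proof.
move=> u v w; elim/mring_ind: u => [u u' uE u'E|g a].
  by rewrite !mring_mulDl uE u'E addrACA.
rewrite mring_mul.unlock !(mring_sum_monom (mul_monom_lD^~ _)).
by rewrite /mul_monom_l (mring_sumD (monom_mulD g a)).
Qed.

Fact mring_mul_monom g a h b :
  mring_mul (monom g a) (monom h b) = monom (g * h)%g (a * b).
Proof.
rewrite mring_mul.unlock (mring_sum_monom (mul_monom_lD^~ _)).
exact: (mring_sum_monom (monom_mulD g a)).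
Qed.

Fact mring_mulA : associative (@mring_mul R G).
Proof.
move=> u v w; elim/mring_ind: u => [u u' uE u'E|g a]; first by rewrite !mring_mulDl uE u'E.
elim/mring_ind: v => [v v' vE v'E|h b]; first by rewrite !(mring_mulDl, mring_mulDr) vE v'E.
elim/mring_ind: w => [w w' wE w'E|k c]; first by rewrite !mring_mulDr wE w'E.
by rewrite !mring_mul_monom mulrA mulgA.
Qed.

Fact mring_mul1 : left_id (monom 1%g 1) (@mring_mul R G).
Proof.
elim/mring_ind=> [u v uE vE|g a]; first by rewrite mring_mulDr uE vE.
by rewrite mring_mul_monom mul1r mul1g.
Qed.

Fact mring_mulr1 : right_id (monom 1%g 1) (@mring_mul R G).
Proof.
elim/mring_ind=> [u v uE vE|g a]; first by rewrite mring_mulDl uE vE.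
by rewrite mring_mul_monom mulr1 mulg1.
Qed.

HB.instance Definition _ := GRing.Zmodule_isPzRing.Build (mring R G)
  mring_mulA mring_mul1 mring_mulr1 mring_mulDl mring_mulDr.

Lemma monomM g a h b : monom g a * monom h b = monom (g * h)%g (a * b) :> mring R G.
Proof. exact: mring_mul_monom. Qed.

Lemma mring_comm u : (forall g a, GRing.comm u (monom g a)) -> forall v, GRing.comm u v.
Proof.
move=> u_comm; elim/mring_ind=> [v w uv uw|//]; exact: commrD.
Qed.

Fact monom1_monoid : monoid_morphism (@monom R G 1%g).
Proof. by split=> // a b; rewrite monomM mulg1. Qed.
HB.instance Definition _ :=
  GRing.isMonoidMorphism.Build R (mring R G) (monom 1%g) monom1_monoid.

Definition mconst : {rmorphism R -> mring R G} := monom 1%g.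

Lemma monom1E : monom 1%g = mconst. Proof. by []. Qed.

Lemma monomE g a : monom g a = mconst a * monom g 1.
Proof. by rewrite monomM mul1g mulr1. Qed.

Lemma mcoef_mulr_const g u a : mcoef g (u * mconst a) = mcoef g u * a.
Proof.
elim/mring_ind: u => [u v uE vE|h b]; first by rewrite mulrDl !mcoefD uE vE mulrDl.
by rewrite monomM !mcoef_monom mulg1; case: eqP; rewrite ?mul0r.
Qed.

Section Lift.
Variables (S : pzRingType) (f : {rmorphism R -> S}) (phi : G -> S).
Hypotheses (phi1 : phi 1%g = 1) (phiM : forall g h, phi (g * h)%g = phi g * phi h).
Hypothesis f_phi_comm : forall a g, GRing.comm (f a) (phi g).

Definition mring_lift_fun u : S := mring_sum (fun g a => f a * phi g) u.

Fact lift_monomD g : {morph (fun a : R => f a * phi g) : a b / a + b}.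
Proof. by move=> a b; rewrite rmorphD mulrDl. Qed.

Fact mring_lift_additive : zmod_morphism mring_lift_fun.
Proof. by move=> u v; apply: (canRL (addrK _)); rewrite -(mring_sumD lift_monomD) subrK. Qed.
HB.instance Definition _ :=
  GRing.isZmodMorphism.Build (mring R G) S mring_lift_fun mring_lift_additive.

Lemma mring_lift_funU g a : mring_lift_fun (monom g a) = f a * phi g.
Proof. exact: (mring_sum_monom lift_monomD). Qed.

Fact mring_lift_monoid : monoid_morphism mring_lift_fun.
Proof.
split=> [|u v]; first by rewrite mring_lift_funU rmorph1 phi1 mulr1.
elim/mring_ind: u => [u u' uE u'E|g a]; first by rewrite mulrDl !raddfD /= uE u'E mulrDl.
elim/mring_ind: v => [v v' vE v'E|h b]; first by rewrite mulrDr !raddfD /= vE v'E mulrDr.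
rewrite monomM !mring_lift_funU rmorphM phiM -!mulrA; congr (_ * _).
by rewrite [RHS]mulrA -f_phi_comm mulrA.
Qed.
HB.instance Definition _ :=
  GRing.isMonoidMorphism.Build (mring R G) S mring_lift_fun mring_lift_monoid.

Definition mring_lift : {rmorphism mring R G -> S} := mring_lift_fun.

Lemma mring_lift_monom g a : mring_lift (monom g a) = f a * phi g.
Proof. exact: mring_lift_funU. Qed.

Lemma mring_lift_const a : mring_lift (mconst a) = f a.
Proof. by rewrite mring_lift_monom phi1 mulr1. Qed.

End Lift.
End MonoidRing.

Section CentralElements.
Variables (R : pzRingType) (G : monoidType).

Lemma monom1_const_comm g (a : R) : GRing.comm (monom g 1) (mconst _ G a).
Proof. by rewrite /GRing.comm !monomM mul1r mulr1 mul1g mulg1. Qed.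

Lemma mconst_central (a : R) : (forall b, GRing.comm a b) -> forall u, GRing.comm (mconst _ G a) u.
Proof.
move=> a_central; apply: mring_comm => g b.
by rewrite /GRing.comm !monomM mul1g mulg1 a_central.
Qed.

Lemma monom1_central g : (forall h, commute g h) -> forall u : mring R G, GRing.comm (monom g 1) u.
Proof.
move=> g_central; apply: mring_comm => h b.
by rewrite /GRing.comm !monomM mul1r mulr1 g_central.
Qed.

Lemma mring_trivialE (u : mring R G) : (forall g : G, g = 1%g) -> u = mconst _ G (mcoef 1%g u).
Proof.
move=> G1; apply: mcoefP => g.
by rewrite (G1 g) mcoef_monom eqxx.
Qed.

End CentralElements.

Section Functoriality.
Variables (R S : pzRingType) (G H : monoidType) (f : {rmorphism R -> S}) (phi : G -> H).
Hypotheses (phi1 : phi 1%g = 1%g) (phiM : forall g h, phi (g * h)%g = (phi g * phi h)%g).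

Fact monom_phi1 : monom (phi 1%g) (1 : S) = 1. Proof. by rewrite phi1. Qed.
Fact monom_phiM g h : monom (phi (g * h)%g) (1 : S) = monom (phi g) 1 * monom (phi h) 1.
Proof. by rewrite monomM mulr1 phiM. Qed.

Definition mring_map : {rmorphism mring R G -> mring S H} :=
  mring_lift (f := mconst _ H \o f) monom_phi1 monom_phiM
    (fun a g => commr_sym (monom1_const_comm (phi g) (f a))).

Lemma mring_map_monom g a : mring_map (monom g a) = monom (phi g) (f a).
Proof. by rewrite mring_lift_monom /= -monomE. Qed.

End Functoriality.

Definition mring_map_coef (R S : pzRingType) (G : monoidType) (f : {rmorphism R -> S}) :
    {rmorphism mring R G -> mring S G} :=
  @mring_map R S G G f id erefl (fun _ _ => erefl).

Definition augmentation (R : pzRingType) (G : monoidType) : {rmorphism mring R G -> R} :=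
  @mring_lift R G R idfun (fun=> 1) erefl (fun _ _ => esym (mulr1 1)) (fun a g => commr1 a).

Fact mring_nonzero (R : nzRingType) (G : monoidType) : (1 : mring R G) != 0.
Proof.
apply/eqP=> /(congr1 (mcoef 1%g)); rewrite mcoef_monom eqxx raddf0.
by apply/eqP; apply: oner_neq0.
Qed.
HB.instance Definition _ (R : nzRingType) (G : monoidType) :=
  GRing.PzSemiRing_isNonZero.Build (mring R G) (mring_nonzero R G).

Section MonoidAlgebra.
Variables (K : comNzRingType) (G : monoidType).
Implicit Types (u v : mring K G) (a b : K).

Definition mring_scale a u : mring K G := mconst _ G a * u.

Fact mring_scaleA a b u : mring_scale a (mring_scale b u) = mring_scale (a * b) u.
Proof. by rewrite /mring_scale rmorphM mulrA. Qed.
Fact mring_scale1 : left_id 1 mring_scale.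
Proof. by move=> u; rewrite /mring_scale rmorph1 mul1r. Qed.
Fact mring_scaleDr : right_distributive mring_scale +%R.
Proof. by move=> a u v; rewrite /mring_scale mulrDr. Qed.
Fact mring_scaleDl v : {morph mring_scale^~ v : a b / a + b}.
Proof. by move=> a b; rewrite /mring_scale rmorphD mulrDl. Qed.
HB.instance Definition _ := GRing.Zmodule_isLmodule.Build K (mring K G)
  mring_scaleA mring_scale1 mring_scaleDr mring_scaleDl.

Lemma mring_scaleE a u : a *: u = mconst _ G a * u. Proof. by []. Qed.

Fact mring_scaleAl a u v : a *: (u * v) = (a *: u) * v.
Proof. by rewrite !mring_scaleE mulrA. Qed.
HB.instance Definition _ := GRing.Lmodule_isLalgebra.Build K (mring K G) mring_scaleAl.
Fact mring_scaleAr a u v : a *: (u * v) = u * (a *: v).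
Proof. by rewrite !mring_scaleE !mulrA (mconst_central (mulrC a) u). Qed.
HB.instance Definition _ := GRing.Lalgebra_isAlgebra.Build K (mring K G) mring_scaleAr.

End MonoidAlgebra.

(** * Laurent polynomials *)

Notation infinite_cyclic := (Algebra.to_multiplicative int).
Notation laurent R := (mring R infinite_cyclic).
Notation lconst R := (mconst R infinite_cyclic).
Notation lmonom k a := (@monom _ infinite_cyclic (k%R : int) a).
Notation lcoef k := (@mcoef _ infinite_cyclic (k%R : int)).

Section LaurentPolynomials.
Variable R : pzRingType.
Implicit Types (q : laurent R) (j k : int).

Lemma lmonom1_central k q : GRing.comm (lmonom k 1) q.
Proof. by apply: monom1_central => l; apply: addrC. Qed.

Lemma lcoef_lmonomMl k (a : R) q j : lcoef j (lmonom k a * q) = a * lcoef (j - k) q.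
Proof.
elim/mring_ind: q => [u v uE vE|l b]; first by rewrite mulrDr !mcoefD uE vE mulrDr.
rewrite monomM !mcoef_monom (fun_if (fun r => a * r)) mulr0.
have -> // : ((k : infinite_cyclic) * l == j)%g = (l == j - k :> int).
by rewrite -[LHS]/(k + l == j :> int) addrC eq_sym -subr_eq eq_sym.
Qed.

Lemma lmonom_inverse k (a b : R) : a * b = 1 -> lmonom k a * lmonom (- k) b = 1.
Proof. by move=> ab; rewrite monomM ab -[(_ * _)%g]/(k - k : int) subrr. Qed.

Lemma inverse_mx_lmonom n k (a b : R) : a * b = 1 -> b * a = 1 ->
  inverse_mx ((lmonom k a)%:M : 'M_n) (lmonom (- k) b)%:M.
Proof.
move=> ab ba; apply: inverse_mx_scalar; first exact: lmonom_inverse.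
by rewrite -[X in _ * lmonom X _]opprK lmonom_inverse.
Qed.

End LaurentPolynomials.

Section LaurentSupport.
Variable R : pzRingType.
Implicit Types (q : laurent R) (j k : int) (n : nat).

Definition supported_in j n q : Prop := forall k, ~~ (j <= k < j + n%:Z) -> lcoef k q = 0.

Lemma supported_inD j n q q' :
  supported_in j n q -> supported_in j n q' -> supported_in j n (q + q').
Proof. by move=> qj q'j k kj; rewrite mcoefD qj // q'j // addr0. Qed.

Lemma supported_in_sum j n q : supported_in j n q ->
  q = \sum_(i < n) lmonom (j + i%:Z) (lcoef (j + i%:Z) q).
Proof.
move=> qj; apply: mcoefP => k; rewrite raddf_sum /=.
under eq_bigr do rewrite mcoef_monom.
have [kj|kj] := boolP (j <= k < j + n%:Z); last first.
  rewrite qj // big1 // => i _; case: eqP => // ik; case/negP: kj; have := ltn_ord i; lia.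
have kjn : (`|(k - j)%R| < n)%N by lia.
have kE : j + `|(k - j)%R|%N%:Z = k by lia.
rewrite (bigD1 (Ordinal kjn)) //= big1 ?addr0 ?kE ?eqxx // => i ne.
by case: eqP => // ik; case/eqP: ne; apply: val_inj => /=; lia.
Qed.

Lemma supported_in_bound (s : seq (laurent R)) :
  exists B : nat, forall q, q \in s -> supported_in (- B%:Z) (B + B) q.
Proof.
elim: s => [|q s [B sB]]; first by exists 0.
have [B' qB'] : exists B : nat, forall k, (B <= `|k|)%N -> lcoef k q = 0.
  elim/mring_ind: (q) => [u v [B1 uB1] [B2 vB2]|k a].
    by exists (B1 + B2)%N => k Bk; rewrite mcoefD uB1 ?vB2 ?addr0 //; lia.
  by exists `|k : int|.+1%N => l; rewrite mcoef_monom; case: eqP => // ->; rewrite ltnn.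
exists (B + B')%N => p; rewrite inE => /orP[/eqP->|ps] k kB; first by apply: qB'; lia.
by apply: (sB p ps); lia.
Qed.

Definition lcoef_functional k : rlinear (lconst R) idfun.
Proof. by exists (lcoef k) => [u v|u a]; [apply: raddfB|apply: mcoef_mulr_const]. Defined.

Lemma supported_in_expansion j n q : supported_in j n q ->
  q = \sum_(i < n) lmonom (j + i%:Z) 1 * lconst R (lcoef_functional (j + i%:Z) q).
Proof.
move=> /supported_in_sum{1}->; apply: eq_bigr => i _.
by rewrite monomM mul1r mulg1.
Qed.

Lemma laurent_dual_basis (s : seq (laurent R)) :
  exists2 B, scalar_finite_rank (lconst R) B & forall m, m \in s -> B m = m.
Proof.
have [B sB] := supported_in_bound s; exists (fun m => \sum_(i < B + B)
    lmonom (- B%:Z + i%:Z) 1 * lconst R (lcoef_functional (- B%:Z + i%:Z) m)).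
  exact: scalar_finite_rank_sum.
by move=> m /sB/supported_in_expansion.
Qed.

End LaurentSupport.

Section LaurentDivision.
Variables (R : pzRingType) (d : nat) (c : nat -> R) (cd' c0' : R).
Hypotheses (cdV : c d * cd' = 1) (cVd : cd' * c d = 1).
Hypotheses (c0V : c 0 * c0' = 1) (cV0 : c0' * c 0 = 1).
Implicit Types (q m : laurent R) (j k : int).

Definition lpoly : laurent R := \sum_(l < d.+1) lmonom l%:Z (c l).
Local Notation f := lpoly.

Lemma lcoef_lpolyM q j : lcoef j (f * q) = \sum_(l < d.+1) c l * lcoef (j - l%:Z) q.
Proof.
by rewrite mulr_suml raddf_sum; apply: eq_bigr => l _; apply: lcoef_lmonomMl.
Qed.

Lemma lcoef_lpoly_lmonom k (w : R) j :
  lcoef j (f * lmonom k w) = if 0 <= j - k <= d%:Z then c `|j - k|%N * w else 0.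
Proof.
rewrite lcoef_lpolyM; under eq_bigr do rewrite mcoef_monom.
case: ifP => jk; last first.
  rewrite big1 // => l _; case: eqP => [kE|_]; rewrite ?mulr0 //.
  by have := ltn_ord l; lia.
have jkd : (`|(j - k)%R| < d.+1)%N by lia.
rewrite (bigD1 (Ordinal jkd)) //= big1 ?addr0 => [|l ne].
  by case: eqP => // ne; case: ne; lia.
case: eqP => [kE|_]; rewrite ?mulr0 //.
by case/eqP: ne; apply: val_inj => /=; lia.
Qed.

Lemma lpoly_division_unique q : supported_in 0 d (f * q) -> q = 0.
Proof.
move=> fq_small; have [B /(_ q (mem_head _ _)) qB] := supported_in_bound [:: q].
have high n k : 0 <= k -> (B <= `|k| + n)%N -> lcoef k q = 0.
  elim: n k => [|n IH] k k0 Bk; first by apply: qB; lia.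
  have lead : c d * lcoef k q = 0.
    have := fq_small (k + d%:Z); rewrite lcoef_lpolyM big_ord_recr big1 /=; last first.
      by move=> l _; rewrite IH ?mulr0 //; have := ltn_ord l; lia.
    by rewrite !add0r addrK; apply; lia.
  by rewrite -[LHS]mul1r -cVd -mulrA lead mulr0.
have low n k : k < 0 -> (B < `|k| + n)%N -> lcoef k q = 0.
  elim: n k => [|n IH] k k0 Bk; first by apply: qB; lia.
  have const : c 0 * lcoef k q = 0.
    have := fq_small k; rewrite lcoef_lpolyM big_ord_recl big1 /=; last first.
      by move=> l _; rewrite IH ?mulr0 //; rewrite /bump /=; lia.
    by rewrite addr0 subr0; apply; lia.
  by rewrite -[LHS]mul1r -cV0 -mulrA const mulr0.
apply: mcoefP => k; rewrite raddf0; have [k0|k0] := boolP (0 <= k :> int).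
  by apply: (high B); lia.
by apply: (low B.+1); lia.
Qed.

Definition has_division m : Prop := exists q, supported_in 0 d (m - f * q).

Lemma division_const a : has_division (lmonom 0 a).
Proof.
case: (posnP d) => d0.
  exists (lmonom 0 (cd' * a)) => j jd; rewrite raddfB /= lcoef_lpoly_lmonom mcoef_monom d0.
  case: eqP => [<-|j0]; first by rewrite subr0 /= mulrA -d0 cdV mul1r subrr.
  by rewrite ifF ?subrr //; lia.
exists 0 => j jd; rewrite mulr0 subr0 mcoef_monom; case: eqP => // j0; lia.
Qed.

Lemma division_shift e :
  (forall r, supported_in 0 d r -> exists w, supported_in 0 d (lmonom e 1 * r - f * w)) ->
  forall m, has_division m -> has_division (lmonom e 1 * m).
Proof.
move=> reduce m [q /reduce[w small]]; exists (lmonom e 1 * q + w).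
rewrite mulrBr -addrA -opprD in small; congr (supported_in 0 d (_ - _)): small.
by rewrite mulrDr !mulrA (lmonom1_central e f).
Qed.

Lemma division_up r : supported_in 0 d r -> exists w, supported_in 0 d (lmonom 1 1 * r - f * w).
Proof.
move=> small; exists (lmonom 0 (cd' * lcoef (d%:Z - 1) r)) => j jd.
rewrite raddfB /= lcoef_lmonomMl mul1r lcoef_lpoly_lmonom subr0.
have [jE|jnd] := eqVneq j d%:Z; first by rewrite jE ifT /= ?mulrA ?cdV ?mul1r ?subrr //; lia.
by rewrite ifF ?subr0; [apply: small|]; lia.
Qed.

Lemma division_down r :
  supported_in 0 d r -> exists w, supported_in 0 d (lmonom (-1) 1 * r - f * w).
Proof.
move=> small; exists (lmonom (-1) (c0' * lcoef 0 r)) => j jd.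
rewrite raddfB /= lcoef_lmonomMl mul1r lcoef_lpoly_lmonom opprK.
have [->|jn1] := eqVneq j (-1); first by rewrite addNr /= mulrA c0V mul1r subrr.
by rewrite ifF ?subr0; [apply: small|]; lia.
Qed.

Lemma division_exists m : has_division m.
Proof.
elim/mring_ind: m => [u v [q uq] [q' vq']|k a].
  by exists (q + q'); rewrite mulrDr opprD addrACA; apply: supported_inD.
have shift (e l : int) : has_division (lmonom l a) ->
    (forall r, supported_in 0 d r -> exists w, supported_in 0 d (lmonom e 1 * r - f * w)) ->
    has_division (lmonom (e + l) a).
  by move=> la /division_shift/(_ _ la); rewrite monomM mul1r.
case: (intP k) => [|n|n]; first exact: division_const.
  elim: n.+1 => [|{}n IHn]; first exact: division_const.
  by rewrite -addn1 PoszD addrC; apply: shift division_up.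
elim: n.+1 => [|{}n IHn]; first exact: division_const.
by rewrite -addn1 PoszD opprD addrC; apply: shift division_down.
Qed.

Theorem laurent_division : exists2 z : rlinear (lconst R) (lconst R),
  forall m, z (f * m) = m & forall m, supported_in 0 d (m - f * z m).
Proof.
have [z zP] := choice division_exists.
have z_unique m q : supported_in 0 d (m - f * q) -> z m = q.
  move=> mq; apply/eqP; rewrite -subr_eq0; apply/eqP/lpoly_division_unique => j jd.
  have -> : f * (z m - q) = (m - f * q) - (m - f * z m).
    by rewrite mulrBr opprB [RHS]addrC addrA subrK.
  by rewrite raddfB /= mq // zP // subrr.
have zB : zmod_morphism z.
  move=> m m'; apply: z_unique => j jd.
  have -> : m - m' - f * (z m - z m') = (m - f * z m) - (m' - f * z m').
    by rewrite mulrBr !opprB addrACA [in RHS]addrACA [- m' + _]addrC.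
  by rewrite raddfB /= !zP // subrr.
have zM m r : z (m * lconst R r) = z m * lconst R r.
  by apply: z_unique => j jd; rewrite mulrA -mulrBl mcoef_mulr_const zP ?mul0r.
exists (RLinear zB zM) => //= m; apply: z_unique => j _.
by rewrite subrr raddf0.
Qed.

Corollary laurent_division_finite_rank : exists2 z : rlinear (lconst R) (lconst R),
  forall m, z (f * m) = m & scalar_finite_rank (lconst R) (fun m => m - f * z m).
Proof.
have [z zf zsmall] := laurent_division; exists z => //.
have rem_additive : zmod_morphism (fun m => m - f * z m).
  by move=> m m'; rewrite raddfB mulrBr /= !opprD !opprK addrACA.
have remM m r : m * lconst R r - f * z (m * lconst R r) = (m - f * z m) * lconst R r.
  by rewrite rlinearM mulrBl mulrA.
pose rem := RLinear rem_additive remM.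
apply: scalar_finite_rank_ext (scalar_finite_rank_sum (index_enum 'I_d)
  (fun i => lmonom i%:Z 1) (fun i => rlinear_comp (lcoef_functional R i%:Z) rem)) => m.
rewrite [RHS](supported_in_expansion (zsmall m)).
by apply: eq_bigr => i _; rewrite add0r.
Qed.

End LaurentDivision.

Section LaurentSubstitutions.
Variable A : pzRingType.
Local Notation R := (laurent A).
Local Notation M := (laurent R).

Lemma lmonom1D (B : pzRingType) (k l : int) :
  lmonom (k + l) 1 = lmonom k 1 * lmonom l 1 :> laurent B.
Proof. by rewrite monomM mulr1. Qed.

(* [R = A[t, 1/t]] and [M = R[s, 1/s]]: [subst_s] is [t -> s] and [subst_t] is [s -> t]. *)
Definition subst_s : {rmorphism R -> M} := mring_map_coef infinite_cyclic (lconst A).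

Definition subst_t : {rmorphism M -> R} :=
  @mring_lift R infinite_cyclic R idfun (fun k => lmonom k 1) erefl (@lmonom1D A)
    (fun a k => commr_sym (lmonom1_central k a)).

Definition s_sub_t : M := lmonom 1 1 - lconst R (lmonom 1 1).

Lemma subst_s_lmonom k a : subst_s (lmonom k a) = lmonom k (lconst A a).
Proof. exact: mring_map_monom. Qed.

Lemma subst_t_lmonom k a : subst_t (lmonom k a) = a * lmonom k 1.
Proof. exact: mring_lift_monom. Qed.

Lemma subst_t_const : cancel (lconst R) subst_t.
Proof. by move=> r; apply: mring_lift_const. Qed.

Lemma subst_t_subst_s : cancel subst_s subst_t.
Proof.
elim/mring_ind=> [u v uE vE|k a]; first by rewrite !rmorphD uE vE.
by rewrite subst_s_lmonom subst_t_lmonom -monomE.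
Qed.

Lemma s_sub_t_central m : GRing.comm s_sub_t m.
Proof.
apply/commr_sym/commrB; apply/commr_sym; first exact: lmonom1_central.
by apply: mconst_central; apply: lmonom1_central.
Qed.

Lemma subst_t_s_sub_t : subst_t s_sub_t = 0.
Proof. by rewrite rmorphB subst_t_const subst_t_lmonom mul1r subrr. Qed.

Lemma s_sub_t_division : exists2 y : rlinear (lconst R) (lconst R),
  forall m, y (s_sub_t * m) = m & forall m, s_sub_t * y m = m - lconst R (subst_t m).
Proof.
pose c i : R := if i is 0 then - lmonom 1 1 else 1.
have c0V : c 0 * - lmonom (-1) 1 = 1 by rewrite mulrNN -lmonom1D subrr.
have cV0 : - lmonom (-1) 1 * c 0 = 1 by rewrite mulrNN -lmonom1D addNr.
have [y] := laurent_division (d := 1) (c := c) (mulr1 1) (mulr1 1) c0V cV0.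
have -> : lpoly 1 c = s_sub_t by rewrite /lpoly big_ord_recl big_ord1 raddfN addrC.
move=> yf small; exists y => // m.
have [r remE] : exists r, m - s_sub_t * y m = lconst R r.
  exists (lcoef 0 (m - s_sub_t * y m)).
  by rewrite {1}(supported_in_expansion (small m)) big_ord1 mul1r.
have -> : subst_t m = r.
  by rewrite -[RHS]subst_t_const -remE rmorphB rmorphM subst_t_s_sub_t mul0r subr0.
by rewrite -remE opprB addrC subrK.
Qed.

End LaurentSubstitutions.

Section FractionField.
Variables (K : fieldType) (G : monoidType) (F : fieldType) (iF : {rmorphism {poly K} -> F}).
Hypothesis iF_inj : injective iF.
Hypothesis iF_frac : forall a : F, exists p n : {poly K}, p != 0 /\ iF p * a = iF n.

Local Notation A := (mring K G).
Local Notation R := (laurent A).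
Local Notation Q := (mring F G).
Local Notation t := (iF 'X).

Lemma t_neq0 : t != 0.
Proof. by rewrite -(rmorph0 iF) (inj_eq iF_inj) polyX_eq0. Qed.

Definition coef_map : {rmorphism A -> Q} := mring_map_coef G (iF \o polyC).

Fact t_powD (k l : int) : mconst F G (t ^ (k + l)) = mconst F G (t ^ k) * mconst F G (t ^ l).
Proof. by rewrite -rmorphM expfzDr ?t_neq0. Qed.

Definition fraction_map : {rmorphism R -> Q} :=
  @mring_lift A infinite_cyclic Q coef_map (fun k => mconst F G (t ^ k)) erefl t_powD
    (fun a k => commr_sym (mconst_central (mulrC _) _)).

Lemma fraction_map_lmonom k a : fraction_map (lmonom k a) = coef_map a * mconst F G (t ^ k).
Proof. exact: mring_lift_monom. Qed.

Lemma mcoef_coef_map a g : mcoef g (coef_map a) = iF (mcoef g a)%:P.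
Proof.
elim/mring_ind: a => [u v uE vE|h k]; first by rewrite rmorphD !mcoefD uE vE polyCD rmorphD.
by rewrite mring_map_monom !mcoef_monom; case: eqP; rewrite ?rmorph0.
Qed.

Lemma fraction_map_inj : injective fraction_map.
Proof.
apply: raddf_inj => u; rewrite -[_ u]/(fraction_map u) => u0.
have [B /(_ u (mem_head _ _)) uB] := supported_in_bound [:: u].
suff c0 i : (i < B + B)%N -> lcoef (- B%:Z + i%:Z) u = 0.
  by rewrite (supported_in_sum uB) big1 // => i _; rewrite c0 ?ltn_ord // raddf0.
move=> iB; apply: mcoefP => g; rewrite raddf0.
pose p := \poly_(j < B + B) mcoef g (lcoef (- B%:Z + j%:Z) u).
suff p0 : p = 0 by rewrite -[LHS]/((fun=> mcoef g _) iB) -(coef0 K i) -p0 coef_poly iB.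
apply: iF_inj; rewrite rmorph0; have := congr1 (fun v => mcoef g v * t ^ B%:Z) u0.
rewrite raddf0 mul0r => <-; rewrite [X in fraction_map X](supported_in_sum uB).
rewrite rmorph_sum raddf_sum /= mulr_suml /p poly_def rmorph_sum; apply: eq_bigr => j _.
rewrite -/fraction_map fraction_map_lmonom mcoef_mulr_const mcoef_coef_map -mul_polyC.
rewrite rmorphM rmorphXn -mulrA.
by congr (_ * _); rewrite -expfzDr ?t_neq0 // addrC addrA subrr add0r.
Qed.

Definition scalar_laurent : {rmorphism K -> R} := lconst A \o mconst K G.

Lemma scalar_laurent_central k (r : R) : GRing.comm (scalar_laurent k) r.
Proof. by apply/mconst_central/mconst_central/mulrC. Qed.

Fact t_scalar_comm : commr_rmorph scalar_laurent (lmonom 1 1 : R).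
Proof. by move=> k; apply: lmonom1_central. Qed.

Definition poly_laurent : {rmorphism {poly K} -> R} := horner_morph t_scalar_comm.

Lemma poly_laurentE p : poly_laurent p = lpoly (size p).-1 (fun i => mconst K G p`_i).
Proof.
have -> : lpoly (size p).-1 (fun i => mconst K G p`_i)
    = \sum_(i < size p) lmonom i%:Z (mconst K G p`_i).
  rewrite /lpoly; have [->|pn0] := eqVneq p 0; last by rewrite prednK // size_poly_gt0.
  by rewrite size_poly0 big_ord1 big_ord0 coef0 !raddf0.
rewrite -{1}[p]coefK poly_def rmorph_sum; apply: eq_bigr => i _.
rewrite -mul_polyC rmorphM rmorphXn /= horner_morphC horner_morphX.
have -> : lmonom 1 1 ^+ i = lmonom i%:Z 1 :> R.
  by elim: (i : nat) => // n IH; rewrite exprS IH -lmonom1D.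
by rewrite -monomE.
Qed.

Lemma subst_s_poly_laurent p : subst_s A (poly_laurent p)
  = lpoly (size p).-1 (fun i => scalar_laurent p`_i).
Proof.
rewrite poly_laurentE rmorph_sum; apply: eq_bigr => i _; exact: subst_s_lmonom.
Qed.

Lemma subst_s_poly_laurent_central p m : GRing.comm (subst_s A (poly_laurent p)) m.
Proof.
rewrite subst_s_poly_laurent; apply/commr_sym/commr_sum => i _; apply/commr_sym.
rewrite monomE; apply/commr_sym/commrM; apply/commr_sym; last exact: lmonom1_central.
by apply: mconst_central => r; apply: scalar_laurent_central.
Qed.

Lemma fraction_map_poly_laurent p : fraction_map (poly_laurent p) = mconst F G (iF p).
Proof.
elim/poly_ind: p => [|p k IH]; first by rewrite !rmorph0.
rewrite !rmorphD !rmorphM IH -[poly_laurent 'X]/(horner_morph _ _) horner_morphX.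
rewrite -[poly_laurent k%:P]/(horner_morph _ _) horner_morphC !fraction_map_lmonom.
by rewrite rmorph1 mul1r !expr0z expr1z rmorph1 mulr1 mring_map_monom.
Qed.

(* Both the leading and the constant coefficient must be units to divide by [p(s)]. *)
Definition denominator (f : R) : Prop := exists2 p : {poly K}, p`_0 != 0 & f = poly_laurent p.

Lemma denominator1 : denominator 1.
Proof. by exists 1; rewrite ?coef1 ?oner_neq0 ?rmorph1. Qed.

Lemma denominatorM f g : denominator f -> denominator g -> denominator (f * g).
Proof.
move=> [p p0 ->] [q q0 ->]; exists (p * q); last by rewrite rmorphM.
by rewrite coef0M mulf_neq0.
Qed.

Lemma common_denominator h : exists p r, p != 0 /\ mconst F G (iF p) * h = fraction_map r.
Proof.
elim/mring_ind: h => [h h' [p [r [pn0 hr]]] [p' [r' [pn0' hr']]]|g a].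
  exists (p * p'), (poly_laurent p' * r + poly_laurent p * r'); rewrite mulf_neq0 //; split=> //.
  rewrite !rmorphD !rmorphM !fraction_map_poly_laurent -hr -hr' mulrDr !mulrA.
  by congr (_ * _ + _); apply: mconst_central; apply: mulrC.
have [p [n [pn0 pa]]] := iF_frac a.
exists p, (poly_laurent n * lconst A (monom g 1)); split=> //.
rewrite rmorphM fraction_map_poly_laurent fraction_map_lmonom expr0z mulr1 mring_map_monom.
by rewrite !monomM pa /= rmorph1 mulr1.
Qed.

Lemma poly_split_X (p : {poly K}) : p != 0 ->
  exists (j : nat) (q : {poly K}), q`_0 != 0 /\ p = q * 'X^j.
Proof.
move=> pn0; have [j [q]] := multiplicity_XsubC p 0; rewrite pn0 /= subr0 => q0 ->.
by exists j, q; rewrite -horner_coef0.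
Qed.

Lemma denominator_frac h : exists f r, denominator f /\ fraction_map f * h = fraction_map r.
Proof.
have [p [r [pn0 ph]]] := common_denominator h; have [j [q [q0 pE]]] := poly_split_X pn0.
exists (poly_laurent q), (lmonom (- j%:Z) 1 * r); split; first by exists q.
rewrite rmorphM -ph mulrA fraction_map_lmonom rmorph1 mul1r fraction_map_poly_laurent.
rewrite -rmorphM pE (rmorphM iF) (rmorphXn iF); congr (mconst F G _ * _).
by rewrite mulrCA -[t ^+ j]/(t ^ j%:Z) -expfzDr ?t_neq0 // addNr mulr1.
Qed.

Lemma denominator_division f : denominator f -> exists2 z : rlinear (lconst R) (lconst R),
  forall m, z (subst_s A f * m) = m &
  scalar_finite_rank (lconst R) (fun m => m - subst_s A f * z m).
Proof.
case=> p p0 ->; rewrite subst_s_poly_laurent.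
have inv k : k != 0 -> scalar_laurent k * scalar_laurent k^-1 = 1.
  by move=> kn0; rewrite -rmorphM divff // rmorph1.
have invV k : k != 0 -> scalar_laurent k^-1 * scalar_laurent k = 1.
  by move=> kn0; rewrite -rmorphM mulVf // rmorph1.
have lead : p`_(size p).-1 != 0.
  by rewrite -/(lead_coef p) lead_coef_eq0; apply: contraNneq p0 => ->; rewrite coef0.
exact: laurent_division_finite_rank (inv _ lead) (invV _ lead) (inv _ p0) (invV _ p0).
Qed.

Theorem K1class_fraction_map_eq0 n (a : 'M[R]_n) : invertible_mx a ->
  Eprod (map_mx fraction_map a) -> K1class a = 0.
Proof.
have [y yx xy] := s_sub_t_division A.
apply: (K1class_localization (@subst_t_const A) (@subst_t_subst_s A) (@s_sub_t_central A)
  (subst_t_s_sub_t A) yx xy (@laurent_dual_basis R) fraction_map_inj denominator1 denominatorM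
  _ _ denominator_frac denominator_division).
- by move=> _ [p _ ->]; apply: subst_s_poly_laurent_central.
- by move=> _ [p _ ->] h; rewrite fraction_map_poly_laurent; apply/mconst_central/mulrC.
Qed.

Lemma K1class_fraction_map_inj n m (a : 'M[R]_n) (b : 'M[R]_m) :
  invertible_mx a -> invertible_mx b ->
  K1class (map_mx fraction_map a) = K1class (map_mx fraction_map b) -> K1class a = K1class b.
Proof. exact: (K1class_map_inj K1class_fraction_map_eq0). Qed.

Definition laurent_value (a : F) : Prop := exists J (p : {poly K}), t ^+ J * a = iF p.

Lemma laurent_valueD a b : laurent_value a -> laurent_value b -> laurent_value (a + b).
Proof.
move=> [J [p ap]] [J' [p' bp']]; exists (J + J')%N, ('X^J' * p + 'X^J * p').
rewrite rmorphD !(rmorphM iF) !(rmorphXn iF) -ap -bp' mulrDr exprD !mulrA.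
by rewrite [_ ^+ J' * _]mulrC.
Qed.

Lemma laurent_valueM a b : laurent_value a -> laurent_value b -> laurent_value (a * b).
Proof.
move=> [J [p ap]] [J' [p' bp']]; exists (J + J')%N, (p * p').
by rewrite rmorphM -ap -bp' exprD mulrACA.
Qed.

Lemma laurent_value_poly p : laurent_value (iF p).
Proof. by exists 0, p; rewrite mul1r. Qed.

Lemma laurent_value_power (k : int) : laurent_value (t ^ k).
Proof.
case: k => [n|n]; first by rewrite -[t ^ n]/(t ^+ n) -rmorphXn; apply: laurent_value_poly.
exists n.+1, 1; rewrite rmorph1 -[t ^+ n.+1]/(t ^ n.+1%:Z) -expfzDr ?t_neq0 // NegzE subrr.
exact: expr0z.
Qed.

Lemma laurent_value_augmentation r : laurent_value (augmentation F G (fraction_map r)).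
Proof.
elim/mring_ind: r => [u v uE vE|k a]; first by rewrite !rmorphD; apply: laurent_valueD.
rewrite fraction_map_lmonom rmorphM; apply: laurent_valueM; last first.
  by rewrite mring_lift_const; apply: laurent_value_power.
elim/mring_ind: a => [u v uE vE|g c]; first by rewrite !rmorphD; apply: laurent_valueD.
by rewrite mring_map_monom mring_lift_monom mulr1; apply: laurent_value_poly.
Qed.

Lemma laurent_value_det n (g : 'M[F]_n) : (forall i j, laurent_value (g i j)) ->
  laurent_value (\det g).
Proof.
have [L0 L1 LN1] : [/\ laurent_value 0, laurent_value 1 & laurent_value (-1)].
  by split; [rewrite -(rmorph0 iF)|rewrite -(rmorph1 iF)|rewrite -(rmorphN1 iF)];
    apply: laurent_value_poly.
move=> gL; apply: (big_ind laurent_value) => // [|s _]; first exact: laurent_valueD.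
apply: laurent_valueM.
  by elim: (nat_of_bool _) => // k IHk; rewrite exprS; apply: laurent_valueM.
by apply: (big_ind laurent_value) => //; apply: laurent_valueM.
Qed.

Lemma laurent_value_unit u v : laurent_value u -> laurent_value v -> u * v = 1 ->
  exists (l : K) (k : int), l != 0 /\ u = iF l%:P * t ^ k.
Proof.
move=> [J [p up]] [J' [p' vp']] uv.
have : p %| ('X - 0%:P) ^+ (J + J').
  rewrite subr0; suff <- : p * p' = 'X^(J + J') by apply: dvdp_mulr.
  by apply: iF_inj; rewrite rmorphM rmorphXn -up -vp' mulrACA uv mulr1 exprD.
case/dvdp_exp_XsubCP=> k _ /eqpf_eq[l ln0]; rewrite subr0 -mul_polyC => pE.
exists l, (k%:Z - J%:Z); split=> //; apply: (mulfI (expf_neq0 J t_neq0)).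
rewrite up pE rmorphM rmorphXn mulrCA -[t ^+ J]/(t ^ J%:Z) -expfzDr ?t_neq0 //.
by rewrite addrC subrK.
Qed.

Hypothesis K1_scalarF : forall n (a : 'M[Q]_n), invertible_mx a ->
  exists2 u : F, u != 0 & K1class a = K1class ((mconst F G u)%:M : 'M_1).

(* The determinant of the augmentation of [g] is a unit of [K[t, 1/t]]. *)
Theorem K1class_laurent n (g : 'M[R]_n) : invertible_mx g -> exists (l : K) (k : int),
  l != 0 /\ K1class g = K1class ((lmonom k (mconst K G l))%:M : 'M_1).
Proof.
case=> g' gg'; have invg : invertible_mx g by exists g'.
have [u un0 gu] := K1_scalarF (invertible_mx_map fraction_map invg).
pose aug (h : 'M[R]_n) := map_mx (augmentation F G) (map_mx fraction_map h).
have aug_value h : laurent_value (\det (aug h)).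
  by apply: laurent_value_det => i j; rewrite !mxE; apply: laurent_value_augmentation.
have invu : invertible_mx ((mconst F G u)%:M : 'M_1) by apply: invertible_mx_scalar_map.
have det_g : \det (aug g) = u.
  rewrite (K1class_det _ _ (K1class_map_eq (augmentation F G) _ _ gu)) //;
    try by do ?apply: invertible_mx_map.
  by rewrite map_scalar_mx det_scalar1 mring_lift_const.
have det_gg' : \det (aug g) * \det (aug g') = 1.
  by rewrite -det_mulmx -!map_mxM gg'.1 !map_mx1 det1.
have [l [k [ln0 lk]]] := laurent_value_unit (aug_value g) (aug_value g') det_gg'.
exists l, k; split=> //; apply: K1class_fraction_map_inj => //.
  by exists (lmonom (- k) (mconst K G l^-1))%:M; apply: inverse_mx_lmonom;
    rewrite -rmorphM ?divff ?mulVf ?rmorph1.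
rewrite gu -det_g lk map_scalar_mx fraction_map_lmonom mring_map_monom monom1E.
by rewrite -rmorphM.
Qed.

End FractionField.

(** * Corner ideals and Toeplitz rings *)

Definition stably_finite (A : pzRingType) : Prop :=
  forall n (a b : 'M[A]_n), a *m b = 1%:M -> b *m a = 1%:M.

Section Corner.
Variables (A T : pzRingType) (iA : {rmorphism A -> T}) (x y : T).
Local Notation e := (1 - x * y).
Hypothesis yx : y * x = 1.
Hypotheses (x_comm : forall a, GRing.comm x (iA a)) (y_comm : forall a, GRing.comm y (iA a)).
Hypothesis corner : forall w, exists a, e * w * e = e * iA a.
Hypothesis corner_inj : forall a, e * iA a = 0 -> a = 0.

Lemma corner_mulx : e * x = 0.
Proof. by rewrite mulrBl mul1r -mulrA yx mulr1 subrr. Qed.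

Lemma y_mul_corner : y * e = 0.
Proof. by rewrite mulrBr mulr1 mulrA yx mul1r subrr. Qed.

Lemma corner_idem : e * e = e.
Proof. by rewrite [in LHS]mulrBr mulr1 mulrA corner_mulx mul0r subr0. Qed.

Lemma corner_comm a : GRing.comm e (iA a).
Proof.
by apply/commr_sym/commrB; [apply: commr1|apply/commrM; apply/commr_sym].
Qed.

Lemma scalar_corner_comm n m (c : 'M[A]_(n, m)) : e%:M *m map_mx iA c = map_mx iA c *m e%:M.
Proof. by apply: scalar_mx_comm => i j; rewrite mxE; apply: corner_comm. Qed.

Lemma scalar_corner_idem n : e%:M *m e%:M = e%:M :> 'M[T]_n.
Proof. by rewrite -scalar_mxM corner_idem. Qed.

Lemma corner_mx n m (w : 'M[T]_(n, m)) :
  exists c : 'M[A]_(n, m), e%:M *m w *m e%:M = e%:M *m map_mx iA c.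
Proof.
have [c cE] := choice (fun ij : 'I_n * 'I_m => corner (w ij.1 ij.2)).
exists (\matrix_(i, j) c (i, j)); rewrite !mul_scalar_mx; apply/matrixP=> i j.
rewrite !mxE -cE (bigD1 j) //= big1 => [|k /negbTE kj]; last by rewrite !mxE kj mulr0.
by rewrite !mxE eqxx addr0.
Qed.

Lemma corner_mx_inj n m (c d : 'M[A]_(n, m)) :
  e%:M *m map_mx iA c = e%:M *m map_mx iA d -> c = d.
Proof.
rewrite !mul_scalar_mx => /matrixP cd; apply/matrixP=> i j; apply/eqP; rewrite -subr_eq0.
by apply/eqP/corner_inj; have := cd i j; rewrite !mxE rmorphB mulrBr => ->; rewrite subrr.
Qed.

Definition corner_embed n (D : 'M[A]_n) : 'M[T]_n := 1%:M + e%:M *m map_mx iA (D - 1%:M).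

Lemma corner_mul_embed n (D : 'M[A]_n) : e%:M *m corner_embed D = e%:M *m map_mx iA D.
Proof.
rewrite mulmxDr mulmx1 mulmxA scalar_corner_idem map_mxB map_mx1 mulmxBr mulmx1.
by rewrite addrC subrK.
Qed.

Lemma embed_mul_corner n (D : 'M[A]_n) : corner_embed D *m e%:M = e%:M *m map_mx iA D.
Proof.
rewrite -corner_mul_embed mulmxDl mulmxDr mul1mx mulmx1; congr (_ + _).
by rewrite scalar_corner_comm mulmxA scalar_corner_comm.
Qed.

Lemma corner_embedM n (D D' : 'M[A]_n) : corner_embed (D *m D') = corner_embed D *m corner_embed D'.
Proof.
rewrite /corner_embed mulmx_sub1; move: (D - _) (D' - _) => P P'.
have ePP' : (e%:M *m map_mx iA P) *m (e%:M *m map_mx iA P') = e%:M *m map_mx iA (P *m P').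
  by rewrite mulmxA scalar_corner_comm -[_ *m e%:M]mulmxA scalar_corner_idem
             -scalar_corner_comm -mulmxA -map_mxM.
by rewrite mulmxDl mul1mx mulmxDr mulmx1 ePP' !map_mxD !mulmxDr -addrA.
Qed.

Lemma corner_embed1 n : corner_embed (1%:M : 'M_n) = 1%:M.
Proof. by rewrite /corner_embed subrr map_mx0 mulmx0 addr0. Qed.

Lemma invertible_corner_embed n (D : 'M[A]_n) : invertible_mx D -> invertible_mx (corner_embed D).
Proof.
by case=> D' [DD' D'D]; exists (corner_embed D'); rewrite -!corner_embedM DD' D'D corner_embed1.
Qed.

Lemma corner_embed_rinv n (D : 'M[A]_n) h : corner_embed D *m h = 1%:M ->
  exists c, D *m c = 1%:M.
Proof.
move=> Dh; have [c cE] := corner_mx h; exists c; apply: corner_mx_inj.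
rewrite map_mxM mulmxA scalar_corner_comm -mulmxA -cE !mulmxA -scalar_corner_comm.
by rewrite -corner_mul_embed -[_ *m h]mulmxA Dh map_mx1 !mulmx1 scalar_corner_idem.
Qed.

Lemma corner_embed_linv n (D : 'M[A]_n) h : h *m corner_embed D = 1%:M ->
  exists c, c *m D = 1%:M.
Proof.
move=> hD; have [c cE] := corner_mx h; exists c; apply: corner_mx_inj.
rewrite map_mxM mulmxA -cE -mulmxA -embed_mul_corner -mulmxA [h *m _]mulmxA hD mul1mx.
by rewrite map_mx1 mulmx1 scalar_corner_idem.
Qed.

Lemma invertible_corner_embedV n (D : 'M[A]_n) : invertible_mx (corner_embed D) -> invertible_mx D.
Proof.
case=> h [/corner_embed_rinv[c Dc] /corner_embed_linv[c' c'D]]; exists c; split=> //.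
by rewrite -(_ : c' = c) // -[c']mulmx1 -Dc mulmxA c'D mul1mx.
Qed.

(* Conjugating [diag (D^-1, 1)] by [[x, e; 0, y]] gives [diag (x D^-1 y + e, 1)], and
   [x D^-1 y + e = D^-1 (1 + e (D - 1))]. *)
Lemma K1class_corner_embed n (D : 'M[A]_n) : invertible_mx D -> K1class (corner_embed D) = 0.
Proof.
case=> D' [DD' D'D]; have invD : invertible_mx D by exists D'.
have inviD' : invertible_mx (map_mx iA D') by apply: invertible_mx_map; exists D.
pose w : 'M[T]_(n + n) := block_mx x%:M e%:M 0 y%:M.
pose w' : 'M[T]_(n + n) := block_mx y%:M 0 e%:M x%:M.
have ww' : inverse_mx w w'.
  split; rewrite mulmx_block !(mulmx0, mul0mx, add0r, addr0) -!scalar_mxM ?corner_mulx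
    ?y_mul_corner yx corner_idem ?raddf0 -?raddfD /= ?dsum1 //.
    by rewrite subrKC dsum1.
  by rewrite subrK dsum1.
have conj : w *m (map_mx iA D' <+> 1%:M) *m w' = map_mx iA D' *m corner_embed D <+> 1%:M.
  rewrite !mulmx_block !(mulmx0, mul0mx, add0r, addr0, mulmx1) -!scalar_mxM.
  rewrite corner_mulx y_mul_corner yx corner_idem !raddf0; congr (_ <+> _).
  rewrite scalar_mx_comm => [|i j]; last by rewrite mxE; apply: x_comm.
  rewrite -mulmxA -scalar_mxM mulmxDr mulmx1 mulmxA -scalar_corner_comm -mulmxA -map_mxM.
  rewrite mulmxBr mulmx1 D'D map_mxB map_mx1 mulmxBr mulmx1.
  have -> : (x * y)%:M = 1%:M - e%:M :> 'M[T]_n by rewrite -raddfB /= opprB addrC subrK.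
  by rewrite scalar_corner_comm mulmxBr mulmx1 addrA addrAC.
have := K1class_conj ww' (invertible_mx_dsum inviD' (invertible_mx1 T n)).
have inv_embed := invertible_corner_embed invD.
rewrite conj !K1class_dsum1 ?K1classM //; last exact: invertible_mxM.
by move/(canRL (addKr _)); rewrite addNr.
Qed.

Definition corner_ideal n m (C : 'M[T]_(n, m)) : Prop :=
  exists N (U : 'M[T]_(n, N)) (V : 'M[T]_(N, m)), C = U *m e%:M *m V.

Lemma corner_ideal0 n m : corner_ideal (0 : 'M[T]_(n, m)).
Proof. by exists 0%N, 0, 0; rewrite mulmx0. Qed.

Lemma corner_idealD n m (C C' : 'M[T]_(n, m)) :
  corner_ideal C -> corner_ideal C' -> corner_ideal (C + C').
Proof.
move=> [N [U [V ->]]] [N' [U' [V' ->]]]; exists (N + N')%N, (row_mx U U'), (col_mx V V').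
by rewrite (@scalar_mx_block _ N N' e) mul_row_block !mulmx0 addr0 add0r mul_row_col.
Qed.

Lemma corner_ideal_mulmx n m p q (P : 'M[T]_(p, n)) (C : 'M[T]_(n, m)) (Q : 'M[T]_(m, q)) :
  corner_ideal C -> corner_ideal (P *m C *m Q).
Proof. by move=> [N [U [V ->]]]; exists N, (P *m U), (V *m Q); rewrite !mulmxA. Qed.

Lemma corner_ideal_entries n m (C : 'M[T]_(n, m)) :
  (forall i j, corner_ideal ((C i j)%:M : 'M_1)) -> corner_ideal C.
Proof.
move=> CI; rewrite [C]matrix_sum_delta.
apply: (big_ind (@corner_ideal n m)) => [||i _]; [exact: corner_ideal0|exact: corner_idealD|].
apply: (big_ind (@corner_ideal n m)) => [||j _]; [exact: corner_ideal0|exact: corner_idealD|].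
have := corner_ideal_mulmx (delta_mx i 0) (delta_mx 0 j) (CI i j).
by rewrite mul_delta_scalar_mx -scalemxAl mul_delta_mx.
Qed.

Lemma corner_ideal_factor n (C : 'M[T]_n) : corner_ideal C ->
  exists N (D : 'M[A]_N) (U : 'M[T]_(n, N)) (V : 'M[T]_(N, n)),
    C = U *m V /\ 1%:M + V *m U = corner_embed D.
Proof.
move=> [N [U [V ->]]]; have [c cE] := corner_mx (V *m U).
exists N, (1%:M + c), (U *m e%:M), (e%:M *m V); split.
  by rewrite mulmxA -[_ *m e%:M *m e%:M]mulmxA scalar_corner_idem.
by rewrite /corner_embed [1%:M + c]addrC addrK -cE !mulmxA.
Qed.

Theorem K1class_add1_corner_ideal n (C : 'M[T]_n) : corner_ideal C ->
  invertible_mx (1%:M + C) -> K1class (1%:M + C) = 0.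
Proof.
case/corner_ideal_factor=> N [D [U [V [-> VU]]]] inv.
rewrite K1class_add1mulmxC VU K1class_corner_embed //; apply: invertible_corner_embedV.
by rewrite -VU; apply: invertible_add1mulmx_swap.
Qed.

Theorem corner_ideal_stably_finite n (C h : 'M[T]_n) : stably_finite A -> corner_ideal C ->
  (1%:M + C) *m h = 1%:M -> h *m (1%:M + C) = 1%:M.
Proof.
move=> finA /corner_ideal_factor[N [D [U [V [-> VU]]]]] rinv.
have [c /finA cD] : exists c, D *m c = 1%:M.
  by apply: corner_embed_rinv (1%:M - V *m h *m U) _; rewrite -VU add1mulmx_rinv_swap.
have : corner_embed c *m (1%:M + V *m U) = 1%:M by rewrite VU -corner_embedM cD corner_embed1.
move/add1mulmx_linv_swap; set l := 1%:M - _ => linv.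
by have <- : l = h by rewrite -[l]mulmx1 -rinv mulmxA linv mul1mx.
Qed.

End Corner.

(* [(i, j)] stands for [x^i y^j]; the truncated subtractions implement [y x = 1]. *)
Definition bicyclic : Type := (nat * nat)%type.
HB.instance Definition _ := Choice.on bicyclic.
Definition bicyclic_mul (p q : bicyclic) : bicyclic :=
  (p.1 + (q.1 - p.2), q.2 + (p.2 - q.1))%N.
Fact bicyclic_mulA : associative bicyclic_mul.
Proof. by move=> [i j] [k l] [m n]; congr (_, _) => /=; lia. Qed.
Fact bicyclic_mul1 : left_id ((0, 0)%N : bicyclic) bicyclic_mul.
Proof. by move=> [i j]; congr (_, _) => /=; lia. Qed.
Fact bicyclic_mulr1 : right_id ((0, 0)%N : bicyclic) bicyclic_mul.
Proof. by move=> [i j]; congr (_, _) => /=; lia. Qed.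
HB.instance Definition _ :=
  isMonoid.Build bicyclic bicyclic_mulA bicyclic_mul1 bicyclic_mulr1.

Lemma bicyclic_mulE i j k l :
  (((i, j) : bicyclic) * (k, l))%g = ((i + (k - j))%N, (l + (j - k))%N) :> bicyclic.
Proof. by []. Qed.

Notation toeplitz A := (mring A bicyclic).
Notation tmonom i j a := (@monom _ bicyclic (i%N, j%N) a).

Section Toeplitz.
Variable A : pzRingType.
Local Notation T := (toeplitz A).
Local Notation tconst := (mconst A bicyclic).
Local Notation x := (tmonom 1 0 1 : T).
Local Notation y := (tmonom 0 1 1 : T).
Local Notation e := (1 - x * y).

Lemma tmonomM i j k l (a b : A) :
  tmonom i j a * tmonom k l b = tmonom (i + (k - j)) (l + (j - k)) (a * b).
Proof. by rewrite monomM bicyclic_mulE. Qed.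

Lemma toeplitz_yx : y * x = 1. Proof. by rewrite tmonomM mulr1. Qed.

Lemma toeplitz_ind (P : T -> Prop) : (forall u v, P u -> P v -> P (u + v)) ->
  (forall i j a, P (tmonom i j a)) -> forall u, P u.
Proof. by move=> PD Pmonom; apply: mring_ind => // -[i j] a; apply: Pmonom. Qed.

Lemma corner_tmonomS i j (a : A) : e * tmonom i.+1 j a = 0.
Proof.
have -> : tmonom i.+1 j a = x * tmonom i j a by rewrite tmonomM mul1r subn0 addn0 add1n.
by rewrite mulrA corner_mulx ?mul0r // toeplitz_yx.
Qed.

Lemma tmonomS_corner i j (a : A) : tmonom i j.+1 a * e = 0.
Proof.
have -> : tmonom i j.+1 a = tmonom i j a * y by rewrite tmonomM mulr1 sub0n addn0 subn0 add1n.
by rewrite -mulrA y_mul_corner ?mulr0 // toeplitz_yx.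
Qed.

Lemma toeplitz_corner (w : T) : exists a, e * w * e = e * tconst a.
Proof.
elim/toeplitz_ind: w => [u v [a ua] [b vb]|[|i] [|j] a].
- by exists (a + b); move: ua vb; move: e => e0 ua vb; rewrite mulrDr mulrDl ua vb rmorphD mulrDr.
- exists a; rewrite -mulrA -(corner_comm (iA := tconst)) ?mulrA ?corner_idem ?toeplitz_yx //;
  by move=> b; apply: monom1_const_comm.
- by exists 0; rewrite -mulrA tmonomS_corner rmorph0 !mulr0.
- by exists 0; rewrite corner_tmonomS mul0r rmorph0 mulr0.
- by exists 0; rewrite corner_tmonomS mul0r rmorph0 mulr0.
Qed.

Lemma toeplitz_corner_inj (a : A) : e * tconst a = 0 -> a = 0.
Proof.
move/(congr1 (mcoef ((0, 0)%N : bicyclic))); rewrite mulrBl mul1r !tmonomM raddfB raddf0 /=.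
by rewrite !mcoef_monom subr0.
Qed.

Definition degree (p : bicyclic) : infinite_cyclic := p.1%:Z - p.2%:Z.
Fact degree1 : degree 1%g = 1%g. Proof. by []. Qed.
Fact degreeM p q : degree (p * q)%g = (degree p * degree q)%g.
Proof. by rewrite -[RHS]/(degree p + degree q : int) /degree /=; lia. Qed.

Definition symbol : {rmorphism T -> laurent A} := mring_map idfun degree1 degreeM.

Lemma symbol_tmonom i j (a : A) : symbol (tmonom i j a) = lmonom (i%:Z - j%:Z) a.
Proof. exact: mring_map_monom. Qed.

Definition lmonom_lift (k : infinite_cyclic) (a : A) : T :=
  if k is Negz n then tmonom 0 n.+1 a else tmonom `|k : int|%N 0 a.

Fact lmonom_liftD k : {morph lmonom_lift k : a b / a + b}.
Proof. by case: k => n a b; rewrite /lmonom_lift /= raddfD. Qed.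

Lemma symbol_surj (q : laurent A) : exists w, symbol w = q.
Proof.
exists (mring_sum lmonom_lift q); elim/mring_ind: q => [q r qE rE|[n|n] a].
- by rewrite (mring_sumD lmonom_liftD) rmorphD qE rE.
- by rewrite (mring_sum_monom lmonom_liftD) symbol_tmonom subr0.
- by rewrite (mring_sum_monom lmonom_liftD) symbol_tmonom sub0r -NegzE.
Qed.

Local Notation corner_ideal := (corner_ideal x y).

Lemma corner_ideal_tmonom i j (a : A) : corner_ideal
  ((tmonom i j a - mring_sum lmonom_lift (lmonom (i%:Z - j%:Z) a))%:M : 'M_1).
Proof.
rewrite (mring_sum_monom lmonom_liftD); elim: i j => [|i IHi] [|j].
- by rewrite subrr raddf0; apply: corner_ideal0.
- by rewrite sub0r -NegzE subrr raddf0; apply: corner_ideal0.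
- by rewrite subr0 subrr raddf0; apply: corner_ideal0.
have -> : i.+1%:Z - j.+1%:Z = i%:Z - j%:Z by lia.
have xyE : tmonom i 0 a * (x * y) * tmonom 0 j 1 = tmonom i.+1 j.+1 a.
  by rewrite !tmonomM !mulr1 !subn0 !sub0n !addn0 !addn1.
have -> : tmonom i.+1 j.+1 a = tmonom i j a + - tmonom i 0 a * e * tmonom 0 j 1.
  rewrite !(mulrBr, mulrBl) !mulNr mulr1 xyE opprK addrA tmonomM mulr1.
  by rewrite !subnn !addn0 subrr add0r.
rewrite addrAC raddfD; apply: corner_idealD; first exact: IHi.
by exists 1%N, (- tmonom i 0 a)%:M, (tmonom 0 j 1)%:M; rewrite -!scalar_mxM.
Qed.

Lemma corner_ideal_sub_lift w :
  corner_ideal ((w - mring_sum lmonom_lift (symbol w))%:M : 'M_1).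
Proof.
elim/toeplitz_ind: w => [u v uI vI|i j a]; last first.
  by rewrite symbol_tmonom; apply: corner_ideal_tmonom.
rewrite [symbol _]rmorphD (mring_sumD lmonom_liftD) opprD addrACA [_%:M]raddfD.
exact: corner_idealD.
Qed.

Lemma corner_ideal_symbol n m (C : 'M[T]_(n, m)) : map_mx symbol C = 0 -> corner_ideal C.
Proof.
move=> /matrixP C0; apply: corner_ideal_entries => i j; have := C0 i j; rewrite !mxE => Cij0.
by have := corner_ideal_sub_lift (C i j); rewrite Cij0 (mring_sum0 lmonom_liftD) subr0.
Qed.

Lemma Eprod_symbol_lift n (h : 'M[laurent A]_n) : Eprod h ->
  exists e e', [/\ Eprod e, inverse_mx e e' & map_mx symbol e' *m h = 1%:M].
Proof.
case/(Eprod_map_surj symbol_surj) => h0 Eh0 <-; have [h0' _ hh'] := Eprod_inverse Eh0.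
by exists h0, h0'; split=> //; rewrite -map_mxM hh'.2 map_mx1.
Qed.

Lemma symbol_eq1 n (g : 'M[T]_n) : map_mx symbol g = 1%:M ->
  exists2 C, corner_ideal C & g = 1%:M + C.
Proof.
move=> g1; exists (g - 1%:M); last by rewrite addrC subrK.
by apply: corner_ideal_symbol; rewrite map_mxB g1 map_mx1 subrr.
Qed.

Lemma K1class_symbol_eq1 n (g : 'M[T]_n) :
  invertible_mx g -> map_mx symbol g = 1%:M -> K1class g = 0.
Proof.
move=> invg /symbol_eq1[C CI gC]; move: invg; rewrite gC.
apply: (K1class_add1_corner_ideal (iA := tconst) toeplitz_yx (monom1_const_comm _)
  (monom1_const_comm _) toeplitz_corner toeplitz_corner_inj CI).
Qed.

Lemma symbol_eq1_linv n (g h : 'M[T]_n) : stably_finite A ->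
  map_mx symbol g = 1%:M -> g *m h = 1%:M -> h *m g = 1%:M.
Proof.
move=> finA /symbol_eq1[C CI ->].
apply: (corner_ideal_stably_finite (iA := tconst) toeplitz_yx (monom1_const_comm _)
  (monom1_const_comm _) toeplitz_corner toeplitz_corner_inj finA CI).
Qed.

Theorem K1class_symbol_inj n m (g : 'M[T]_n) (h : 'M[T]_m) : invertible_mx g -> invertible_mx h ->
  K1class (map_mx symbol g) = K1class (map_mx symbol h) -> K1class g = K1class h.
Proof.
apply: K1class_map_inj => {g}n a inva /Eprod_symbol_lift[e0 [e0' [Ee0 ee' e'a]]].
have inve' : invertible_mx e0' by exists e0; apply: inverse_mx_sym.
rewrite -[a](mulKmx_inverse _ ee'.1); rewrite K1class_EprodMl //; last exact: invertible_mxM.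
by apply: K1class_symbol_eq1; [apply: invertible_mxM|rewrite map_mxM].
Qed.

(* Up to elementary factors [g] is congruent to [s] modulo the corner ideal, and modulo
   that ideal one-sided inverses are two-sided. *)
Theorem K1class_symbol_rinv n (g : 'M[T]_n) (s r : T) : stably_finite A -> r * s = 1 ->
  symbol s * symbol r = 1 -> invertible_mx g ->
  K1class (map_mx symbol g) = K1class ((symbol s)%:M : 'M_1) -> s * r = 1.
Proof.
move=> finA rs ss [g' gg']; have srs : symbol r * symbol s = 1 by rewrite -rmorphM rs rmorph1.
have invg : invertible_mx (map_mx symbol g) by apply: invertible_mx_map; exists g'.
case/(K1class_eqP invg (invertible_mx_scalar 1 ss srs)) => N0.
move: (leq_addr n.+1 N0) (leq_addl N0 n.+1); set N := (N0 + n.+1)%N => N0N nN /(_ N N0N).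
case=> h /Eprod_symbol_lift[e0 [e0' [_ ee' e0'h]]] gE; have N1 := leq_trans (ltn0Sn n) nN.
pose p := pad N (s%:M : 'M[T]_1); pose q := pad N (r%:M : 'M[T]_1).
have := inverse_mxM (inverse_mx_sym ee') (inverse_mx_pad (ltnW nN) gg').
move uE: (e0' *m pad N g) => u; move: (pad N g' *m e0) => u' [uu' u'u].
have symbol_qu : map_mx symbol (q *m u) = 1%:M.
  rewrite -uE !map_mxM !map_pad gE (mulKmx_inverse _ e0'h) -padM //.
  by rewrite !map_scalar_mx -scalar_mxM srs pad1.
have qup : q *m u *m (u' *m p) = 1%:M.
  by rewrite mulmxA (mulmxK_inverse _ uu') -padM // -scalar_mxM rs pad1.
have pqu : u' *m (p *m q) *m u = 1%:M.
  by rewrite -[RHS](symbol_eq1_linv finA symbol_qu qup) !mulmxA.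
have pq1 : p *m q = 1%:M.
  by rewrite -[p *m q](mulKmx_inverse _ uu') -[u' *m _](mulmxK_inverse _ uu') pqu mul1mx.
have : (s * r)%:M = 1%:M :> 'M[T]_1 by apply: (pad_inj N1); rewrite scalar_mxM padM // pq1 pad1.
by move/matrixP/(_ 0 0); rewrite !mxE.
Qed.

Lemma tmonom_nonunitary (u v : A) j : 0 != 1 :> A -> tmonom j.+1 0 u * tmonom 0 j.+1 v != 1.
Proof.
apply: contra => /eqP/(congr1 (mcoef ((0, 0)%N : bicyclic))); rewrite tmonomM !mcoef_monom.
by rewrite eqxx /= => /eqP.
Qed.

End Toeplitz.

Section SymbolDegree.
Variables (A : nzRingType) (finA : stably_finite A).

Lemma K1class_symbol_not_pos n (g : 'M[toeplitz A]_n) j (u v : A) :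
  u * v = 1 -> v * u = 1 -> invertible_mx g ->
  K1class (map_mx (symbol A) g) <> K1class ((lmonom j.+1%:Z u)%:M : 'M_1).
Proof.
move=> uv vu invg; have sE : symbol A (tmonom j.+1 0 u) = lmonom j.+1%:Z u.
  by rewrite symbol_tmonom subr0.
rewrite -sE => /(K1class_symbol_rinv (r := tmonom 0 j.+1 v) finA) isometry.
have := tmonom_nonunitary u v j; rewrite eq_sym oner_eq0 => /(_ isT)/eqP; apply.
apply: isometry => //; first by rewrite tmonomM vu subnn !addn0.
by rewrite sE symbol_tmonom sub0r lmonom_inverse.
Qed.

Theorem K1class_symbol_degree0 n (g : 'M[toeplitz A]_n) (k : int) (u v : A) :
  u * v = 1 -> v * u = 1 -> invertible_mx g ->
  K1class (map_mx (symbol A) g) = K1class ((lmonom k u)%:M : 'M_1) -> k = 0.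
Proof.
case: k => [[|j]|j] // uv vu; first by move=> invg /(K1class_symbol_not_pos uv vu invg).
move=> [g' gg'] symg; have invg' : invertible_mx g' by exists g; apply: inverse_mx_sym.
case: (K1class_symbol_not_pos (j := j) vu uv invg').
rewrite (K1class_inverse (inverse_mx_map (symbol A) gg')) symg NegzE; apply/esym/K1class_inverse.
exact: inverse_mx_lmonom.
Qed.

End SymbolDegree.

(** * Monoid rings whose K_1 is that of the scalars *)

Lemma fraction_clear_denominator (D : idomainType) (a : {fraction D}) :
  exists p n : D, p != 0 /\ FracField.tofrac p * a = FracField.tofrac n.
Proof.
elim/quotW: a => r; exists \d_r, \n_r; split; first exact: denom_ratioP.
unlock FracField.tofrac; rewrite -[LHS]FracField.pi_mul.
apply/eqmodP; rewrite /= FracField.equivfE.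
by rewrite !numden_Ratio ?oner_eq0 ?mul1r ?mulf_neq0 ?oner_eq0 ?denom_ratioP // mulr1 mulrC.
Qed.

Definition K1_scalar (G : monoidType) : Prop :=
  forall (K : fieldType) n (a : 'M[mring K G]_n), invertible_mx a ->
  exists2 u : K, u != 0 & K1class a = K1class ((mconst K G u)%:M : 'M_1).

Lemma K1_scalar_trivial (G : monoidType) : (forall g : G, g = 1%g) -> K1_scalar G.
Proof.
move=> G1 K n a inva; pose aug := augmentation K G.
have augK : cancel aug (mconst K G).
  move=> u; rewrite [in RHS](mring_trivialE u G1) [in LHS](mring_trivialE u G1) /aug.
  by rewrite mring_lift_const.
have [u u0 au] := K1class_field (invertible_mx_map aug inva); exists u => //.
rewrite -map_scalar_mx; apply: (K1class_retract augK) au => //.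
exact: (@invertible_mx_scalar_map _ _ idfun).
Qed.

Section Retract.
Variables (G H : monoidType) (phi : G -> H) (psi : H -> G).
Hypotheses (phi1 : phi 1%g = 1%g) (phiM : forall g h, phi (g * h)%g = (phi g * phi h)%g).
Hypotheses (psi1 : psi 1%g = 1%g) (psiM : forall g h, psi (g * h)%g = (psi g * psi h)%g).
Hypothesis phiK : cancel phi psi.

Lemma K1_scalar_retract : K1_scalar H -> K1_scalar G.
Proof.
move=> K1_H K n a inva.
pose Phi : {rmorphism mring K G -> mring K H} := mring_map idfun phi1 phiM.
pose Psi : {rmorphism mring K H -> mring K G} := mring_map idfun psi1 psiM.
have PhiK : cancel Phi Psi.
  elim/mring_ind=> [u v uE vE|g b]; first by rewrite !rmorphD uE vE.
  by rewrite /Psi /Phi !mring_map_monom phiK.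
have [u u0 au] := K1_H K n _ (invertible_mx_map Phi inva); exists u => //.
have <- : Psi (mconst K H u) = mconst K G u by rewrite /Psi mring_map_monom psi1.
by rewrite -map_scalar_mx; apply: (K1class_retract PhiK) au; first exact: inva;
  exact: invertible_mx_scalar_map.
Qed.

End Retract.

Section BicyclicStep.
Variable G : monoidType.

Section Currying.
Variable R : pzRingType.

Definition curry_monom (p : bicyclic * G) : toeplitz (mring R G) := monom p.1 (monom p.2 1).

Fact curry_monom1 : curry_monom 1%g = 1. Proof. by []. Qed.
Fact curry_monomM p q : curry_monom (p * q)%g = curry_monom p * curry_monom q.
Proof. by rewrite /curry_monom !monomM mulr1. Qed.
Fact curry_monom_comm a p :
  GRing.comm (mconst (mring R G) bicyclic (mconst R G a)) (curry_monom p).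
Proof. by rewrite /GRing.comm !monomM !mul1g !mulg1 mul1r mulr1. Qed.

Definition mring_curry : {rmorphism mring R (bicyclic * G)%type -> toeplitz (mring R G)} :=
  mring_lift (f := mconst _ _ \o mconst R G) curry_monom1 curry_monomM curry_monom_comm.

Fact uncurry_inr1 : ((1, 1) : bicyclic * G)%g = 1%g. Proof. by []. Qed.
Fact uncurry_inrM (g h : G) :
  ((1%g, (g * h)%g) : bicyclic * G) = (((1%g, g) : bicyclic * G) * (1%g, h))%g.
Proof. by []. Qed.
Fact uncurry_monomM (b c : bicyclic) :
  monom ((b * c)%g, 1%g : G) (1 : R) = monom (b, 1%g) 1 * monom (c, 1%g) 1.
Proof. by rewrite monomM mulr1; congr (@monom _ _ _ _); congr (_, _); rewrite /= mul1g. Qed.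

Definition mring_inr : {rmorphism mring R G -> mring R (bicyclic * G)%type} :=
  @mring_map R R G (bicyclic * G)%type idfun (pair 1%g) uncurry_inr1 uncurry_inrM.

Fact uncurry_comm (u : mring R G) (b : bicyclic) :
  GRing.comm (mring_inr u) (monom (b, 1%g) 1).
Proof.
elim/mring_ind: u => [u v ub vb|g a].
  by rewrite rmorphD; apply/commr_sym/commrD; apply/commr_sym.
rewrite mring_map_monom /GRing.comm !monomM mulr1 mul1r; congr (@monom _ _ _ _).
by congr (_, _); rewrite /= ?mul1g ?mulg1.
Qed.

Definition mring_uncurry : {rmorphism toeplitz (mring R G) -> mring R (bicyclic * G)%type} :=
  mring_lift (f := mring_inr) (phi := fun b => monom (b, 1%g) 1) erefl uncurry_monomM uncurry_comm.

Lemma mring_curryK : cancel mring_curry mring_uncurry.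
Proof.
elim/mring_ind=> [u v uE vE|[b g] a]; first by rewrite !rmorphD uE vE.
rewrite mring_lift_monom monomM mul1g mring_lift_monom monomM mul1g mulr1.
rewrite mring_map_monom monomM mulr1; congr (@monom _ _ _ _).
by congr (_, _); rewrite /= ?mul1g ?mulg1.
Qed.
End Currying.
Lemma symbol_augmentation (K : fieldType) (w : toeplitz (mring K G)) :
  symbol K (mring_map_coef bicyclic (augmentation K G) w) =
  mring_map_coef infinite_cyclic (augmentation K G) (symbol _ w).
Proof.
elim/toeplitz_ind: w => [u v uE vE|i j a]; first by rewrite !rmorphD uE vE.
by rewrite /mring_map_coef symbol_tmonom !mring_map_monom.
Qed.

Lemma field_stably_finite (K : fieldType) : stably_finite K.
Proof. by move=> n a b; apply: mulmx1C. Qed.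

Lemma K1class_toeplitz (K : fieldType) n (a : 'M[toeplitz (mring K G)]_n) :
  K1_scalar G -> invertible_mx a ->
  exists2 l : K, l != 0 & K1class a = K1class ((mconst _ bicyclic (mconst K G l))%:M : 'M_1).
Proof.
move=> K1_G inva.
have tofrac_inj : injective (@FracField.tofrac {poly K}).
  by apply: raddf_inj => p /eqP; rewrite tofrac_eq0 => /eqP.
have invsa := invertible_mx_map (symbol (mring K G)) inva.
have [l [k [l0 ak]]] := K1class_laurent tofrac_inj (@fraction_clear_denominator _) (K1_G _) invsa.
pose aug (A : monoidType) := mring_map_coef A (augmentation K G).
have symbol_aug_a : map_mx (symbol K) (map_mx (aug bicyclic) a) =
    map_mx (aug infinite_cyclic) (map_mx (symbol _) a).
  by apply/matrixP=> i j; rewrite !mxE symbol_augmentation.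
have invl q : invertible_mx ((lmonom q (mconst K G l))%:M : 'M_1).
  exists (lmonom (- q) (mconst K G l^-1))%:M; apply: inverse_mx_lmonom;
    by rewrite -rmorphM ?divff ?mulVf ?rmorph1.
have k0 : k = 0.
  apply: (K1class_symbol_degree0 (@field_stably_finite K) (divff l0) (mulVf l0)
    (invertible_mx_map (aug bicyclic) inva)).
  rewrite symbol_aug_a (K1class_map_eq _ _ _ ak) //.
  by rewrite map_scalar_mx /aug mring_map_monom mring_lift_const.
exists l => //; apply: K1class_symbol_inj => //.
  exact: invertible_mx_scalar_map (mconst _ _ \o mconst K G) _ _ l0.
by rewrite ak k0 map_scalar_mx symbol_tmonom subr0.
Qed.

Theorem K1_scalar_bicyclic : K1_scalar G -> K1_scalar (bicyclic * G)%type.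
Proof.
move=> K1_G K n a inva.
have [l l0 al] := K1class_toeplitz K1_G (invertible_mx_map (@mring_curry K) inva).
exists l => //; have <- : mring_uncurry K (mconst _ bicyclic (mconst K G l)) = mconst K _ l.
  by rewrite mring_lift_monom mring_map_monom monomM mulr1 mul1g.
rewrite -map_scalar_mx; apply: (K1class_retract (@mring_curryK K)) al => //.
exact: invertible_mx_scalar_map (mconst _ _ \o mconst K G) _ _ l0.
Qed.

End BicyclicStep.

Lemma K1_scalar_bicyclic_power m : K1_scalar {ffun 'I_m -> bicyclic}.
Proof.
elim: m => [|m IHm].
  by apply: K1_scalar_trivial => g; apply/ffunP => -[].
pose split_ord0 (p : {ffun 'I_m.+1 -> bicyclic}) : bicyclic * {ffun 'I_m -> bicyclic} :=
  (p ord0, [ffun i => p (lift ord0 i)]).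
pose join_ord0 (p : bicyclic * {ffun 'I_m -> bicyclic}) : {ffun 'I_m.+1 -> bicyclic} :=
  [ffun i => oapp p.2 p.1 (unlift ord0 i)].
apply: (@K1_scalar_retract _ _ split_ord0 join_ord0); last exact: K1_scalar_bicyclic.
- by congr (_, _); [rewrite ffunE|apply/ffunP=> i; rewrite !ffunE].
- by move=> p q; congr (_, _); [rewrite ffunE|apply/ffunP=> i; rewrite !ffunE].
- by apply/ffunP=> i; rewrite !ffunE; case: unliftP => [j|] _ //=; rewrite ffunE.
- by move=> p q; apply/ffunP=> i; rewrite !ffunE; case: unliftP => [j|] _ //=; rewrite ffunE.
- by move=> p; apply/ffunP=> i; rewrite !ffunE; case: unliftP => [j|] -> //=; rewrite ffunE.
Qed.

Section Evaluation.
Variable S : pzRingType.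

Lemma prodrM_comm_neq (I : eqType) (r : seq I) (F G : I -> S) : uniq r ->
  (forall i j, i != j -> GRing.comm (F i) (G j)) ->
  \prod_(i <- r) (F i * G i) = (\prod_(i <- r) F i) * \prod_(i <- r) G i.
Proof.
move=> + FG; elim: r => [|k r IHr] /=; first by rewrite !big_nil mulr1.
case/andP=> kr /IHr prodFG; rewrite !big_cons prodFG -!mulrA; congr (_ * _).
rewrite !mulrA; congr (_ * _); rewrite big_seq; apply: commr_prod => i ir.
by apply/commr_sym/FG; apply: contraNneq kr => <-.
Qed.

Definition bicyclic_eval (x y : S) (p : bicyclic) : S := x ^+ p.1 * y ^+ p.2.

Lemma exprM_linv (x y : S) j k : y * x = 1 -> y ^+ j * x ^+ k = x ^+ (k - j) * y ^+ (j - k).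
Proof.
move=> yx; elim: j k => [|j IHj] [|k];
  rewrite ?expr0 ?mul1r ?mulr1 ?subn0 ?sub0n ?expr0 ?mulr1 ?mul1r //.
by rewrite exprSr exprS mulrA -(mulrA _ y) yx mulr1 IHj subSS.
Qed.

Lemma bicyclic_evalM (x y : S) p q : y * x = 1 ->
  bicyclic_eval x y (p * q)%g = bicyclic_eval x y p * bicyclic_eval x y q.
Proof.
case: p q => [i j] [k l] yx; rewrite bicyclic_mulE /bicyclic_eval /= exprD (addnC l) exprD.
by rewrite -!mulrA; congr (_ * _); rewrite [RHS]mulrA (exprM_linv j k yx) -mulrA.
Qed.

Lemma bicyclic_eval_comm (x y x' y' : S) p q :
  GRing.comm x x' -> GRing.comm x y' -> GRing.comm y x' -> GRing.comm y y' ->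
  GRing.comm (bicyclic_eval x y p) (bicyclic_eval x' y' q).
Proof.
move=> xx xy yx yy; apply: commrM; apply: commrX; apply/commr_sym/commrM;
  exact/commrX/commr_sym.
Qed.

Variables (m : nat) (x y : 'I_m -> S).
Hypothesis xy : Sm_relations x y.

Definition ffun_eval (p : {ffun 'I_m -> bicyclic}) : S :=
  \prod_i bicyclic_eval (x i) (y i) (p i).

Fact ffun_eval1 : ffun_eval 1%g = 1.
Proof. by apply: big1 => i _; rewrite ffunE /bicyclic_eval !expr0 mulr1. Qed.

Fact ffun_evalM p q : ffun_eval (p * q)%g = ffun_eval p * ffun_eval q.
Proof.
rewrite /ffun_eval -prodrM_comm_neq ?index_enum_uniq // => [|i j ij].
  by apply: eq_bigr => i _; rewrite ffunE bicyclic_evalM // xy.1.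
have [xiyj xx yy] := xy.2 i j ij; have [xjyi _ _] := xy.2 j i (contra_neq esym ij).
by apply: bicyclic_eval_comm => //; apply: esym.
Qed.

Definition bicyclic_inj (i : 'I_m) (b : bicyclic) : {ffun 'I_m -> bicyclic} :=
  [ffun j => if j == i then b else 1%g].

Lemma ffun_eval_inj i b : ffun_eval (bicyclic_inj i b) = bicyclic_eval (x i) (y i) b.
Proof.
have <- : \prod_(j | j == i) bicyclic_eval (x j) (y j) b = bicyclic_eval (x i) (y i) b.
  by rewrite big_pred1_eq.
rewrite [RHS]big_mkcond; apply: eq_bigr => j _; rewrite ffunE; case: ifP => // _.
by rewrite /bicyclic_eval !expr0 mulr1.
Qed.

End Evaluation.

Lemma bicyclic_injM m (i : 'I_m) b c :
  (bicyclic_inj i b * bicyclic_inj i c)%g = bicyclic_inj i (b * c)%g.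
Proof. by apply/ffunP=> j; rewrite !ffunE; case: ifP => // _; rewrite mulg1. Qed.

Lemma bicyclic_inj_commute m (i j : 'I_m) b c : i != j ->
  commute (bicyclic_inj i b) (bicyclic_inj j c).
Proof.
move=> ij; apply/ffunP=> k; rewrite !ffunE.
by case: eqP => [->|_]; [rewrite (negbTE ij) mulg1 mul1g|case: ifP; rewrite ?mulg1 ?mul1g].
Qed.

(** * The algebra S_m *)

Section PresentedAlgebra.
Variables (K : fieldType) (m : nat) (S : algType K) (x y : 'I_m -> S).
Hypothesis HS : is_Sm x y.
Local Notation B := (mring K {ffun 'I_m -> bicyclic}).

Fact in_alg_comm (a : K) p : GRing.comm (GRing.in_alg S a) (ffun_eval x y p).
Proof. by rewrite /GRing.comm mulr_algl mulr_algr. Qed.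

Definition evaluation : B -> S :=
  mring_lift (f := GRing.in_alg S) (ffun_eval1 x y) (ffun_evalM HS.1) in_alg_comm.
HB.instance Definition _ := GRing.RMorphism.on evaluation.

Fact evaluation_scalable : scalable evaluation.
Proof.
move=> a u; rewrite mring_scaleE /evaluation rmorphM mring_lift_const.
by rewrite -[RHS]mulr_algl.
Qed.
HB.instance Definition _ := GRing.isScalable.Build K B S *:%R evaluation evaluation_scalable.

Lemma evaluation_inj i b : evaluation (monom (bicyclic_inj i b) 1) = bicyclic_eval (x i) (y i) b.
Proof. by rewrite /evaluation mring_lift_monom rmorph1 mul1r ffun_eval_inj. Qed.

Lemma bicyclic_relations :
  Sm_relations (fun i => monom (bicyclic_inj i (1, 0)%N) 1 : B)
               (fun i => monom (bicyclic_inj i (0, 1)%N) 1 : B).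
Proof.
split=> [i|i j ij].
  rewrite monomM mulr1 bicyclic_injM; congr (@monom _ _ _ _).
  by apply/ffunP=> j; rewrite !ffunE; case: ifP.
by split; rewrite !monomM !mulr1; congr (@monom _ _ _ _); apply: bicyclic_inj_commute.
Qed.

Lemma evaluation_section : exists f : {lrmorphism S -> B}, cancel f evaluation.
Proof.
have [f [f_gen _]] := HS.2 B _ _ bicyclic_relations; exists f => s.
have [h [_ h_unique]] := HS.2 S x y HS.1.
have evalf_h : (evaluation \o f) s = h s.
  apply: (h_unique (evaluation \o f : {lrmorphism S -> S})) => i /=.
  have [-> ->] := f_gen i; rewrite !evaluation_inj /bicyclic_eval.
  by rewrite !expr0 mul1r mulr1.
by rewrite -[LHS]/((evaluation \o f) s) evalf_h -(h_unique idfun).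
Qed.

Theorem K1class_Sm n (a : 'M[S]_n) : invertible_mx a ->
  exists2 l : K, l != 0 & K1class a = K1class (l%:A%:M : 'M[S]_1).
Proof.
move=> inva; have [f fK] := evaluation_section.
have [l l0 al] := K1_scalar_bicyclic_power (invertible_mx_map f inva).
exists l => //; rewrite (K1class_retract fK inva _ al); last exact: invertible_mx_scalar_map.
by rewrite map_scalar_mx /= /evaluation mring_lift_const.
Qed.

End PresentedAlgebra.

Section ReducedDeterminant.
Variables (K : fieldType) (S : algType K) (L : comUnitAlgType K) (pi : {lrmorphism S -> L}).
Implicit Type l : K.

Lemma detbarM n (a b : 'M[S]_n) : detbar pi (a *m b) = detbar pi a * detbar pi b.
Proof. by rewrite /detbar map_mxM det_mulmx. Qed.

Lemma detbar1 n : detbar pi (1%:M : 'M[S]_n) = 1.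
Proof. by rewrite /detbar map_mx1 det1. Qed.

Lemma detbar_dsum1 n k (a : 'M[S]_n) : detbar pi (a <+> 1%:M : 'M[S]_(n + k)) = detbar pi a.
Proof. by rewrite /detbar map_block_mx !map_mx0 map_mx1 det_dsum1. Qed.

Lemma detbar_Einf n (a : 'M[S]_n) : in_Einf a -> detbar pi a = 1.
Proof. by case=> k Ea; rewrite -(detbar_dsum1 k) [LHS](det_Eprod (Eprod_map pi Ea)). Qed.

Lemma K1class_detbar n p (a : 'M[S]_n) (b : 'M[S]_p) : invertible_mx a -> invertible_mx b ->
  K1class a = K1class b -> detbar pi a = detbar pi b.
Proof.
by move=> inva invb ab; apply: K1class_det; [apply: invertible_mx_map..|apply: K1class_map_eq].
Qed.

Lemma mu_dsum n l : mu S n l = (l%:A%:M <+> 1%:M : 'M[S]_(1 + n)).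
Proof.
suff muE (i j : 'I_(1 + n)) : mu S n l i j = (l%:A%:M <+> 1%:M : 'M[S]_(1 + n)) i j.
  by apply/matrixP => i j; apply: muE.
rewrite mxE; case: (split_ordP i) => i' ->; case: (split_ordP j) => j' ->.
- by rewrite block_mxEul !ord1 mxE eqxx.
- by rewrite block_mxEur mxE -!val_eqE !ord1.
- by rewrite block_mxEdl mxE -!val_eqE !ord1.
- by rewrite block_mxEdr mxE -!val_eqE /= !add1n eqSS; case: eqP.
Qed.

Lemma inverse_mx_mu n l : l != 0 -> inverse_mx (mu S n l) (mu S n l^-1).
Proof.
move=> l0; have ll' : inverse_mx (l%:A%:M : 'M[S]_1) l^-1%:A%:M.
  by apply: inverse_mx_scalar; rewrite -(rmorphM (GRing.in_alg S)) ?divff ?mulVf ?rmorph1.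
by have := inverse_mx_dsum ll' (inverse_mx1 S n); rewrite -!mu_dsum.
Qed.

Lemma invertible_mx_mu n l : l != 0 -> invertible_mx (mu S n l).
Proof. by move=> l0; exists (mu S n l^-1); apply: inverse_mx_mu. Qed.

Lemma detbar_scalar l : detbar pi (l%:A%:M : 'M[S]_1) = l%:A.
Proof. by rewrite /detbar map_scalar_mx det_scalar1; apply: rmorph_alg. Qed.

Lemma detbar_mu n l : detbar pi (mu S n l) = l%:A.
Proof. by rewrite mu_dsum; apply: etrans (detbar_dsum1 _ _) (detbar_scalar l). Qed.

Variables (m : nat) (x y : 'I_m -> S).
Hypothesis HS : is_Sm x y.

Lemma detbar_K1class n (a : 'M[S]_n) : invertible_mx a ->
  exists l, [/\ l != 0, detbar pi a = l%:A & K1class a = K1class (l%:A%:M : 'M[S]_1)].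
Proof.
move=> inva; have [l l0 al] := K1class_Sm HS inva; exists l; split=> //.
rewrite -detbar_scalar; apply: K1class_detbar al => //.
exact: (invertible_mx_scalar_map (GRing.in_alg S)).
Qed.

Lemma in_Einf_detbar n (a : 'M[S]_n) : invertible_mx a -> in_Einf a <-> detbar pi a = 1.
Proof.
move=> inva; split=> [|a1]; first exact: detbar_Einf.
apply/(K1class_eq0 inva); have [l [_ al ->]] := detbar_K1class inva.
have {al a1}-> : l = 1 by apply: (fmorph_inj (GRing.in_alg L)); rewrite /= -al a1 scale1r.
by rewrite scale1r K1class1.
Qed.

Lemma in_Einf_mulV n (a b b' : 'M[S]_n) : invertible_mx a -> inverse_mx b b' ->
  in_Einf (a *m b') <-> detbar pi a = detbar pi b.
Proof.
move=> inva [bb' b'b]; have invb' : invertible_mx b' by exists b.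
rewrite (in_Einf_detbar (invertible_mxM inva invb')) detbarM; split=> [ab'|->].
  by rewrite -[LHS]mulr1 -(detbar1 n) -b'b detbarM mulrA ab' mul1r.
by rewrite -detbarM bb' detbar1.
Qed.

Lemma in_Einf_muV n (a : 'M[S]_n.+1) l : invertible_mx a -> l != 0 -> detbar pi a = l%:A ->
  in_Einf (mu S n l^-1 *m a).
Proof.
move=> inva l0 al; have invl : invertible_mx (mu S n l^-1).
  by apply: invertible_mx_mu; rewrite invr_eq0.
apply/in_Einf_detbar; first exact: invertible_mxM.
by rewrite detbarM al detbar_mu -(rmorphM (GRing.in_alg L)) mulVf ?rmorph1.
Qed.

Lemma mu_mul_Einf_inj n (e : 'M[S]_n.+1) l l' : in_Einf e ->
  detbar pi (mu S n l' *m e) = l%:A -> l' = l.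
Proof.
move=> Ee; rewrite detbarM detbar_mu detbar_Einf // mulr1.
exact: (fmorph_inj (GRing.in_alg L)).
Qed.

End ReducedDeterminant.

Theorem theorem4p5 (K : fieldType) (m : nat) (m_ge1 : (1 <= m)%N)
    (S : algType K) (x y : 'I_m -> S) (HS : is_Sm x y)
    (L : comUnitAlgType K) (X : 'I_m -> L) (HL : is_Laurent X)
    (pi : {lrmorphism S -> L})
    (Hpix : forall i, pi (x i) = X i) (Hpiy : forall i, pi (y i) = (X i)^-1) :
  (* (1) detbar : GL_oo(S_m) -> L_m^* takes values in K^* ... *)
  (forall (n : nat) (a : 'M[S]_n.+1), invertible_mx a ->
     exists l : K, l != 0 /\ detbar pi a = l%:A) /\
  (* ... is well defined on GL_oo (compatible with a |-> diag(a,1)) ... *)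
  (forall (n k : nat) (a : 'M[S]_n.+1), invertible_mx a ->
     detbar pi (block_mx a 0 0 1%:M : 'M[S]_(n.+1 + k)) = detbar pi a) /\
  (* ... is a group homomorphism ... *)
  (forall (n : nat) (a b : 'M[S]_n.+1), invertible_mx a -> invertible_mx b ->
     detbar pi (a *m b) = detbar pi a * detbar pi b) /\
  (* ... is surjective onto K^* ... *)
  (forall l : K, l != 0 ->
     exists (n : nat) (a : 'M[S]_n.+1), invertible_mx a /\ detbar pi a = l%:A) /\
  (* ... with kernel E_oo(S_m) ... *)
  (forall (n : nat) (a : 'M[S]_n.+1), invertible_mx a ->
     (in_Einf a <-> detbar pi a = 1)) /\
  (* ... and every a is uniquely a = mu(l) e with l = detbar a in K^*, e in E_oo. *)
  (forall (n : nat) (a : 'M[S]_n.+1), invertible_mx a ->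
     exists (l : K) (e : 'M[S]_n.+1),
       [/\ l != 0, detbar pi a = l%:A, in_Einf e, a = mu S n l *m e &
         forall (l' : K) (e' : 'M[S]_n.+1),
           l' != 0 -> in_Einf e' -> a = mu S n l' *m e' -> l' = l /\ e' = e]) /\
  (* (2) K_1(S_m) = GL_oo/E_oo is isomorphic to K^* via detbar: two elements of
     GL_oo have the same class in K_1 iff they have the same detbar. *)
  (forall (n : nat) (a b b' : 'M[S]_n.+1), invertible_mx a ->
     b *m b' = 1%:M -> b' *m b = 1%:M ->
     (in_Einf (a *m b') <-> detbar pi a = detbar pi b)).
Proof.
split=> [n a /(detbar_K1class pi HS)[l [l0 al _]]|]; first by exists l.
split=> [n k a _|]; first exact: detbar_dsum1.
split=> [n a b _ _|]; first exact: detbarM.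
split=> [l l0|].
  by exists 0%N, (mu S 0 l); split; [apply: invertible_mx_mu|apply: detbar_mu].
split=> [n a inva|]; first exact: (in_Einf_detbar pi HS).
split=> [n a inva|n a b b' inva bb' b'b]; last exact: (in_Einf_mulV pi HS).
have [l [l0 al _]] := detbar_K1class pi HS inva; have [ll' l'l] := inverse_mx_mu S n l0.
exists l, (mu S n l^-1 *m a); split=> //.
- exact: (in_Einf_muV HS inva l0 al).
- by rewrite (mulKmx_inverse _ ll').
- move=> l' e' _ Ee' aE; have l'E : l' = l by apply: (mu_mul_Einf_inj (pi := pi) Ee'); rewrite -aE.
  by rewrite l'E aE l'E (mulKmx_inverse _ l'l).
Qed.
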